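(* Let $(x_0,u_0)$ be a Pareto optimal solution of the multiobjective Bolza problem $(\mathcal B)$. Assume: (a) for each $i\in\{1,\dots,l\}$, $f_i^0$ is continuous on $[0,T]\times\Omega\times U$; $D_{G,2}f_i^0(t,\xi,\zeta)$ exists for all $(t,\xi,\zeta)\in[0,T]\times\Omega\times U$; $D_{F,2}f_i^0(t,x_0(t),\zeta)$ exists for all $(t,\zeta)\in[0,T]\times U$; $(t,\zeta)\mapsto D_{F,2}f_i^0(t,x_0(t),\zeta)$ is continuous from $[0,T]\times U$ to $E^*$; and for all non-empty compact $K\subset\Omega$, $M\subset U$, $\sup_{[0,T]\times K\times M}\|D_{G,2}f_i^0(t,\xi,\zeta)\|_{\mathcal L}<+\infty$; (b) $f$ is continuous on $[0,T]\times\Omega\times U$; $D_{G,2}f(t,\xi,\zeta)$ exists for all $(t,\xi,\zeta)\in[0,T]\times\Omega\times U$; $D_{F,2}f(t,x_0(t),\zeta)$ exists for all $(t,\zeta)\in[0,T]\times U$; $(t,\zeta)\mapsto D_{F,2}f(t,x_0(t),\zeta)$ is continuous from $[0,T]\times U$ to $\mathcal L(E,E)$; and for all non-empty compact $K\subset\Omega$, $M\subset U$, $\sup_{[0,T]\times K\times M}\|D_{G,2}f(t,\xi,\zeta)\|_{\mathcal L}<+\infty$; (c) all $g_i^0$ and all $g^\alpha$ are Hadamard differentiable at $x_0(T)$; (d) each $h^\beta$ is continuous on a neighborhood of $x_0(T)$ and Hadamard differentiable at $x_0(T)$; (e) $U$ is a subset of a real normed vector space $Y$ such that $U$ is a neighborhood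 of $u_0(T)$ in $Y$, $D_{G,3}f(T,x_0(T),u_0(T))$ exists, and the $m+q$ functionals $D_Hg^\alpha(x_0(T))\circ D_{G,3}f(T,x_0(T),u_0(T))$ ($1\le\alpha\le m$), $D_Hh^\beta(x_0(T))\circ D_{G,3}f(T,x_0(T),u_0(T))$ ($1\le\beta\le q$) form a linearly independent family in $Y^*$. Then there exist $((\theta_i)_{1\le i\le l},(\lambda_\alpha)_{1\le\alpha\le m},(\mu_\beta)_{1\le\beta\le q},p)\in\mathbb R^l\times\mathbb R^m\times\mathbb R^q\times PC^1([0,T],E^* )$ satisfying the Pontryagin conditions (NN), (Si), (S$\ell$), (TC), (AE.B), (MP.B), (CH.B) listed in the context, and for every such tuple, $(\theta_i)_{1\le i\le l}\ne0$.
   Context: Function spaces. Fix $T\in(0,+\infty)$. Let $Y$ be a Hausdorff space. A function $u:[0,T]\to Y$ is piecewise continuous if there is a subdivision $0=\tau_0<\tau_1<\dots<\tau_{k+1}=T$ such that $u$ is continuous on each $(\tau_i,\tau_{i+1})$, the right limits $u(\tau_i+)$ exist in $Y$ for $0\le i\le k$ and the left limits $u(\tau_i-)$ exist in $Y$ for $1\le i\le k+1$. $NPC^0([0,T],Y)$ is the set of piecewise continuous $u$ that are right continuous on $[0,T)$ and satisfy $u(T-)=u(T)$. If $Y$ is a real Banach space, $PC^1([0,T],Y)$ is the set of continuous $x:[0,T]\to Y$ for which there is a subdivision as before such that $x$ is continuously differentiable on each $(\tau_i,\tau_{i+1})$ and the one-sided limits $x'(\tau_i+)$ ($0\le i\le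 k$), $x'(\tau_i-)$ ($1\le i\le k+1$) exist in $Y$; for open $G\subset Y$, $PC^1([0,T],G)=\{x\in PC^1([0,T],Y): x([0,T])\subset G\}$. The extended derivative $\underline{d}x:[0,T]\to Y$ of such $x$ is $\underline{d}x(t)=x'(t)$ if $t\notin\{\tau_0,\dots,\tau_{k+1}\}$, $\underline{d}x(\tau_i)=x'(\tau_i+)$ for $0\le i\le k$, $\underline{d}x(T)=x'(T-)$. Differentials. For real normed spaces $X,Y$, $\mathcal L(X,Y)$ is the space of bounded linear maps with operator norm $\|\cdot\|_{\mathcal L}$ and $X^*=\mathcal L(X,\mathbb R)$. Let $G\subset X$ be non-empty open (or a neighborhood of the point considered), $\mathfrak f:G\to Y$, $x\in G$. $\mathfrak f$ is Gâteaux differentiable at $x$ if there is $D_G\mathfrak f(x)\in\mathcal L(X,Y)$ with $\lim_{t\to0+}\frac{\mathfrak f(x+th)-\mathfrak f(x)}{t}=D_G\mathfrak f(x)\cdot h$ for all $h\in X$; it is Hadamard differentiable at $x$ if there is $D_H\mathfrak f(x)\in\mathcal L(X,Y)$ such that for each compact $K\subset X$, $\lim_{t\to0+}\sup_{h\in K}\|\frac{\mathfrak f(x+th)-\mathfrak f(x)}{t}-D_H\mathfrak f(x)\cdot h\|=0$. $D_F\mathfrak f(x)$ is the Fréchet differential. $D_{G,k}$, $D_{F,k}$ denote partial Gâteaux/Fréchet differentials with respect to the $k$-th variable ($D_{G,3}f(t,\xi,\zeta)$ is the Gâteaux differential at $\zeta$ of $f(t,\xi,\cdot)$). Problem. $E$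 is a real Banach space, $\Omega\subset E$ a non-empty open subset, $U$ a Hausdorff topological space, $\xi_0\in\Omega$, $l,m,q$ positive integers, $f:[0,T]\times\Omega\times U\to E$, $f_i^0:[0,T]\times\Omega\times U\to\mathbb R$, and $g_i^0,g^\alpha,h^\beta:\Omega\to\mathbb R$ ($1\le i\le l$, $1\le\alpha\le m$, $1\le\beta\le q$). The multiobjective Bolza problem $(\mathcal B)$ is: maximize $(J_1(x,u),\dots,J_l(x,u))$, $J_i(x,u)=g_i^0(x(T))+\int_0^Tf_i^0(t,x(t),u(t))\,dt$, over $x\in PC^1([0,T],\Omega)$, $u\in NPC^0([0,T],U)$ subject to $\underline{d}x(t)=f(t,x(t),u(t))$ for all $t\in[0,T]$, $x(0)=\xi_0$, $g^\alpha(x(T))\ge0$ for all $\alpha$, $h^\beta(x(T))=0$ for all $\beta$. Pairs $(x,u)$ satisfying these constraints are admissible. An admissible $(\overline x,\overline u)$ is a Pareto optimal solution if there is no admissible $(x,u)$ with $J_i(x,u)\ge J_i(\overline x,\overline u)$ for all $i$ and $J_{i_0}(x,u)>J_{i_0}(\overline x,\overline u)$ for some $i_0$. Hamiltonian: $H_B:[0,T]\times\Omega\times U\times E^*\times\mathbb R^l\to\mathbb R$, $H_B(t,x,u,p,\theta)=\sum_{i=1}^l\theta_if_i^0(t,x,u)+p\cdot f(t,x,u)$. Pontryagin conditions for $(\theta=(\theta_i),(\lambda_\alpha),(\mu_\beta),p)$ at $(x_0,u_0)$: (NN) $((\theta_i)_i,(\lambda_\alpha)_\alpha,(\mu_\beta)_\beta)\ne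 0$; (Si) $\theta_i\ge0$ for all $i$ and $\lambda_\alpha\ge 0$ for all $\alpha$; (S$\ell$) $\lambda_\alpha g^\alpha(x_0(T))=0$ for all $\alpha$; (TC) $\sum_{i=1}^l\theta_iD_Hg_i^0(x_0(T))+\sum_{\alpha=1}^m\lambda_\alpha D_Hg^\alpha(x_0(T))+\sum_{\beta=1}^q\mu_\beta D_Hh^\beta(x_0(T))=p(T)$; (AE.B) $\underline{d}p(t)=-D_{F,2}H_B(t,x_0(t),u_0(t),p(t),\theta)$ for all $t\in[0,T]$; (MP.B) $H_B(t,x_0(t),u_0(t),p(t),\theta)\ge H_B(t,x_0(t),\zeta,p(t),\theta)$ for all $t\in[0,T]$, $\zeta\in U$; (CH.B) $t\mapsto H_B(t,x_0(t),u_0(t),p(t),\theta)$ is continuous on $[0,T]$. *)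

(* Defs.v *)
From HB Require Import structures.
From mathcomp Require Import all_boot all_order all_algebra.
From mathcomp Require Import all_classical all_reals all_analysis.

Set Implicit Arguments.
Unset Strict Implicit.
Unset Printing Implicit Defensive.

Import Order.TTheory GRing.Theory Num.Theory.
Import numFieldNormedType.Exports.

Local Open Scope classical_set_scope.
Local Open Scope ring_scope.

Section BoundedLinear.
Context {R : realType} {X Y : normedModType R}.

(* For a linear map between normed spaces, continuous and bounded are the same
   (linear_bounded_continuous). *)
Definition bounded_linear : {pred X -> Y} :=
  mem [set f : X -> Y | linear f /\ continuous f].

Record blin := BLin {
  blin_fun :> X -> Y ;
  blin_subproof : blin_fun \in bounded_linear
}.

HB.instance Definition _ := [isSub for blin_fun].
HB.instance Definition _ := [Choice of blin by <:].

Lemma blin_linear (f : blin) : linear f.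
Proof. by have /set_mem[] := blin_subproof f. Qed.

Lemma blin_continuous (f : blin) : continuous f.
Proof. by have /set_mem[] := blin_subproof f. Qed.

HB.instance Definition _ (f : blin) :=
  GRing.isLinear.Build R X Y *:%R f (@blin_linear f).

Lemma bounded_linear_submod_closed : submod_closed bounded_linear.
Proof.
split=> [|a f g /set_mem[lf cf] /set_mem[lg cg]]; apply/mem_set.
  split; last exact: cst_continuous.
  by move=> a x y; rewrite /= scaler0 addr0.
split.
  move=> b x y; rewrite !fctE lf lg !scalerDr !scalerA mulrC.
  by rewrite addrACA.
by move=> x; apply: cvgD; [apply: cvgZr; exact: cf|exact: cg].
Qed.

HB.instance Definition _ := GRing.isSubmodClosed.Build R (X -> Y)
  bounded_linear bounded_linear_submod_closed.
HB.instance Definition _ := [SubChoice_isSubLmodule of blin by <:].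

Definition opnorm (f : blin) : R := sup [set `|f x| | x in [set x | `|x| <= 1]].

Lemma opnorm_has_sup (f : blin) : has_sup [set `|f x| | x in [set x | `|x| <= 1]].
Proof.
split; first by exists `|f 0|; exists 0 => //=; rewrite normr0.
have /linear_bounded_continuous/bounded_funP/(_ 1)[M fM] := @blin_continuous f.
by exists M => _ [x /= x1 <-]; exact: fM.
Qed.

Lemma opnorm_ge0 (f : blin) : 0 <= opnorm f.
Proof.
rewrite -(normr0 Y) -(linear0 f).
apply: ub_le_sup; first by case: (opnorm_has_sup f).
by exists 0 => //=; rewrite normr0.
Qed.

Lemma le_opnorm (f : blin) x : `|f x| <= opnorm f * `|x|.
Proof.
have [->|x0] := eqVneq x 0; first by rewrite linear0 !normr0 mulr0.
rewrite -ler_pdivrMr ?normr_gt0//.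
apply: ub_le_sup; first by case: (opnorm_has_sup f).
exists (`|x|^-1 *: x) => /=.
  by rewrite normrZ normfV normr_id mulVf ?normr_eq0.
by rewrite linearZ/= normrZ normfV normr_id mulrC.
Qed.

Lemma opnorm_le (f : blin) c :
  (forall x, `|x| <= 1 -> `|f x| <= c) -> opnorm f <= c.
Proof.
move=> fc; apply: ge_sup; first by case: (opnorm_has_sup f).
by move=> _ [x /= x1 <-]; exact: fc.
Qed.

Lemma opnormD (f g : blin) : opnorm (f + g) <= opnorm f + opnorm g.
Proof.
apply: opnorm_le => x x1.
apply: le_trans (ler_normD _ _) _.
by apply: lerD; apply: le_trans (le_opnorm _ _) _;
  rewrite ler_piMr// opnorm_ge0.
Qed.

Lemma opnormZ (a : R) (f : blin) : opnorm (a *: f) = `|a| * opnorm f.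
Proof.
have le b (g : blin) : opnorm (b *: g) <= `|b| * opnorm g.
  apply: opnorm_le => x x1; rewrite /= [X in `|X|](_ : _ = b *: g x)//.
  rewrite normrZ ler_wpM2l//; apply: le_trans (le_opnorm _ _) _.
  by rewrite ler_piMr// opnorm_ge0.
apply/eqP; rewrite eq_le le/=.
have [->|a0] := eqVneq a 0; first by rewrite normr0 mul0r opnorm_ge0.
rewrite -ler_pdivlMl ?normr_gt0//.
by have := le a^-1 (a *: f); rewrite scalerA mulVf// scale1r normfV.
Qed.

Lemma opnorm_eq0 (f : blin) : opnorm f = 0 -> f = 0.
Proof.
move=> f0; apply/val_inj/funext => x /=; apply/eqP; rewrite -normr_le0.
by have := le_opnorm f x; rewrite f0 mul0r.
Qed.

HB.instance Definition _ :=
  Lmodule_isNormed.Build R blin opnormD opnormZ opnorm_eq0.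

End BoundedLinear.

Arguments blin {R} X Y.

Section BoundedLinearComp.
Context {R : realType} {X Y Z : normedModType R}.

Lemma blin_comp_subproof (g : blin Y Z) (f : blin X Y) :
  (g \o f : X -> Z) \in bounded_linear.
Proof.
apply/mem_set; split.
  by move=> a x y; rewrite /= !linearP.
by move=> x; apply: continuous_comp; exact: blin_continuous.
Qed.

Definition blin_comp (g : blin Y Z) (f : blin X Y) : blin X Z :=
  BLin (blin_comp_subproof g f).

End BoundedLinearComp.

Definition lin_indep {R : realType} {V : lmodType R} {I : finType} (v : I -> V) :=
  forall c : I -> R, \sum_i c i *: v i = 0 -> forall i, c i = 0.

(* A map defined on a neighborhood G of x is represented by any total extension
   of it: the notions below only depend on the germ at x. *)

Section Differentials.
Context {R : realType} {X Y : normedModType R}.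
Implicit Types (f : X -> Y) (x : X) (D : blin X Y) (K : set X).

Definition is_gateaux f x D :=
  forall h : X, t^-1 *: (f (x + t *: h) - f x) @[t --> 0^'+] --> D h.

Definition gateaux_differentiable f x := exists D, is_gateaux f x D.

Definition dG f x : blin X Y := get [set D | is_gateaux f x D].

Definition is_hadamard f x D := forall K, compact K -> K !=set0 ->
  ereal_sup [set `|t^-1 *: (f (x + t *: h) - f x) - D h|%:E | h in K]
    @[t --> 0^'+] --> 0%E.

Definition hadamard_differentiable f x := exists D, is_hadamard f x D.

Definition dH f x : blin X Y := get [set D | is_hadamard f x D].

(* The library's differential 'd f x, as an element of blin X Y. *)
Definition dF f x : blin X Y := get [set D : blin X Y | is_diff x f D].

End Differentials.

(* Functions on [0, T] are represented by total functions on R, whose values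
   outside [0, T] play no role.  A subdivision
   0 = tau_0 < tau_1 < ... < tau_(k+1) = T is the sequence s of
   tau_1, ..., tau_(k+1), with itv_partition 0 T s; thus, for i < size s, tau_i is
   nth 0 (0 :: s) i and tau_(i+1) is nth 0 s i. *)

Section FunctionSpaces.
Context {R : realType}.
Implicit Types (T t : R) (s : seq R).

Section PiecewiseContinuous.
Context {Y : topologicalType}.

(* Piecewise continuity of u as a map into the subspace U of Y: the one-sided
   limits have to lie in U. *)
Definition piecewise_continuous T (U : set Y) (u : R -> Y) :=
  exists2 s, itv_partition 0 T s &
  forall i, (i < size s)%N ->
    let a := nth 0 (0 :: s) i in let b := nth 0 s i in
    [/\ {in `]a, b[, continuous u},
        (exists2 y, U y & u @ a^'+ --> y) &
        (exists2 y, U y & u @ b^'- --> y)].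

Definition NPC0 T (U : set Y) (u : R -> Y) :=
  [/\ {in `[0, T], forall t, U (u t)},
      piecewise_continuous T U u,
      {in `[0, T[, forall t, u @ t^'+ --> u t} &
      u @ T^'- --> u T].

End PiecewiseContinuous.

Section PiecewiseC1.
Context {Y : normedModType R}.
Implicit Types x : R -> Y.

Definition PC1_subdivision T x s :=
  itv_partition 0 T s /\
  forall i, (i < size s)%N ->
    let a := nth 0 (0 :: s) i in let b := nth 0 s i in
    [/\ {in `]a, b[, forall t, derivable x t 1},
        {in `]a, b[, continuous (derive1 x)},
        cvg (derive1 x @ a^'+) &
        cvg (derive1 x @ b^'-)].

Definition PC1 T (G : set Y) x :=
  [/\ {within `[0, T], continuous x},
      (exists s, PC1_subdivision T x s) &
      {in `[0, T], forall t, G (x t)}].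

Definition ext_derive_on T s x t : Y :=
  if t == T then lim (derive1 x @ T^'-)
  else if t \in 0 :: s then lim (derive1 x @ t^'+)
  else derive1 x t.

(* The value does not depend on the subdivision that is picked, because x' is
   continuous at the interior points of the subintervals. *)
Definition ext_derive T x : R -> Y :=
  ext_derive_on T (xget [::] [set s | PC1_subdivision T x s]) x.

End PiecewiseC1.

End FunctionSpaces.

(* The control space is the subset control_set of a topological space V, with the
   subspace topology.  The data are total functions, of which only the values at
   arguments in [0, T], state_domain and control_set matter. *)

Record bolza {R : realType} (E : completeNormedModType R) (V : topologicalType)
    (l m q : nat) := Bolza {
  horizon : R ;
  state_domain : set E ;
  control_set : set V ;
  initial_state : E ;
  dynamics : R -> E -> V -> E ;
  running_payoff : 'I_l -> R -> E -> V -> R ;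
  terminal_payoff : 'I_l -> E -> R ;
  ineq_constraint : 'I_m -> E -> R ;
  eq_constraint : 'I_q -> E -> R
}.

Section Bolza.
Context {R : realType} {E : completeNormedModType R} {V : topologicalType}.
Context {l m q : nat}.
Variable P : bolza E V l m q.

Local Notation T := (horizon P).
Local Notation U := (control_set P).
Local Notation Om := (state_domain P).
Local Notation f := (dynamics P).
Local Notation f0 := (running_payoff P).
Local Notation g0 := (terminal_payoff P).
Local Notation g := (ineq_constraint P).
Local Notation h := (eq_constraint P).

Definition admissible (x : R -> E) (u : R -> V) :=
  [/\ PC1 T Om x, NPC0 T U u,
      {in `[0, T], forall t, ext_derive T x t = f t (x t) (u t)} &
      [/\ x 0 = initial_state P,
          forall a, 0 <= g a (x T) &
          forall b, h b (x T) = 0]].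

Definition objective (i : 'I_l) (x : R -> E) (u : R -> V) : R :=
  g0 i (x T) + \int[lebesgue_measure]_(t in `[0, T]) f0 i t (x t) (u t).

Definition pareto_optimal (x0 : R -> E) (u0 : R -> V) :=
  admissible x0 u0 /\
  ~ exists x u, [/\ admissible x u,
      forall i, objective i x0 u0 <= objective i x u &
      exists i0, objective i0 x0 u0 < objective i0 x u].

Definition hamiltonian (t : R) (x : E) (u : V) (p : blin E R) (theta : 'rV[R]_l)
    : R :=
  \sum_i theta 0 i * f0 i t x u + p (f t x u).

Record pontryagin (x0 : R -> E) (u0 : R -> V) (theta : 'rV[R]_l)
    (lambda : 'rV[R]_m) (mu : 'rV[R]_q) (p : R -> blin E R) : Prop := Pontryagin {
  pontryagin_NN : (theta, lambda, mu) != 0 ;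
  pontryagin_Si : (forall i, 0 <= theta 0 i) /\ (forall a, 0 <= lambda 0 a) ;
  pontryagin_Sl : forall a, lambda 0 a * g a (x0 T) = 0 ;
  pontryagin_TC :
    \sum_i theta 0 i *: dH (g0 i) (x0 T) +
    \sum_a lambda 0 a *: dH (g a) (x0 T) +
    \sum_b mu 0 b *: dH (h b) (x0 T) = p T ;
  pontryagin_AE : {in `[0, T], forall t, ext_derive T p t =
    - dF (fun xi => hamiltonian t xi (u0 t) (p t) theta) (x0 t)} ;
  pontryagin_MP : {in `[0, T], forall t, forall zeta, U zeta ->
    hamiltonian t (x0 t) zeta (p t) theta <=
    hamiltonian t (x0 t) (u0 t) (p t) theta} ;
  pontryagin_CH : {within `[0, T], continuous
    (fun t => hamiltonian t (x0 t) (u0 t) (p t) theta)}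
}.

(* Instantiated with both the dynamics and the running payoffs. *)
Definition regular_along {F : normedModType R} (x0 : R -> E)
    (phi : R -> E -> V -> F) :=
  [/\ {within `[0, T] `*` Om `*` U, continuous
        (fun z : R * E * V => phi z.1.1 z.1.2 z.2)},
      (forall (t : R) xi zeta, t \in `[0, T] -> Om xi -> U zeta ->
        gateaux_differentiable (fun y => phi t y zeta) xi),
      (forall (t : R) zeta, t \in `[0, T] -> U zeta ->
        differentiable (fun y => phi t y zeta) (x0 t)),
      {within `[0, T] `*` U, continuous
        (fun z : R * V => dF (fun y => phi z.1 y z.2) (x0 z.1))} &
      forall (K : set E) (M : set V), compact K -> K !=set0 -> K `<=` Om ->
        compact M -> M !=set0 -> M `<=` U ->
        (ereal_sup [set `|dG (fun y => phi z.1.1 y z.2) z.1.2|%:E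
          | z in `[0%R, T] `*` K `*` M] < +oo)%E].

End Bolza.

(* Main.v *)
(* Needle variations. Replacing u0 by constants zeta_k on short intervals of lengths a_k
   after times t_k changes the terminal value of the state, augmented by the running
   payoffs, by sum_k a_k y_k(T) + o(|a|), where y_k solves the equation linearised along
   (x0, u0) and starts at t_k from the jump of the right-hand side. If no nonzero
   multipliers separate the cone spanned by the images of the y_k(T) under the Hadamard
   differentials of the terminal functions from the cone of the gains that may be
   discarded, then the difference of the two cones is dense; hence finitely many needles
   improve all the payoffs and the active constraints at first order while steering the
   equality constraints in every direction, and Brouwer's theorem produces an admissible
   pair that contradicts Pareto optimality. The multipliers determine p(T), p is the
   solution of the adjoint equation, and p . y + theta . (payoff part of y) is constant
   along the linearised equation, which turns the separation into the maximum principle. *)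

Require Import Defs.
From mathcomp Require Import all_boot all_order all_algebra.
From mathcomp Require Import boolp zify.

Import Order.TTheory GRing.Theory Num.Theory.

Set Implicit Arguments.
Unset Strict Implicit.
Unset Printing Implicit Defensive.

(** * Sperner's lemma for the Kuhn triangulation of a cube *)

Section Parity.

(** The state space may be infinite-dimensional and the control is continuous from one side only, so
    the calculus rests on right derivatives: trajectories have them at every time before the
    horizon, and a mean value inequality for them yields Gronwall's inequality, primitives and
    Picard iteration without vector-valued integrals. At the end of the trajectory only [l + m + q]
    numbers matter. The cone of variations need not be closed there, so directions are reached only
    up to an error, and every later constant is chosen to leave room for it. Bounds on Gateaux
    differentials over compact sets give Lipschitz estimates only near [x0], which calls for a
    modified field. Frechet differentiability holds only along [x0], separately at each time, so the
    first-order expansion cannot come from a uniform remainder. The equality constraints are merely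
    continuous near the end point, so no implicit function theorem applies; the topological argument
    used instead needs end points that depend continuously on the amplitudes, which is why a
    Lipschitz estimate accompanies the expansion. *)

Lemma even_card_involution (T : finType) (A : {set T}) (f : T -> T) :
  (forall x, x \in A -> f x \in A) -> (forall x, x \in A -> f (f x) = x) ->
  (forall x, x \in A -> f x != x) -> ~~ odd #|A|.
Proof.
have [n] := ubnP #|A|; elim: n A => // n IH A; rewrite ltnS => An fA ffK fN.
have [->|/set0Pn[x xA]] := eqVneq A set0; first by rewrite cards0.
have fxA := fA x xA; have fxN := fN x xA.
rewrite (cardsD1 x) (cardsD1 (f x)) xA !inE fxN fxA /= negbK.
apply: IH => [|y|y|y]; rewrite ?inE.
- rewrite (cardsD1 x) (cardsD1 (f x)) xA !inE fxN fxA /= in An.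
  by apply: leq_trans An; rewrite !add1n leqnSn.
- move=> /and3P[yfx yx yA]; rewrite fA// andbT; apply/andP; split.
    by apply: contra yx => /eqP /(congr1 f); rewrite !ffK// => ->.
  by apply: contra yfx => /eqP <-; rewrite ffK.
- by move=> /and3P[_ _]; exact: ffK.
- by move=> /and3P[_ _]; exact: fN.
Qed.

(* Removing one of the [n + 2] vertices of a simplex labelled in [0, n + 1] leaves the
   labels [0, n] for one vertex if all labels occur, for zero or two vertices otherwise. *)
Lemma odd_covering_facets n (lam : 'I_n.+2 -> 'I_n.+2) :
  odd #|[set k | [forall c : 'I_n.+2, (c < n.+1) ==> [exists j, (j != k) && (lam j == c)]]]| =
  [forall c, exists j, lam j == c].
Proof.
set A := [set k | _].
have AP k : reflect (forall c : 'I_n.+2, c < n.+1 -> exists2 j, j != k & lam j = c) (k \in A).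
  rewrite inE; apply: (iffP forallP) => H c.
    by move=> cn; have /implyP/(_ cn)/existsP[j /andP[jk /eqP]] := H c; exists j.
  by apply/implyP => /H[j jk /eqP jc]; apply/existsP; exists j; rewrite jk.
have [/forallP H|/forallPn[c0 /existsPn nc0]] := boolP [forall c, exists j, lam j == c].
  have lam_inj : injective lam.
    have sub : lam @: [set: 'I_n.+2] = [set: 'I_n.+2].
      apply/setP => c; rewrite inE; apply/imsetP.
      by have /existsP[j /eqP <-] := H c; exists j.
    have /imset_injP inj : #|lam @: [set: 'I_n.+2]| == #|[set: 'I_n.+2]| by rewrite sub.
    by move=> x y; apply: inj; rewrite inE.
  have /existsP[k0 /eqP k0E] := H ord_max.
  suff -> : A = [set k0] by rewrite cards1.
  apply/setP => k; rewrite !inE; apply/idP/eqP => [|->{k}].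
    move=> kA; have {}kA : k \in A by rewrite inE.
    have [//|kk0] := eqVneq k k0.
    have : lam k < n.+1.
      rewrite ltn_neqAle -ltnS ltn_ord andbT; apply/negP => /eqP e.
      by move/eqP: kk0; apply; apply: lam_inj; rewrite k0E; apply: val_inj.
    move=> /((AP k kA) (lam k))[j /eqP jk /lam_inj //].
  have : k0 \in A; last by rewrite inE.
  apply/AP => c cn; have /existsP[j /eqP jc] := H c; exists j => //.
  by apply/eqP => jk; move: cn; rewrite -jc jk k0E ltnn.
have [->|/set0Pn[k1 k1A]] := eqVneq A set0; first by rewrite cards0.
have c0E : c0 = ord_max.
  apply/val_inj/eqP; rewrite /= eqn_leq -ltnS ltn_ord /= leqNgt; apply/negP => c0n.
  by have [j _ /eqP] := (AP k1 k1A) c0 c0n; apply/negP; exact: nc0.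
have lam_lt j : lam j < n.+1.
  rewrite ltn_neqAle -ltnS ltn_ord andbT; apply/negP => /eqP e.
  by have /eqP := nc0 j; apply; rewrite c0E; apply: val_inj.
have inj1 : {in [set~ k1] &, injective lam}.
  apply/imset_injP; rewrite cardsC1 card_ord /=.
  have sub : lam @: [set~ k1] = [set~ ord_max].
    apply/setP => c; rewrite !inE; apply/imsetP/idP => [[j _ ->]|].
      by apply/eqP => e; have := lam_lt j; rewrite e ltnn.
    move=> cm; have cn : c < n.+1.
      rewrite ltn_neqAle -ltnS ltn_ord andbT; apply/negP => /eqP e.
      by move/eqP: cm; apply; apply: val_inj.
    by have [j jk jc] := (AP k1 k1A) c cn; exists j => //; rewrite !inE.
  by rewrite sub cardsC1 card_ord.
have [k2 k21 k2E] := (AP k1 k1A) (lam k1) (lam_lt k1).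
suff -> : A = [set k1; k2] by rewrite cards2 eq_sym k21.
apply/setP => k; rewrite in_set2; apply/idP/idP => [kA|].
  apply/norP => -[kk1 kk2].
  have [j jk jE] := (AP k kA) (lam k) (lam_lt k).
  have [jk1|jk1] := eqVneq j k1.
    move/eqP: kk2; apply; apply: inj1; rewrite ?inE// k2E -jk1 jE//.
  by move/eqP: jk; apply; apply: inj1; rewrite ?inE.
move=> /orP[/eqP -> //|/eqP ->]; apply/AP => c cn.
have [j jk1 jc] := (AP k1 k1A) c cn.
have [jk2|jk2] := eqVneq j k2; last by exists j.
by exists k1; rewrite 1?eq_sym// -jc jk2 k2E.
Qed.

End Parity.

Section Kuhn.
Variables (N P : nat) (lbl : ('I_N -> nat) -> nat).
Hypothesis lbl_le : forall v, lbl v <= N.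
(** The first condition keeps the labels on the face where the coordinates from [d] on vanish within
    [[0, d]]. The next one bars label 0 from the upper faces, so that no completely labelled facet
    lies there. *)
Hypothesis lbl_zero : forall v (i : 'I_N), v i = 0 -> lbl v != i.+1.
Hypothesis lbl_top : forall v (i : 'I_N), v i = P.+1 -> i < lbl v.

Local Notation simplex := ({ffun 'I_N -> 'I_P.+1} * {ffun 'I_N -> 'I_N})%type.

(** A Kuhn simplex is a lower corner [x.1] with an order of increments: coordinate [i] is raised by
    one at step [x.2 i]. Corners have coordinates in [[0, P]], hence vertices in [[0, P.+1]]. *)
Definition vert (x : simplex) (j : nat) : 'I_N -> nat := fun i => x.1 i + (x.2 i < j).

(** The Kuhn simplices of the face where the coordinates from [d] on vanish: prescribing [x.2 i = i]
    there postpones these increments beyond vertex [d]. *)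
Definition simplex_dim d (x : simplex) :=
  injectiveb x.2 && [forall i : 'I_N, (d <= i) ==> (x.1 i == 0 :> nat) && (x.2 i == i)].

Definition full d (x : simplex) :=
  [forall c : 'I_d.+1, exists j : 'I_d.+1, lbl (vert x j) == c].

Definition covers d (x : simplex) (k : 'I_d.+2) :=
  [forall c : 'I_d.+1, exists j : 'I_d.+2, (j != k) && (lbl (vert x j) == c)].

Lemma simplex_dimP d (x : simplex) : reflect
  (injective x.2 /\ forall i : 'I_N, d <= i -> x.1 i = 0 :> nat /\ x.2 i = i) (simplex_dim d x).
Proof.
apply: (iffP andP) => -[/injectiveP inj H]; split => //.
  by move=> i di; have /forallP/(_ i)/implyP/(_ di)/andP[/eqP ? /eqP] := H.
by apply/forallP => i; apply/implyP => /H[-> ->]; rewrite !eqxx.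
Qed.

Lemma lbl_vert d (x : simplex) j : simplex_dim d x -> j <= d -> lbl (vert x j) <= d.
Proof.
move=> /simplex_dimP[inj H] jd; case E : (lbl _) => [//|c].
rewrite ltnNge; apply/negP => dc.
have cN : c < N by rewrite -E; exact: lbl_le.
have /H[h1 h2] : d <= Ordinal cN by [].
have := @lbl_zero (vert x j) (Ordinal cN); rewrite E eqxx /vert h1 h2 /= ltnNge.
by rewrite (leq_trans jd)// => /(_ erefl).
Qed.

Section Step.
Variable d : nat.
Hypothesis dN : d < N.

Let i_d : 'I_N := Ordinal dN.

Definition facets : {set simplex * 'I_d.+2} :=
  [set z | simplex_dim d.+1 z.1 && covers z.1 z.2].

(** The labelled facets in the face where coordinate [d] vanishes: a [d]-dimensional simplex is also
    a [d.+1]-dimensional one whose last step raises coordinate [d], and it is the facet opposite to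
    the last vertex of the latter. *)
Definition base_facets : {set simplex * 'I_d.+2} :=
  [set z | [&& simplex_dim d z.1, full d z.1 & z.2 == ord_max]].

(** The three maps from here on reflect a simplex through a facet. To replace vertex 0, [rot_down]
    performs the first increment in the corner and repeats it as step [d]; [rot_up] is its inverse
    and replaces the last vertex; [swap] replaces an inner vertex [k] by exchanging the steps [k.-1]
    and [k]. *)
Definition rot_down (x : simplex) : simplex :=
  ([ffun i => inord (x.1 i + (x.2 i == 0 :> nat))],
   [ffun i => if x.2 i == 0 :> nat then i_d
              else if x.2 i <= d then insubd i_d (x.2 i).-1 else x.2 i]).

Definition rot_up (x : simplex) : simplex :=
  ([ffun i => inord (x.1 i - (x.2 i == i_d))],
   [ffun i => if x.2 i == i_d then insubd i_d 0
              else if x.2 i < d then insubd i_d (x.2 i).+1 else x.2 i]).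

Definition swap (x : simplex) (k : nat) : simplex :=
  (x.1, [ffun i => if x.2 i == k.-1 :> nat then insubd i_d k
                   else if x.2 i == k :> nat then insubd i_d k.-1 else x.2 i]).

Arguments rot_down : simpl never.
Arguments rot_up : simpl never.
Arguments swap : simpl never.

Definition neighbour (z : simplex * 'I_d.+2) : simplex * 'I_d.+2 :=
  if z.2 == 0 :> nat then (rot_down z.1, ord_max)
  else if z.2 == d.+1 :> nat then (rot_up z.1, ord0)
  else (swap z.1 z.2, z.2).

Let val_insubd (u : 'I_N) n : val (insubd u n) = if n < N then n else u.
Proof. exact: val_insubd. Qed.

Let neq_last (j k : 'I_d.+2) : j != k -> k = d.+1 :> nat -> j < d.+1.
Proof.
move=> jk kE; rewrite ltn_neqAle -ltnS ltn_ord andbT; apply: contra jk => /eqP e.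
by apply/eqP/val_inj; rewrite /= e.
Qed.

(** If the coordinate [i] raised last starts at 0, it vanishes on the whole facet, which therefore
    lacks the label [i.+1]. As the labels up to [d] all occur, [i] must be [d]. This is the only
    obstruction to [rot_up]. *)
Lemma facets_base z : z \in facets -> z.2 = d.+1 :> nat ->
  (exists i, z.1.2 i = d :> nat /\ z.1.1 i = 0 :> nat) -> z \in base_facets.
Proof.
case: z => x k; rewrite !inE /= => /andP[xd xc] kE [i [ri vi]].
have [inj H] := simplex_dimP _ _ xd.
have k_max : k = ord_max by apply: val_inj.
have vert0 (j : 'I_d.+2) : j != k -> vert x j i = 0.
  move=> jk; rewrite /vert vi ri.
  by have := neq_last jk kE; rewrite ltnS leqNgt => /negbTE ->.
have id_d : i = i_d.
  apply: val_inj => /=; apply/eqP; rewrite eqn_leq; apply/andP; split.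
    rewrite leqNgt; apply/negP => di; have [_ e] := H i di.
    by move: di; rewrite -{1}e ri ltnn.
  rewrite leqNgt; apply/negP => id.
  have id' : i.+1 < d.+1 by [].
  have /forallP/(_ (Ordinal id'))/existsP[j /andP[jk]] := xc.
  by apply/negP/lbl_zero/vert0.
rewrite k_max eqxx andbT; apply/andP; split.
  apply/simplex_dimP; split => // i'; rewrite leq_eqVlt => /predU1P[e|]; last exact: H.
  have -> : i' = i by rewrite id_d; apply: val_inj.
  by split => //; apply: val_inj; rewrite /= ri id_d.
apply/forallP => c; have /forallP/(_ c)/existsP[j /andP[jk jc]] := xc.
have jd := neq_last jk kE.
by apply/existsP; exists (Ordinal jd).
Qed.

Lemma base_facets_sub : base_facets \subset facets.
Proof.
apply/subsetP => -[x k]; rewrite !inE /= => /and3P[xd xf /eqP ->].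
have [inj H] := simplex_dimP _ _ xd; apply/andP; split.
  by apply/simplex_dimP; split => // i di; apply: H; exact: ltnW.
apply/forallP => c; have /forallP/(_ c)/existsP[j jc] := xf.
apply/existsP; exists (widen_ord (leqnSn _) j); rewrite jc andbT.
by apply/eqP => /(congr1 val) /= e; have := ltn_ord j; rewrite e ltnn.
Qed.

(** The bound on [x.1] keeps the new corner on the grid, and the last clause is what shows that the
    reflected facet is not a base facet. *)
Lemma rot_down_dim x : simplex_dim d.+1 x -> (forall i, x.2 i = 0 :> nat -> x.1 i < P) ->
  [/\ simplex_dim d.+1 (rot_down x), rot_up (rot_down x) = x,
      forall j, j <= d -> vert (rot_down x) j = vert x j.+1 &
      forall i, (rot_down x).2 i = i_d -> 0 < (rot_down x).1 i].
Proof.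
move=> xd top; have [inj H] := simplex_dimP _ _ xd.
have E1 i : (rot_down x).1 i = x.1 i + (x.2 i == 0 :> nat) :> nat.
  rewrite ffunE inordK//; case: eqP => [/top|_]; first by rewrite addn1 !ltnS.
  by rewrite addn0.
have E2 i : (rot_down x).2 i = (if x.2 i == 0 :> nat then d else
    if x.2 i <= d then (x.2 i).-1 else x.2 i) :> nat.
  rewrite ffunE; case: ifP => // _; case: ifP => // h.
  rewrite val_insubd; case: ifP => // /negP; case; move: h dN; lia.
split.
- apply/simplex_dimP; split.
    move=> i i' /(congr1 val); rewrite /= !E2 => e; apply: inj; apply: val_inj => /=.
    by move: e; do 2 case: eqP => ?; do 2 ?case: (leqP _ d) => ?; lia.
  move=> i di; have [h1 h2] := H i di.
  rewrite E1 h1 h2; have i0 : (i == 0 :> nat) = false by apply/negbTE; move: di; lia.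
  by rewrite i0; split => //; apply: val_inj; rewrite /= E2 h2 i0 leqNgt di.
- have e2 i : (rot_down x).2 i == i_d = (x.2 i == 0 :> nat).
    rewrite -val_eqE /= E2; case: (eqVneq (x.2 i : nat) 0) => [_|h]; first exact: eqxx.
    by case: (leqP (x.2 i) d) => h'; apply/negbTE; move: h h'; lia.
  move: (rot_down x) E1 E2 e2 => y E1 E2 e2.
  apply: injective_projections; apply/ffunP => i; apply: val_inj; rewrite ffunE e2 /=.
    rewrite inordK E1 ?addnK//; exact: leq_ltn_trans (leq_subr _ _) (ltn_ord _).
  have := E2 i; case: (eqVneq (x.2 i : nat) 0) => [h _|h].
    by rewrite val_insubd h ifT//; move: dN; lia.
  case: (leqP (x.2 i) d) => h' E.
    rewrite E ifT; last by move: h h'; lia.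
    by rewrite val_insubd prednK ?lt0n ?ltn_ord.
  by rewrite E ifF//; apply/negbTE; rewrite -leqNgt ltnW.
- move=> j jd; apply/funext => i; rewrite /vert E1 E2.
  case: eqP => [->|h]; first by rewrite addnAC; move: jd; lia.
  by rewrite addn0; congr (_ + nat_of_bool _); case: (leqP (x.2 i) d) => h'; move: h h' jd; lia.
- move=> i /(congr1 val); rewrite /= E1 E2; case: (eqVneq (x.2 i : nat) 0) => [_ _|h].
    by rewrite addn1.
  by case: (leqP (x.2 i) d) => h'; move: h h'; lia.
Qed.

Lemma rot_up_dim x : simplex_dim d.+1 x -> (forall i, x.2 i = d :> nat -> 0 < x.1 i) ->
  [/\ simplex_dim d.+1 (rot_up x), rot_down (rot_up x) = x &
      forall j, j <= d -> vert (rot_up x) j.+1 = vert x j].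
Proof.
move=> xd bot; have [inj H] := simplex_dimP _ _ xd.
have ed i : (x.2 i == i_d) = (x.2 i == d :> nat) by rewrite -val_eqE.
have E1 i : (rot_up x).1 i = x.1 i - (x.2 i == d :> nat) :> nat.
  by rewrite ffunE inordK ed//; exact: leq_ltn_trans (leq_subr _ _) (ltn_ord _).
have E2 i : (rot_up x).2 i = (if x.2 i == d :> nat then 0 else
    if x.2 i < d then (x.2 i).+1 else x.2 i) :> nat.
  rewrite ffunE ed; case: ifP => _; first by rewrite val_insubd ifT//; move: dN; lia.
  case: ifP => // h.
  rewrite val_insubd; case: ifP => // /negP; case; move: h dN; lia.
split.
- apply/simplex_dimP; split.
    move=> i i' /(congr1 val); rewrite /= !E2 => e; apply: inj; apply: val_inj => /=.
    by move: e; do 2 case: eqP => ?; do 2 ?case: (ltnP _ d) => ?; lia.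
  move=> i di; have [h1 h2] := H i di.
  rewrite E1 h1 h2 sub0n; split => //; apply: val_inj; rewrite /= E2 h2.
  by case: eqP => [h|_]; [move: di; rewrite h ltnn|rewrite ltnNge ltnW].
- move: (rot_up x) E1 E2 => y E1 E2.
  have e2 i : (y.2 i == 0 :> nat) = (x.2 i == d :> nat).
    rewrite E2; case: (eqVneq (x.2 i : nat) d) => [_|h]; first exact: eqxx.
    by case: (ltnP (x.2 i) d) => h'; apply/negbTE; move: h h'; lia.
  apply: injective_projections; apply/ffunP => i; apply: val_inj; rewrite ffunE e2 /=.
    rewrite E1 subnK.
      by rewrite inordK.
    by case: (eqVneq (x.2 i : nat) d) => [/bot//|].
  have := E2 i; case: (eqVneq (x.2 i : nat) d) => [h _|h]; first by rewrite h.
  case: (ltnP (x.2 i) d) => h' E; first by rewrite E h' val_insubd /= ifT.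
  by rewrite E ifF//; apply/negbTE; move: h h'; lia.
- move=> j jd; apply/funext => i; rewrite /vert E1 E2.
  case: (eqVneq (x.2 i : nat) d) => [e|h].
    by have := bot i e; rewrite e; move: jd; lia.
  rewrite subn0; congr (_ + nat_of_bool _).
  by case: (ltnP (x.2 i) d) => h'; move: h h' jd; lia.
Qed.

Lemma swap_dim x k : simplex_dim d.+1 x -> 0 < k <= d ->
  [/\ simplex_dim d.+1 (swap x k), swap (swap x k) k = x, swap x k != x &
      forall j, j != k -> vert (swap x k) j = vert x j].
Proof.
move=> xd /andP[k0 kd]; have [inj H] := simplex_dimP _ _ xd.
have E2 i : (swap x k).2 i = (if x.2 i == k.-1 :> nat then k else
    if x.2 i == k :> nat then k.-1 else x.2 i) :> nat.
  rewrite ffunE; case: ifP => _; first by rewrite val_insubd ifT//; exact: leq_ltn_trans dN.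
  by case: ifP => // _; rewrite val_insubd ifT//; move: kd dN; lia.
have E1 : (swap x k).1 = x.1 by [].
split.
- apply/simplex_dimP; split.
    move=> i i' /(congr1 val); rewrite [val _]/= [X in _ = X]/= !E2 => e; apply: inj; apply: val_inj => /=.
    by move: e; do 2 case: eqP => ?; do 2 ?case: eqP => ?; lia.
  move=> i di; have [h1 h2] := H i di.
  rewrite E1; split => //; apply: val_inj; rewrite [LHS]E2 h2.
  by do 2 (case: eqP => [h|_]; first by move: di kd; rewrite h; lia).
- have F2 i : (swap (swap x k) k).2 i = (if (swap x k).2 i == k.-1 :> nat then k else
    if (swap x k).2 i == k :> nat then k.-1 else (swap x k).2 i) :> nat.
    rewrite ffunE; case: ifP => _; first by rewrite val_insubd ifT//; exact: leq_ltn_trans dN.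
    by case: ifP => // _; rewrite val_insubd ifT//; move: kd dN; lia.
  apply: injective_projections => //; apply/ffunP => i; apply: val_inj.
  rewrite [LHS]F2 E2.
  case: (eqVneq (x.2 i : nat) k.-1) => [e|h1].
    by rewrite eqxx /= e; case: eqP => //; move: k0; lia.
  case: (eqVneq (x.2 i : nat) k) => [e|h2]; first by rewrite eqxx /= e.
  by rewrite (negbTE h1) (negbTE h2).
- have kN : k < N by exact: leq_ltn_trans dN.
  have [g _ gK] := injF_bij inj.
  apply/eqP => /(congr1 (fun y : simplex => val (y.2 (g (Ordinal kN))))).
  rewrite [LHS]E2 gK /= eqxx; case: eqP; move: k0; lia.
- move=> j jk; apply/funext => i; rewrite /vert E1 E2; congr (_ + nat_of_bool _).
  by do 2 (case: eqP => [h|_]; first by move: h jk k0; lia).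
Qed.

Lemma neighbour_facets z : z \in facets :\: base_facets ->
  [/\ neighbour z \in facets :\: base_facets, neighbour (neighbour z) = z & neighbour z != z].
Proof.
case: z => x k /setDP[zf zb]; have := zf; rewrite inE /= => /andP[xd xc].
have [k0|k0] := eqVneq (k : nat) 0.
  (* Otherwise the first increment would lead to the upper face, and all remaining vertices would
     lie there, where label 0 does not occur. *)
  have top i : x.2 i = 0 :> nat -> x.1 i < P.
    move=> ri; rewrite ltn_neqAle -ltnS ltn_ord andbT; apply/eqP => vi.
    have /forallP/(_ ord0)/existsP[j /andP[jk /eqP j0]] := xc.
    have j1 : 0 < j.
      by rewrite lt0n; apply: contra jk => /eqP e; apply/eqP/val_inj; rewrite /= e k0.
    have := @lbl_top (vert x j) i; rewrite j0 /vert vi ri j1 addn1 => /(_ erefl).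
    by [].
  have [h1 h2 h3 h4] := rot_down_dim xd top.
  have nE : neighbour (x, k) = (rot_down x, ord_max) by rewrite /neighbour /= k0.
  rewrite nE; split.
  - apply/setDP; split.
      rewrite inE h1; apply/forallP => c; have /forallP/(_ c)/existsP[j /andP[jk jc]] := xc.
      have j1 : 0 < j.
        by rewrite lt0n; apply: contra jk => /eqP e; apply/eqP/val_inj; rewrite /= e k0.
      have jd : j.-1 < d.+1 by have := ltn_ord j; move: j1; lia.
      apply/existsP; exists (widen_ord (leqnSn _) (Ordinal jd)).
      rewrite -val_eqE /= neq_ltn jd /= h3 ?prednK//; move: jd; lia.
    rewrite inE /=; apply/negP => /and3P[/simplex_dimP[_ /(_ i_d (leqnn _))[e1 e2]] _ _].
    by have := h4 i_d e2; rewrite e1.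
  - rewrite /neighbour /= eqxx h2; congr (_, _); apply: val_inj; by rewrite /= k0.
  - by apply/eqP => -[_ /(congr1 val)]; rewrite /= k0.
have [kd|kd] := eqVneq (k : nat) d.+1.
  have bot i : x.2 i = d :> nat -> 0 < x.1 i.
    move=> ri; rewrite lt0n; apply: contra zb => /eqP vi.
    by apply: facets_base => //; exists i.
  have [h1 h2 h3] := rot_up_dim xd bot.
  have nE : neighbour (x, k) = (rot_up x, ord0) by rewrite /neighbour /= kd eqxx.
  rewrite nE; split.
  - apply/setDP; split.
      rewrite inE h1; apply/forallP => c; have /forallP/(_ c)/existsP[j /andP[jk jc]] := xc.
      have jd := neq_last jk kd.
      have jd' : j.+1 < d.+2 by [].
      by apply/existsP; exists (Ordinal jd'); rewrite /= h3.
    by rewrite inE /=; apply/negP => /and3P[_ _ /eqP/(congr1 val)].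
  - rewrite /neighbour /= h2; congr (_, _); apply: val_inj; by rewrite /= kd.
  - by apply/eqP => -[_ /(congr1 val)]; rewrite /= kd.
have kb : 0 < k <= d by have := ltn_ord k; move: k0 kd; lia.
have [h1 h2 h3 h4] := swap_dim xd kb.
have nE y : neighbour (y, k) = (swap y k, k) by rewrite /neighbour /= (negbTE k0) (negbTE kd).
rewrite !nE h2; split => //.
- apply/setDP; split.
    rewrite inE h1; apply/forallP => c; have /forallP/(_ c)/existsP[j /andP[jk jc]] := xc.
    by apply/existsP; exists j; rewrite jk h4.
  rewrite inE /=; apply/negP => /and3P[_ _ /eqP/(congr1 val) /= e].
  by move: kb; rewrite e; lia.
- by apply/eqP => -[e]; move/eqP: h3; rewrite /= => h3; apply: h3; rewrite -[in RHS]e.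
Qed.

(** Double counting modulo 2 of the pairs of a simplex and a labelled facet. Reflection pairs off
    the facets outside the base, while each simplex contributes an odd number of facets exactly when
    it carries all labels. *)
Lemma odd_full_step : odd #|[set x | simplex_dim d.+1 x && full d.+1 x]| =
  odd #|[set x | simplex_dim d x && full d x]|.
Proof.
have -> : #|[set x | simplex_dim d x && full d x]| = #|base_facets|.
  rewrite -(card_imset _ (f := fun x => (x, ord_max : 'I_d.+2))); last by move=> x y [].
  congr #|pred_of_set _|; apply/setP => -[x k]; rewrite !inE /=; apply/imsetP/and3P.
    by move=> [y]; rewrite inE => /andP[? ?] [-> ->].
  by move=> [xd xf /eqP ->]; exists x => //; rewrite inE xd.
have -> : odd #|base_facets| = odd #|facets|.
  rewrite -(cardsID base_facets facets) oddD.
  rewrite (setIidPr base_facets_sub).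
  have /negbTE -> : ~~ odd #|facets :\: base_facets|; last by rewrite addbF.
  by apply: (even_card_involution (f := neighbour)) => z /neighbour_facets[].
have -> : #|facets| = \sum_(x | simplex_dim d.+1 x) #|[set k : 'I_d.+2 | covers x k]|.
  rewrite -sum1_card (eq_bigl (fun z => simplex_dim d.+1 z.1 && covers z.1 z.2)); last first.
    by move=> z; rewrite inE.
  rewrite -(pair_big_dep _ (fun x (k : 'I_d.+2) => covers x k) (fun _ _ => 1)) /=.
  by apply: eq_bigr => x _; rewrite sum1_card; apply: eq_card => k; rewrite inE.
rewrite -sum1_card (eq_bigl (fun x => simplex_dim d.+1 x && full d.+1 x)); last first.
  by move=> x; rewrite inE.
rewrite big_mkcondr /=.
rewrite !(big_morph odd oddD (erefl _)); apply: eq_bigr => x xd.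
have lb (j : 'I_d.+2) : lbl (vert x j) < d.+2 by apply: lbl_vert => //; rewrite -ltnS.
rewrite (_ : [set k : 'I_d.+2 | covers x k] = [set k | [forall c : 'I_d.+2,
   (c < d.+1) ==> [exists j, (j != k) && (Ordinal (lb j) == c)]]]); last first.
  apply/setP => k; rewrite !inE; apply/forallP/forallP => H c.
    apply/implyP => cd; have /existsP[j jc] := H (Ordinal cd).
    by apply/existsP; exists j; rewrite -val_eqE.
  have /implyP/(_ (ltn_ord c))/existsP[j] := H (widen_ord (leqnSn _) c).
  by rewrite -val_eqE /= => jc; apply/existsP; exists j.
rewrite odd_covering_facets.
have -> : full d.+1 x = [forall c, exists j, Ordinal (lb j) == c].
  by apply: eq_forallb => c; apply: eq_existsb => j; rewrite -val_eqE.
by case: ifP.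
Qed.

End Step.

Lemma odd_full d : d <= N -> odd #|[set x | simplex_dim d x && full d x]|.
Proof.
elim: d => [_|d IH dN]; last by rewrite (odd_full_step dN) IH// ltnW.
(* In dimension 0 the only simplex is the origin, whose label is 0 because all its coordinates
   vanish. *)
rewrite (_ : [set x | _] = [set ([ffun=> ord0], [ffun i => i])]) ?cards1//.
apply/setP => x; rewrite !inE; apply/andP/eqP => [[/simplex_dimP[inj H] _]|->].
  apply: injective_projections; apply/ffunP => i; rewrite /= ffunE.
    by have [/= h _] := H i isT; apply: val_inj.
  by have [] := H i isT.
split.
  apply/simplex_dimP; split => [i j|i _]; first by rewrite !ffunE.
  by rewrite !ffunE.
apply/forallP => c; apply/existsP; exists ord0; rewrite (ord1 c) /=.
set v := vert _ _.
have v0 i : v i = 0 by rewrite /v /vert !ffunE /= addn0.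
case E : (lbl v) => [//|k].
have kN : k < N by rewrite -E; exact: lbl_le.
by have := @lbl_zero v (Ordinal kN) (v0 _); rewrite E eqxx.
Qed.

Theorem kuhn_lemma : exists x : simplex, forall c, c <= N -> exists2 j, j <= N & lbl (vert x j) = c.
Proof.
have := odd_full (leqnn N).
have [->|/set0Pn[x]] := eqVneq [set x | simplex_dim N x && full N x] set0; first by rewrite cards0.
rewrite inE => /andP[_ /forallP xf] _; exists x => c cN.
have /existsP[j /eqP jc] := xf (Ordinal (cN : c < N.+1)).
by exists j => //; rewrite -ltnS.
Qed.

End Kuhn.

(* Imported only here because classical sets shadow the finite sets used above. *)
From mathcomp Require Import all_classical all_reals all_analysis.
From mathcomp Require Import measurable_realfun ring lra.

Import numFieldNormedType.Exports.

Local Open Scope classical_set_scope.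
Local Open Scope ring_scope.

(** * Linear identities between vectors by reflection *)

Section ModuleExpressions.
Context {K : comPzRingType} {V : lmodType K}.

Inductive mexp : Type :=
  | MVar of nat | MZero | MAdd of mexp & mexp | MOpp of mexp | MScale of K & mexp.

Fixpoint meval (vs : seq V) (e : mexp) : V :=
  match e with
  | MVar i => nth 0 vs i
  | MZero => 0
  | MAdd a b => meval vs a + meval vs b
  | MOpp a => - meval vs a
  | MScale c a => c *: meval vs a
  end.

Fixpoint mcoef (e : mexp) (i : nat) : K :=
  match e with
  | MVar j => if eqn i j then 1 else 0
  | MZero => 0
  | MAdd a b => mcoef a i + mcoef b i
  | MOpp a => - mcoef a i
  | MScale c a => c * mcoef a i
  end.

(** A computed conjunction rather than a quantification over indices, so that each coefficient
    becomes a separate goal for [ring]. *)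
Fixpoint mcoef_eq (a b : mexp) (n : nat) : Prop :=
  match n with
  | 0%N => True
  | n'.+1 => mcoef a n' = mcoef b n' /\ mcoef_eq a b n'
  end.

Fixpoint mbound (e : mexp) (n : nat) : bool :=
  match e with
  | MVar i => (i < n)%N
  | MZero => true
  | MAdd a b => mbound a n && mbound b n
  | MOpp a => mbound a n
  | MScale _ a => mbound a n
  end.

Lemma mevalE vs e : mbound e (size vs) ->
  meval vs e = \sum_(i < size vs) mcoef e i *: nth 0 vs i.
Proof.
elim: e => /= [j|_|a IHa b IHb|a IHa|c a IHa].
- move=> jn.
  rewrite (bigD1 (Ordinal jn)) //= (introT eqnP (erefl j)) scale1r big1 ?addr0 // => i ij.
  suff -> : eqn i j = false by rewrite scale0r.
  by apply/eqnP => e; move/eqP: ij; apply; exact: val_inj.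
- by rewrite big1 // => i _; rewrite scale0r.
- by move=> /andP[/IHa -> /IHb ->]; rewrite -big_split; apply: eq_bigr => i _; rewrite scalerDl.
- by move=> /IHa ->; rewrite -sumrN; apply: eq_bigr => i _; rewrite scaleNr.
- by move=> /IHa ->; rewrite scaler_sumr; apply: eq_bigr => i _; rewrite scalerA.
Qed.

Lemma meval_eq vs a b : mbound a (size vs) -> mbound b (size vs) ->
  mcoef_eq a b (size vs) -> meval vs a = meval vs b.
Proof.
move=> ba bb; rewrite !mevalE// => h; apply: eq_bigr => i _; congr (_ *: _).
by case: i h => i /= ; move: (size vs) => n; elim: n => // n IH; rewrite ltnS leq_eqVlt
  => /predU1P[-> []|/IH{}IH []].
Qed.

End ModuleExpressions.

Ltac mindex x l n :=
  match l with
  | x :: _ => n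
  | _ :: ?l' => mindex x l' (S n)
  end.

Ltac matoms e l :=
  match e with
  | ?a + ?b => let l := matoms a l in matoms b l
  | - ?a => matoms a l
  | _ *: ?a => matoms a l
  | 0 => l
  | ?x => match l with
          | context [x :: _] => l
          | _ => constr:(x :: l)
          end
  end.

Ltac mreify K e l :=
  match e with
  | ?a + ?b => let a := mreify K a l in let b := mreify K b l in
      constr:(@MAdd K a b)
  | - ?a => let a := mreify K a l in constr:(@MOpp K a)
  | ?c *: ?a => let a := mreify K a l in constr:(@MScale K c a)
  | 0 => constr:(@MZero K)
  | ?x => let i := mindex x l O in constr:(@MVar K i)
  end.

(* Decides linear identities between vectors by comparing coefficients. *)
Ltac module K :=
  lazymatch goal with
  | |- @eq ?V ?a ?b =>
    let l := matoms a (@nil V) in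
    let l := matoms b l in
    let ea := mreify K a l in
    let eb := mreify K b l in
    apply: (@meval_eq _ _ l ea eb); [reflexivity|reflexivity|
      cbn [mcoef_eq mcoef size eqn]; repeat split; ring]
  end.

(** * Right derivatives and differential inequalities *)

Section RealInduction.
Context {R : realType}.

(** Consider the supremum of the points up to which [P] holds throughout. The condition from the
    left shows that [P] holds at the supremum, and the condition to the right pushes beyond it
    unless it is [b]. *)
Lemma real_ind (P : R -> Prop) (a b : R) : a <= b -> P a ->
  (forall t, a <= t < b -> P t -> \forall s \near t^'+, P s) ->
  (forall t, a < t <= b -> (forall s, a <= s < t -> P s) -> P t) ->
  P b.
Proof.
move=> ab Pa Pr Pl.
pose S := [set t | a <= t <= b /\ forall s, a <= s <= t -> P s].
have Sa : S a.
  by split; [rewrite lexx ab|move=> s; rewrite -eq_le => /eqP <-].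
have hS : has_sup S.
  by split; [exists a|exists b => t [/andP[]]].
have cS : a <= sup S <= b.
  apply/andP; split; first by apply: ub_le_sup => //; case: hS.
  by apply: ge_sup; [case: hS|move=> t [/andP[]]].
have lS s : a <= s < sup S -> P s.
  move=> /andP[As sS].
  have e0 : 0 < sup S - s by rewrite subr_gt0.
  have [t [_ St] st] := sup_adherent e0 hS.
  by apply: St; rewrite As ltW//; move: st; lra.
have PS : P (sup S).
  have [<-//|aS] := eqVneq a (sup S).
  by apply: Pl => //; rewrite lt_neqAle aS; case/andP: cS => -> ->.
have SS s : a <= s <= sup S -> P s.
  move=> /andP[as_ ]; rewrite le_eqVlt => /predU1P[->//|sS].
  by apply: lS; rewrite as_.
have [<-//|Sb] := eqVneq (sup S) b.
have Sb' : sup S < b by rewrite lt_neqAle Sb; case/andP: cS.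
have {}Pr : \forall s \near (sup S)^'+, P s.
  by apply: Pr => //; rewrite Sb' andbT; case/andP: cS.
have [e /= e0 He] := Pr.
pose t := Num.min b (sup S + e / 2).
have St : sup S < t.
  by rewrite lt_min Sb'/= ltrDl divr_gt0.
suff : S t by move=> /(ub_le_sup (proj2 hS)); rewrite leNgt St.
split.
  rewrite ge_min lexx/= andbT; apply: ltW.
  by apply: le_lt_trans St; case/andP: cS.
move=> s /andP[as_ st].
have [|sS] := leP s (sup S); first by move=> ?; apply: SS; rewrite as_.
apply: He => //=.
move: st; rewrite le_min => /andP[_ st].
rewrite ltr0_norm ?subr_lt0//; move: st; move: e0; lra.
Qed.

End RealInduction.

Section RightDerivative.
Context {R : realType}.
Implicit Types (F : normedModType R) (t a b : R).

(** A trajectory has no two-sided derivative where the control jumps, but it has a right derivative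
    there, since the control is right continuous. The increment form avoids quotients in the
    estimates. *)
Definition rderiv {F} (y : R -> F) t (v : F) := forall e, 0 < e ->
  \forall s \near t^'+, `|y s - y t - (s - t) *: v| <= e * (s - t).

Lemma near_rightP t (P : R -> Prop) :
  (\forall s \near t^'+, P s) <->
  exists2 d, 0 < d & forall s, t < s < t + d -> P s.
Proof.
split=> [[d /= d0 H]|[d d0 H]].
  exists d => // s /andP[ts sd]; apply: H => //=.
  by rewrite ltr0_norm ?subr_lt0//; lra.
exists d => //= s; rewrite /ball_ /= => sd ts; apply: H; rewrite ts/=.
by move: sd; rewrite ltr0_norm ?subr_lt0//; lra.
Qed.

Lemma near_leftP t (P : R -> Prop) :
  (\forall s \near t^'-, P s) <->
  exists2 d, 0 < d & forall s, t - d < s < t -> P s.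
Proof.
split=> [[d /= d0 H]|[d d0 H]].
  exists d => // s /andP[ts sd]; apply: H => //=.
  by rewrite gtr0_norm ?subr_gt0//; lra.
exists d => //= s; rewrite /ball_ /= => sd ts; apply: H; rewrite ts/= andbT.
by move: sd; rewrite gtr0_norm ?subr_gt0//; lra.
Qed.

Lemma near_to_right t (P : set R) : nbhs t P -> t^'+ P.
Proof. by apply: filterS. Qed.

Lemma near_to_left t (P : set R) : nbhs t P -> t^'- P.
Proof. by apply: filterS. Qed.

Lemma rderiv_near F (y z : R -> F) t v : z t = y t ->
  (\forall s \near t^'+, z s = y s) -> rderiv y t v -> rderiv z t v.
Proof.
by move=> zt zy yv e e0; apply: filterS2 zy (yv e e0) => s ->; rewrite zt.
Qed.

Lemma rderiv_cst F (c : F) t : rderiv (fun=> c) t 0.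
Proof.
move=> e e0; near=> s.
rewrite subrr scaler0 subr0 normr0 mulr_ge0 ?(ltW e0)// subr_ge0 ltW//.
Unshelve. all: by end_near. Qed.

Lemma rderivD F (y z : R -> F) t v w :
  rderiv y t v -> rderiv z t w -> rderiv (fun s => y s + z s) t (v + w).
Proof.
move=> yv zw e e0; have e20 : 0 < e / 2 by rewrite divr_gt0.
apply: filterS2 (yv _ e20) (zw _ e20) => s ys zs.
rewrite [X in `|X|](_ : _ =
  (y s - y t - (s - t) *: v) + (z s - z t - (s - t) *: w)); last by module R.
by apply: le_trans (ler_normD _ _) _; lra.
Qed.

Lemma rderivZ F (y : R -> F) t v (c : R) :
  rderiv y t v -> rderiv (fun s => c *: y s) t (c *: v).
Proof.
move=> yv e e0; have c0 : 0 < `|c| + 1 by rewrite ltr_wpDl.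
have ec : 0 < e / (`|c| + 1) by rewrite divr_gt0.
near=> s.
rewrite [X in `|X|](_ : _ = c *: (y s - y t - (s - t) *: v)); last by module R.
rewrite normrZ; apply: (@le_trans _ _ ((`|c| + 1) * (e / (`|c| + 1) * (s - t)))).
  by apply: ler_pM => //; [rewrite lerDl|near: s; exact: yv].
by rewrite mulrA mulrCA mulfV ?mulr1 ?gt_eqF.
Unshelve. all: by end_near. Qed.

Lemma rderivN F (y : R -> F) t v : rderiv y t v -> rderiv (fun s => - y s) t (- v).
Proof. by move=> /(rderivZ (-1)); rewrite scaleN1r; under eq_fun do rewrite scaleN1r. Qed.

Lemma rderivB F (y z : R -> F) t v w :
  rderiv y t v -> rderiv z t w -> rderiv (fun s => y s - z s) t (v - w).
Proof. by move=> yv /rderivN; exact: rderivD. Qed.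

Lemma rderiv_sum F (I : Type) (r : seq I) (y : I -> R -> F) t (v : I -> F) :
  (forall i, rderiv (y i) t (v i)) ->
  rderiv (fun s => \sum_(i <- r) y i s) t (\sum_(i <- r) v i).
Proof.
move=> yv; elim: r => [|i r IH].
  by rewrite big_nil; under eq_fun do rewrite big_nil; exact: rderiv_cst.
by rewrite big_cons; under eq_fun do rewrite big_cons; exact: rderivD.
Qed.

Lemma rderiv_le F (y : R -> F) t v : rderiv y t v ->
  \forall s \near t^'+, `|y s - y t| <= (`|v| + 1) * (s - t).
Proof.
move=> yv; near=> s.
have st : 0 <= s - t by rewrite subr_ge0 ltW.
rewrite -[y s - y t](subrK ((s - t) *: v)).
apply: le_trans (ler_normD _ _) _; rewrite normrZ ger0_norm//.
have : `|y s - y t - (s - t) *: v| <= 1 * (s - t) by near: s; exact: yv.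
by lra.
Unshelve. all: by end_near. Qed.

(** One product rule for the two pairings in use, scalar multiplication and evaluation of an
    operator at a vector. *)
Lemma rderiv_bilin (F G H : normedModType R) (b : F -> G -> H) (M : R)
  (y : R -> F) (z : R -> G) t v w :
  (forall x x' z, b (x - x') z = b x z - b x' z) ->
  (forall x z z', b x (z - z') = b x z - b x z') ->
  (forall (c : R) x z, b (c *: x) z = c *: b x z) ->
  (forall (c : R) x z, b x (c *: z) = c *: b x z) ->
  (forall x z, `|b x z| <= M * `|x| * `|z|) ->
  rderiv y t v -> rderiv z t w ->
  rderiv (fun s => b (y s) (z s)) t (b v (z t) + b (y t) w).
Proof.
move=> bBl bBr bZl bZr bM yv zw e e0.
have bMg x z' : `|b x z'| <= (`|M| + 1) * (`|x| * `|z'|).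
  apply: le_trans (bM _ _) _; rewrite -mulrA ler_wpM2r// ?mulr_ge0//.
  by rewrite (le_trans (ler_norm _))// lerDl.
set N := `|M| + 1 in bMg; have N0 : 0 < N by rewrite ltr_wpDl.
(* [k] absorbs the two first-order remainders, and [c] bounds the product of the increments, which
   is quadratic in [s - t]. *)
pose k := N * (`|z t| + `|y t| + 1).
have k0 : 0 < k by rewrite mulr_gt0// ltr_wpDl// addr_ge0.
pose c := N * ((`|v| + 1) * (`|w| + 1)).
have c0 : 0 < c by rewrite !mulr_gt0// ltr_wpDl.
have e1 : 0 < e / 2 / k by rewrite !divr_gt0.
have e2 : 0 < e / 2 / c by rewrite !divr_gt0.
near=> s.
have st : 0 <= s - t by rewrite subr_ge0 ltW.
have -> : b (y s) (z s) - b (y t) (z t) - (s - t) *: (b v (z t) + b (y t) w) =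
   (b (y s - y t - (s - t) *: v) (z t) + b (y t) (z s - z t - (s - t) *: w)) +
   b (y s - y t) (z s - z t).
  by rewrite !(bBl, bBr, bZl, bZr); module R.
have ys : `|y s - y t - (s - t) *: v| <= e / 2 / k * (s - t) by near: s; exact: yv.
have zs : `|z s - z t - (s - t) *: w| <= e / 2 / k * (s - t) by near: s; exact: zw.
have dy : `|y s - y t| <= (`|v| + 1) * (s - t) by near: s; exact: rderiv_le.
have dz : `|z s - z t| <= (`|w| + 1) * (s - t) by near: s; exact: rderiv_le.
have sc : s - t <= e / 2 / c.
  by rewrite lerBlDl ltW//; near: s; apply: nbhs_right_lt; rewrite ltrDl.
have -> : e * (s - t) = N * (e / 2 / k * (s - t) * `|z t| + `|y t| * (e / 2 / k * (s - t)))
   + N * (e / 2 / k * (s - t)) + e / 2 * (s - t).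
  rewrite /k; field; rewrite gt_eqF//= gt_eqF// ltr_wpDl// addr_ge0//.
apply: le_trans (ler_normD _ _) _; apply: lerD.
  apply: le_trans (ler_normD _ _) _.
  apply: (@le_trans _ _ (N * (e / 2 / k * (s - t) * `|z t| + `|y t| * (e / 2 / k * (s - t))))).
    rewrite mulrDr; apply: lerD; apply: le_trans (bMg _ _) _; rewrite ler_pM2l//.
      by rewrite ler_wpM2r.
    by rewrite ler_wpM2l.
  by rewrite lerDl !mulr_ge0// ltW// invr_gt0.
apply: le_trans (bMg _ _) _.
apply: (@le_trans _ _ (N * (((`|v| + 1) * (s - t)) * ((`|w| + 1) * (s - t))))).
  by rewrite ler_pM2l//; apply: ler_pM.
have -> : N * (((`|v| + 1) * (s - t)) * ((`|w| + 1) * (s - t))) = (c * (s - t)) * (s - t).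
  by rewrite /c; ring.
by rewrite ler_wpM2r// mulrC -ler_pdivlMr.
Unshelve. all: by end_near. Qed.

Lemma rderiv_scale F (S : R -> R^o) (y : R -> F) t (s' : R^o) v :
  rderiv S t s' -> rderiv y t v ->
  rderiv (fun s => (S s : R) *: y s) t ((s' : R) *: y t + (S t : R) *: v).
Proof.
apply: (@rderiv_bilin R^o F F (fun (a : R^o) (x : F) => (a : R) *: x) 1).
- by move=> *; rewrite scalerBl.
- by move=> *; rewrite scalerBr.
- by move=> *; rewrite scalerA.
- by move=> *; rewrite !scalerA mulrC.
- by move=> x z; rewrite mul1r normrZ.
Qed.

Lemma rderiv_derive F (y : R -> F) t : derivable y t 1 -> rderiv y t ('D_1 y t).
Proof.
move=> /cvgrPdist_le yt e e0; have [d /= d0 yd] := yt e e0.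
apply/near_rightP; exists d => // s /andP[ts sd].
have st : 0 < s - t by rewrite subr_gt0.
have := yd (s - t); rewrite /ball_ /= sub0r normrN gtr0_norm// gt_eqF//.
rewrite /= [_%:A]mulr1 subrK => h.
have {}h : `|'D_1 y t - (s - t)^-1 *: (y s - y t)| <= e by apply: h => //; move: sd; lra.
rewrite [X in `|X|](_ : _ = (s - t) *: ((s - t)^-1 *: (y s - y t) - 'D_1 y t)).
  by rewrite normrZ gtr0_norm// mulrC distrC ler_pM2r.
by rewrite scalerBr scalerA mulfV ?gt_eqF// scale1r.
Qed.

Lemma rderiv_is_derive F (y : R -> F) t v : is_derive t 1 y v -> rderiv y t v.
Proof. by move=> [yt <-]; exact: rderiv_derive. Qed.

Lemma rderiv_id t : rderiv (id : R -> R^o) t 1.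
Proof.
move=> e e0; near=> s.
rewrite [_ *: _]mulr1 subrr normr0 mulr_ge0 ?(ltW e0)// subr_ge0 ltW//.
Unshelve. all: by end_near. Qed.

(* Where the bound is attained, strict domination of the right derivatives propagates
   it to the right; elsewhere continuity does. *)
Lemma rderiv_norm_le F (y : R -> F) (m : R -> R^o) a b : a <= b ->
  continuous y -> continuous m ->
  `|y a| <= m a ->
  (forall t, a <= t < b -> `|y t| = m t ->
    exists v m', [/\ rderiv y t v, rderiv m t m' & `|v| < m']) ->
  `|y b| <= m b.
Proof.
move=> ab cy cm yma H; apply: (@real_ind _ (fun t => `|y t| <= m t) a b) => //.
- move=> t tab; rewrite le_eqVlt => /predU1P[ymt|ymt].
    have [v [m' [yv mm' vm]]] := H t tab ymt.
    pose e := (m' - `|v|) / 2.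
    have e0 : 0 < e by rewrite divr_gt0// subr_gt0.
    near=> s.
    have st : 0 <= s - t by rewrite subr_ge0 ltW.
    have ys : `|y s - y t - (s - t) *: v| <= e * (s - t) by near: s; exact: yv.
    have ms : `|m s - m t - (s - t) *: m'| <= e * (s - t) by near: s; exact: mm'.
    have {}ms : m t + (s - t) * m' - e * (s - t) <= m s.
      by move: ms; rewrite ler_norml [_ *: _]/GRing.scale/= => /andP[]; lra.
    rewrite (_ : y s = (y s - y t - (s - t) *: v) + y t + (s - t) *: v); last by module R.
    apply: le_trans (ler_normD _ _) _; rewrite normrZ ger0_norm//.
    apply: le_trans ms; rewrite -ymt.
    have -> : m' = 2 * e + `|v| by rewrite /e; lra.
    have := ler_normD (y s - y t - (s - t) *: v) (y t).
    by move: ys; set A := `|_|; set B := `|_|; lra.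
  have : \forall s \near t, 0 < (m s : R) - `|y s|.
    have : (m s : R) - `|y s| @[s --> t] --> (m t : R) - `|y t|.
      by apply: cvgB; [exact: cm|apply: cvg_norm; exact: cy].
    by move=> /cvgr_gt; apply; rewrite subr_gt0.
  by move=> /near_to_right; apply: filterS => s; rewrite subr_gt0 => /ltW.
- move=> t /andP[at_ tb] yms.
  rewrite leNgt; apply/negP => ymt.
  have : \forall s \near t, 0 < `|y s| - (m s : R).
    have : `|y s| - (m s : R) @[s --> t] --> `|y t| - (m t : R).
      by apply: cvgB; [apply: cvg_norm; exact: cy|exact: cm].
    by move=> /cvgr_gt; apply; rewrite subr_gt0.
  move=> /near_to_left /near_leftP[d d0] /(_ (Num.max a (t - d / 2))).
  rewrite comparable_lt_max ?comparable_gt_max ?real_comparable ?num_real//.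
  have -> : t - d < t - d / 2 by lra.
  have td : t - d / 2 < t by lra.
  rewrite orbT at_ td => /(_ isT); rewrite subr_gt0.
  rewrite ltNge yms//.
  by rewrite le_max lexx/= gt_max at_ td.
Unshelve. all: by end_near. Qed.

Lemma rderiv_expR (L t : R) :
  rderiv (fun s => expR (L * s) : R^o) t (L * expR (L * t)).
Proof.
apply: rderiv_is_derive.
have dL : is_derive t 1 (L *: (id : R -> R)) (L *: (1 : R)) by apply: is_deriveZ.
have -> : (fun s => expR (L * s) : R^o) = expR \o (L *: (id : R -> R)) by [].
have -> : L * expR (L * t) = expR ((L *: (id : R -> R)) t) * (L *: (1 : R)).
  by rewrite [_ *: 1]mulr1 mulrC.
exact: is_derive1_comp.
Qed.

Lemma gronwall F (y : R -> F) (B : R -> R^o) (L : R) a b : a <= b -> 0 <= L ->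
  continuous y -> continuous B ->
  (forall t, a <= t < b -> exists v b', [/\ rderiv y t v, rderiv B t b',
     0 <= b' & `|v| <= L * `|y t| + b']) ->
  `|y b| <= expR (L * (b - a)) * (`|y a| + (B b - B a)).
Proof.
move=> ab L0 cy cB H.
suff He e : 0 < e -> `|y b| <= expR (L * (b - a)) * (`|y a| + (B b - B a) + e * (b - a)).
  rewrite leNgt; apply/negP => hlt.
  set X := expR _ in He hlt; set Z := `|y a| + _ in He hlt.
  have X0 : 0 < X by exact: expR_gt0.
  pose e := (`|y b| - X * Z) / 2 / (X * (b - a + 1)).
  have ba : 0 < b - a + 1 by rewrite ltr_wpDl// subr_ge0.
  have e0 : 0 < e by rewrite !divr_gt0// ?mulr_gt0// subr_gt0.
  have h1 := He e e0.
  have h2 : X * (e * (b - a + 1)) = (`|y b| - X * Z) / 2.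
    by rewrite /e; field; rewrite !gt_eqF.
  have h3 : 0 < X * e by rewrite mulr_gt0.
  have h4 : X * (Z + e * (b - a)) = X * Z + X * (e * (b - a + 1)) - X * e by ring.
  move: h1; rewrite h4 h2; move: hlt h3; set W := X * Z; set U := X * e; lra.
move=> e0.
pose m (t : R) : R^o := expR (L * (t - a)) * (`|y a| + (B t - B a) + e * (t - a)).
have exp_shift t : expR (L * (t - a)) = expR (- (L * a)) * expR (L * t).
  by rewrite -expRD; congr expR; ring.
apply: (@rderiv_norm_le _ y m a b) => //.
- move=> t; rewrite /m; apply: (@cvgM R).
    apply: (@cvg_comp _ _ _ (fun s => L * (s - a)) expR _ (nbhs (L * (t - a)))).
      by apply: (@cvgM R); [exact: cvg_cst|apply: cvgB; [exact: cvg_id|exact: cvg_cst]].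
    exact: continuous_expR.
  apply: cvgD; first by apply: cvgD; [exact: cvg_cst|apply: cvgB; [exact: cB|exact: cvg_cst]].
  by apply: (@cvgM R); [exact: cvg_cst|apply: cvgB; [exact: cvg_id|exact: cvg_cst]].
- by rewrite /m (subrr a) (subrr (B a)) mulr0 expR0 mulr0 !addr0 mul1r.
- move=> t tab ymt.
  have [v [b' [yv Bb b0 vb]]] := H t tab.
  exists v, (L * expR (L * (t - a)) * (`|y a| + (B t - B a) + e * (t - a)) + expR (L * (t - a)) * (b' + e)).
  split=> //.
    rewrite !exp_shift.
    have h1 := rderivZ (expR (- (L * a))) (rderiv_expR L t).
    have h2 : rderiv (fun s => (`|y a| + (B s - B a) + e * (s - a)) : R^o) t (b' + e).
      have := rderivD (rderivB (rderivD (rderiv_cst (`|y a| : R^o) t) Bb) (rderiv_cst (B a : R^o) t))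
         (rderivZ e (rderivB (rderiv_id t) (rderiv_cst (a : R^o) t))).
      rewrite add0r !subr0 [_ *: _]mulr1; congr (rderiv _ _ _).
      by apply/funext => s; rewrite -[_ *: _]/(_ * _) addrA.
    have := rderiv_scale h1 h2.
    rewrite /m; under [X in _ -> rderiv X _ _]eq_fun do rewrite exp_shift.
    congr rderiv.
    rewrite -![_ *: _]/(_ * _); ring.
  apply: le_lt_trans vb _; rewrite ymt.
  have -> : L * m t = L * expR (L * (t - a)) * (`|y a| + (B t - B a) + e * (t - a)).
    by rewrite /m mulrA.
  rewrite ltrD2l; apply: (@lt_le_trans _ _ (1 * (b' + e))); first by rewrite mul1r ltrDl.
  rewrite ler_wpM2r ?addr_ge0 ?(ltW e0)//.
  rewrite -expR0 ler_expR mulr_ge0// subr_ge0; by case/andP: tab.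
Qed.

Lemma rderiv_mvi F (y : R -> F) (B : R -> R^o) a b : a <= b ->
  continuous y -> continuous B ->
  (forall t, a <= t < b -> exists v b', [/\ rderiv y t v, rderiv B t b' & `|v| <= b']) ->
  `|y b - y a| <= B b - B a.
Proof.
move=> ab cy cB H.
have := @gronwall _ (fun t => y t - y a) B 0 a b ab (lexx _) _ cB.
rewrite mul0r expR0 mul1r subrr normr0 add0r; apply.
  by move=> t; apply: cvgB; [exact: cy|exact: cvg_cst].
move=> t /H[v [b' [yv Bb vb]]]; exists v, b'; split => //.
- by have := rderivB yv (rderiv_cst (y a) t); rewrite subr0.
- exact: le_trans vb.
- by rewrite mul0r add0r.
Qed.

Lemma rderiv_lip F (y : R -> F) (C : R) a b : a <= b -> continuous y ->
  (forall t, a <= t < b -> exists2 v, rderiv y t v & `|v| <= C) ->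
  `|y b - y a| <= C * (b - a).
Proof.
move=> ab cy H; rewrite mulrBr.
apply: (@rderiv_mvi _ y (fun t => C * t) a b) => //.
  by move=> t; apply: (@cvgM R); [exact: cvg_cst|exact: cvg_id].
move=> t /H[v yv vC]; exists v, C; split => //.
by have := rderivZ C (rderiv_id t); rewrite [_ *: _]mulr1.
Qed.

End RightDerivative.

(** * Primitives and differential equations with one-sided limits *)

Section GeometricLimits.
Context {R : realType}.
Implicit Types (F : normedModType R).

(** Completeness restricted to sequences with geometrically decreasing steps. It passes easily to
    products, rows and operator spaces, and it suffices for primitives and for Picard iteration. *)
Definition geom_complete F := forall (y : nat -> F) (C : R),
  (forall n, `|y n.+1 - y n| <= C / 2 ^+ n) -> exists l : F, y @ \oo --> l.

Lemma geom_small (C e : R) : 0 < e -> exists n, C / 2 ^+ n <= e.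
Proof.
move=> e0.
have : (C * 2^-1 ^+ n) @[n --> \oo] --> C * 0.
  by apply: cvgMr; apply: cvg_expr; rewrite ger0_norm// invf_lt1// ltr1n.
rewrite mulr0 => /cvgrPdist_le /(_ e e0) [n _ /(_ n (leqnn n))].
rewrite /= sub0r normrN => h; exists n; rewrite -exprVn.
exact: le_trans (ler_norm _) h.
Qed.

Lemma geom_dist F (y : nat -> F) (C : R) :
  (forall n, `|y n.+1 - y n| <= C / 2 ^+ n) ->
  forall n k, `|y (n + k)%N - y n| <= 2 * C / 2 ^+ n.
Proof.
move=> h n k.
have C0 : 0 <= C by have := h 0%N; rewrite expr0 divr1; exact: le_trans.
(* Subtracting the tail still available after step [n + k] is what closes the induction. *)
suff : `|y (n + k)%N - y n| <= 2 * C / 2 ^+ n - 2 * C / 2 ^+ (n + k).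
  move=> /le_trans; apply; rewrite gerBl mulr_ge0// ?invr_ge0 ?exprn_ge0//.
  by rewrite mulr_ge0.
elim: k => [|k IH]; first by rewrite addn0 !subrr normr0.
rewrite (_ : y (n + k.+1)%N - y n = (y (n + k).+1 - y (n + k)%N) + (y (n + k)%N - y n)); last by rewrite addnS; module R.
apply: le_trans (ler_normD _ _) _.
have := h (n + k)%N.
rewrite addnS exprS invfM.
set u := (2 ^+ (n + k))^-1; set v := (2 ^+ n)^-1 in IH *; move: IH.
by rewrite -/u; set p := C * u; set q := C * v; move: (`|_|) (`|_|) => A B;
  rewrite -!mulrA -/p -/q !(mulrCA C) -/p; lra.
Qed.

Lemma geom_tail F (y : nat -> F) (C : R) l :
  (forall n, `|y n.+1 - y n| <= C / 2 ^+ n) -> y @ \oo --> l ->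
  forall n, `|l - y n| <= 2 * C / 2 ^+ n.
Proof.
move=> h yl n.
have yk : `|y k - y n| @[k --> \oo] --> `|l - y n|.
  by apply: cvg_norm; apply: cvgB => //; exact: cvg_cst.
rewrite -(cvg_lim _ yk)//; apply: limr_le; first by apply/cvg_ex; exists `|l - y n|.
exists n => // k /= nk; rewrite -(subnKC nk); exact: geom_dist.
Qed.

Lemma geom_complete_complete (F : completeNormedModType R) : geom_complete F.
Proof.
move=> y C h.
suff /cvg_ex[l yl] : cvgn y by exists l.
have -> : y = (fun n => y 0%N + series (fun k => y k.+1 - y k) n).
  by apply/funext => n; rewrite /series/= telescope_sumr// addrC subrK.
apply: is_cvgD; first exact: is_cvg_cst.
apply: normed_cvg.
apply: (@series_le_cvg _ _ (geometric C 2^-1)) => [n|n|n|].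
- exact: normr_ge0.
- rewrite /geometric/= mulr_ge0// ?exprn_ge0 ?invr_ge0//.
  by have := h 0%N; rewrite expr0 divr1; exact: le_trans.
- by rewrite /geometric/= exprVn; exact: h.
- by apply: is_cvg_geometric_series; rewrite ger0_norm// invf_lt1// ltr1n.
Qed.

Lemma geom_unif F (y : nat -> R -> F) (C : R) : geom_complete F ->
  (forall n t, `|y n.+1 t - y n t| <= C / 2 ^+ n) ->
  exists Y, forall n t, `|Y t - y n t| <= 2 * C / 2 ^+ n.
Proof.
move=> cF h.
have /choice[Y HY] : forall t, exists l : F, y ^~ t @ \oo --> l.
  by move=> t; apply: (cF _ C) => n; exact: h.
by exists Y => n t; apply: (@geom_tail _ (y ^~ t)) => // k; exact: h.
Qed.

Lemma geom_unif_continuous F (y : nat -> R -> F) (Y : R -> F) (C : R) :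
  (forall n, continuous (y n)) -> (forall n t, `|Y t - y n t| <= C / 2 ^+ n) ->
  continuous Y.
Proof.
move=> cy h t; apply/cvgrPdist_le => e e0.
have e3 : 0 < e / 3 by rewrite divr_gt0.
have [n Hn] := geom_small C e3.
have := cy n t => /cvgrPdist_le /(_ _ e3); apply: filterS => s ys.
rewrite (_ : Y t - Y s = (Y t - y n t) + (y n t - y n s) - (Y s - y n s)); last by module R.
have := ler_normB ((Y t - y n t) + (y n t - y n s)) (Y s - y n s).
have := ler_normD (Y t - y n t) (y n t - y n s).
have := le_trans (h n t) Hn; have := le_trans (h n s) Hn; move: ys.
by lra.
Qed.

(** Precomposition with [clamp a b] extends a function from [[a, b]] to the line by constants, so
    that continuity can be stated without restriction to the interval. *)
Definition clamp (a b t : R) : R := Num.max a (Num.min b t).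

Lemma clamp_itv a b t : a <= b -> a <= clamp a b t <= b.
Proof. by move=> ab; rewrite /clamp le_max lexx/= ge_max ab/= ge_min lexx. Qed.

Lemma clampE a b t : a <= t <= b -> clamp a b t = t.
Proof. by move=> /andP[at_ tb]; rewrite /clamp min_r// max_r. Qed.

Lemma continuous_clamp a b : continuous (clamp a b).
Proof.
apply: (@max_fun_continuous _ R R (fun=> a) (fun t => Num.min b t)).
  exact: cst_continuous.
by apply: (@min_fun_continuous _ R R (fun=> b) id); [exact: cst_continuous|move=> x; exact: cvg_id].
Qed.

End GeometricLimits.

Definition cadlag {R : realType} {S : topologicalType} (a b : R) (w : R -> S) :=
  (forall t, a <= t < b -> w @ t^'+ --> w t) /\
  (forall t, a < t <= b -> exists l : S, w @ t^'- --> l).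

Section Primitives.
Context {R : realType} {F : normedModType R}.
Implicit Types (w W y : R -> F) (a b t : R).

Let glue W c (v : F) (s : R) := W (Num.min s c) + Num.max (s - c) 0 *: v.

Let glue_cont W c v : continuous W -> continuous (glue W c v).
Proof.
move=> cW t; apply: cvgD.
  apply: (@cvg_comp _ _ _ (fun s => Num.min s c) W _ (nbhs (Num.min t c))); last exact: cW.
  apply: (@min_fun_continuous _ R R id (fun=> c)); last exact: cst_continuous.
  by move=> x; exact: cvg_id.
apply: cvgZr_tmp.
apply: (@max_fun_continuous _ R R (fun s => s - c) (fun=> 0)); last exact: cst_continuous.
by move=> x; apply: cvgB; [exact: cvg_id|exact: cvg_cst].
Qed.

Let glue_lt W c v t u : t < c -> rderiv W t u -> rderiv (glue W c v) t u.
Proof.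
move=> tc; apply: rderiv_near.
  by rewrite /glue min_l ?ltW// max_r ?scale0r ?addr0// subr_le0 ltW.
near=> s.
have sc : s <= c by apply/ltW; near: s; exact: nbhs_right_lt.
by rewrite /glue min_l// max_r ?scale0r ?addr0// subr_le0.
Unshelve. all: by end_near. Qed.

Let glue_ge W c v t : c <= t -> rderiv (glue W c v) t v.
Proof.
move=> ct e e0; near=> s.
have ts : t < s by near: s; exact: nbhs_right_gt.
rewrite /glue min_r ?(le_trans ct (ltW ts))// min_r// !max_l ?subr_ge0 ?(le_trans ct (ltW ts))//.
rewrite [X in `|X|](_ : _ = 0); last by module R.
by rewrite normr0 mulr_ge0 ?(ltW e0)// subr_ge0 ltW.
Unshelve. all: by end_near. Qed.

(** Piecewise affine approximate primitives, extended by real induction: beyond [t] with slope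
    [w t], thanks to right continuity, and up to [t] with the left limit as slope. *)
Lemma cadlag_approx_primitive a b w e : a <= b -> cadlag a b w -> 0 < e ->
  exists2 W, continuous W &
    forall t, a <= t < b -> exists2 v, rderiv W t v & `|v - w t| <= e.
Proof.
move=> ab [rw lw] e0.
pose P t := exists2 W, continuous W &
    forall s, a <= s < t -> exists2 v, rderiv W s v & `|v - w s| <= e.
apply: (@real_ind _ P a b) => //.
- exists (fun=> 0); first by move=> t; exact: cvg_cst.
  by move=> s /andP[as_ /(le_lt_trans as_)]; rewrite ltxx.
- move=> t tab [W cW HW].
  have /cvgrPdist_le /(_ e e0) /near_rightP[d d0 wd] := rw t tab.
  apply/near_rightP; exists d => // s /andP[ts sd].
  exists (glue W t (w t)); first exact: glue_cont.
  move=> r /andP[ar rs]; have [rt|tr] := ltP r t.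
    have [v Wv vw] := HW r (introT andP (conj ar rt)).
    by exists v => //; exact: glue_lt.
  exists (w t); first exact: glue_ge.
  move: tr; rewrite le_eqVlt => /predU1P[->|tr]; first by rewrite subrr normr0 ltW.
  by apply: wd; rewrite tr (lt_trans rs).
- move=> t tab HP.
  have [l /cvgrPdist_le /(_ e e0) /near_leftP[d d0 wd]] := lw t tab.
  pose c := Num.max a (t - d / 2).
  have ac : a <= c < t.
    by rewrite le_max lexx/= gt_max (andP tab).1/=; move: d0; lra.
  have [W cW HW] := HP c ac.
  exists (glue W c l); first exact: glue_cont.
  move=> s /andP[as_ st]; have [sc|cs] := ltP s c.
    have [v Wv vw] := HW s (introT andP (conj as_ sc)).
    by exists v => //; exact: glue_lt.
  exists l; first exact: glue_ge.
  apply: wd; rewrite st andbT.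
  by move: cs; rewrite ge_max => /andP[_]; move: d0; lra.
Qed.

(** A uniform limit of approximate primitives with errors [2^-1 ^+ n]. Its right derivative at [t]
    is found by comparing each approximation with an affine function of slope [w t] on an interval
    where [w] stays close to [w t]. *)
Lemma cadlag_primitive a b w : geom_complete F -> a <= b -> cadlag a b w ->
  exists W, [/\ continuous W, W a = 0 & forall t, a <= t < b -> rderiv W t (w t)].
Proof.
move=> cF ab cw.
have /choice[W0 HW0] : forall n : nat, exists W, continuous W /\ forall t, a <= t < b -> exists2 v, rderiv W t v & `|v - w t| <= 2^-1 ^+ n.
  move=> n; have [|W cW HW] := @cadlag_approx_primitive a b w (2^-1 ^+ n) ab cw.
    by rewrite exprn_gt0// invr_gt0.
  by exists W.
(* Clamping makes the bound on successive differences hold on the whole line, and all approximations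
   vanish at [a]. *)
pose W n t := W0 n (clamp a b t) - W0 n a.
have cW n : continuous (W n).
  move=> t; apply: cvgB; last exact: cvg_cst.
  apply: (@cvg_comp _ _ _ (clamp a b) (W0 n) _ (nbhs (clamp a b t))).
    exact: continuous_clamp.
  by case: (HW0 n) => + _; exact.
have dW n t : a <= t < b -> exists2 v, rderiv (W n) t v & `|v - w t| <= 2^-1 ^+ n.
  move=> tab; have [_ /(_ t tab)[v W0v vw]] := HW0 n.
  exists v => //; rewrite -[v]subr0; apply: rderivB; last exact: rderiv_cst.
  apply: rderiv_near W0v.
    by rewrite clampE//; case/andP: tab => -> /ltW ->.
  near=> s; rewrite clampE//.
  apply/andP; split.
    by apply: le_trans (andP tab).1 _; apply: ltW; near: s; exact: nbhs_right_gt.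
  by apply: ltW; near: s; apply: nbhs_right_lt; case/andP: tab.
have WnS n t : `|W n.+1 t - W n t| <= 2 * (b - a) / 2 ^+ n.
  have Wa k : W k a = 0 by rewrite /W clampE ?lexx// subrr.
  have -> : W n.+1 t - W n t = (W n.+1 (clamp a b t) - W n (clamp a b t)) - (W n.+1 a - W n a).
    by rewrite !Wa subrr subr0 /W !(clampE (clamp_itv _ ab)).
  have /andP[act ctb] := clamp_itv t ab.
  apply: le_trans (@rderiv_lip _ _ (fun t => W n.+1 t - W n t) (2 / 2 ^+ n) a (clamp a b t) act _ _) _.
  - by move=> s; apply: cvgB; exact: cW.
  - move=> s /andP[as_ sc]; have sab : a <= s < b by rewrite as_ (lt_le_trans sc).
    have [v Wv vw] := dW n s sab; have [v' Wv' vw'] := dW n.+1 s sab.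
    exists (v' - v); first exact: rderivB.
    rewrite (_ : v' - v = (v' - w s) - (v - w s)); last by module R.
    apply: le_trans (ler_normB _ _) _.
    rewrite -exprVn mulr_natl mulr2n; apply: lerD => //.
    apply: le_trans vw' _; rewrite exprS ler_piMl ?exprn_ge0 ?invr_ge0//.
    by rewrite invf_le1// ler1n.
  rewrite -!mulrA ler_pM2l// mulrC ler_pM2r ?invr_gt0 ?exprn_gt0//.
  by rewrite lerD2r.
have [Y HY] := geom_unif cF WnS.
exists Y; split.
- exact: geom_unif_continuous cW HY.
- apply/eqP; rewrite -normr_le0; apply/ler_addgt0Pl => e e0; rewrite addr0.
  have [n Hn] := geom_small (2 * (2 * (b - a))) e0.
  have := le_trans (HY n a) Hn.
  by rewrite {1}/W clampE ?lexx// subrr subr0.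
- move=> t tab e e0.
  have e2 : 0 < e / 2 by rewrite divr_gt0.
  have /cvgrPdist_le /(_ _ e2) /near_rightP[d d0 wd] := cw.1 t tab.
  apply/near_rightP; exists (Num.min d (b - t)).
    by rewrite lt_min d0 subr_gt0; case/andP: tab.
  move=> s /andP[ts]; rewrite -ltrBlDl lt_min ltrBlDl ltrBlDl subrKC => /andP[sd sb].
  apply/ler_addgt0Pl => k k0.
  have st : 0 < s - t by rewrite subr_gt0.
  have k4 : 0 < k / 4 by rewrite divr_gt0.
  have ba0 : 0 <= b - a by rewrite subr_ge0.
  have [n Hn] := geom_small (2 * (2 * (b - a)) + (s - t)) k4.
  have i0 : 0 < (2 ^+ n)^-1 :> R by rewrite invr_gt0 exprn_gt0.
  have Hn1 : 2 * (2 * (b - a)) / 2 ^+ n <= k / 4.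
    apply: le_trans Hn; rewrite ler_pM2r//; lra.
  have Hn2 : (2 ^+ n)^-1 * (s - t) <= k / 4.
    apply: le_trans Hn; rewrite mulrC ler_pM2r//; lra.
  have h : `|(W n s - (s - t) *: w t) - (W n t - (t - t) *: w t)| <=
      ((2 ^+ n)^-1 + e / 2) * (s - t).
    apply: (@rderiv_lip _ _ (fun r => W n r - (r - t) *: w t) _ t s (ltW ts)).
      move=> r; apply: cvgB; first exact: cW.
      by apply: cvgZr_tmp; apply: cvgB; [exact: cvg_id|exact: cvg_cst].
    move=> r /andP[tr rs].
    have rab : a <= r < b.
      by rewrite (le_trans (andP tab).1 tr)/=; apply: lt_trans rs _; move: sb; lra.
    have [v Wv vw] := dW n r rab.
    exists (v - w t).
      apply: rderivB => //.
      have := rderiv_scale (rderivB (rderiv_id r) (rderiv_cst (t : R^o) r)) (rderiv_cst (w t) r).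
      by rewrite subr0 scale1r scaler0 addr0.
    rewrite (_ : v - w t = (v - w r) - (w t - w r)); last by module R.
    apply: le_trans (ler_normB _ _) _; rewrite -exprVn; apply: lerD => //.
    move: tr; rewrite le_eqVlt => /predU1P[->|tr]; first by rewrite subrr normr0 ltW.
    by apply: wd; rewrite tr/=; apply: lt_trans rs _; move: sd; lra.
  rewrite subrr scale0r subr0 in h.
  have h1 := le_trans (HY n s) Hn1; have h2 := le_trans (HY n t) Hn1.
  rewrite (_ : Y s - Y t - _ = (Y s - W n s) - (Y t - W n t) + (W n s - (s - t) *: w t - W n t)); last by module R.
  apply: le_trans (ler_normD _ _) _.
  have h3 := ler_normB (Y s - W n s) (Y t - W n t).
  have h4 : ((2 ^+ n)^-1 + e / 2) * (s - t) = (2 ^+ n)^-1 * (s - t) + e * (s - t) / 2 by ring.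
  have h5 : 0 < e * (s - t) by rewrite mulr_gt0.
  move: h; rewrite h4; move: Hn2 h5; set z := _^-1 * _; set x := e * _; lra.
Unshelve. all: by end_near. Qed.

End Primitives.

Section Boundedness.
Context {R : realType} {F : normedModType R}.
Implicit Types (a b t : R).

Lemma cadlag_bounded a b (w : R -> F) : a <= b -> cadlag a b w ->
  exists2 M, 0 <= M & forall t, a <= t <= b -> `|w t| <= M.
Proof.
move=> ab [rw lw].
suff [M HM] : exists M, forall t, a <= t <= b -> `|w t| <= M.
  exists M => //; apply: le_trans (HM a _); first exact: normr_ge0.
  by rewrite lexx.
apply: (@real_ind _ (fun t => exists M, forall s, a <= s <= t -> `|w s| <= M) a b ab).
- by exists `|w a| => s; rewrite -eq_le => /eqP <-.
- move=> t tab [M HM].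
  have /cvgrPdist_le /(_ 1 ltr01) /near_rightP[d d0 wd] := rw t tab.
  apply/near_rightP; exists d => // s /andP[ts sd].
  exists (Num.max M (`|w t| + 1)) => r /andP[ar rs].
  rewrite le_max; have [rt|tr] := leP r t; first by rewrite HM ?ar.
  apply/orP; right.
  have := wd r; rewrite tr (le_lt_trans rs sd) => /(_ isT).
  have := ler_normB (w t) (w t - w r); rewrite subKr; lra.
- move=> t /andP[at_ tb] HP.
  have [l /cvgrPdist_le /(_ 1 ltr01) /near_leftP[d d0 wd]] := lw t (introT andP (conj at_ tb)).
  pose c := Num.max a (t - d / 2).
  have ac : a <= c < t by rewrite le_max lexx/= gt_max at_/=; move: d0; lra.
  have [M HM] := HP c ac.
  exists (Num.max M (Num.max (`|l| + 1) `|w t|)) => r /andP[ar rt].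
  rewrite !le_max; have [rc|cr] := leP r c; first by rewrite HM ?ar.
  move: rt; rewrite le_eqVlt => /predU1P[->|rt]; first by rewrite lexx !orbT.
  apply/orP; right; apply/orP; left.
  have := wd r; rewrite rt andbT.
  have -> : t - d < r by move: cr; rewrite gt_max => /andP[_]; move: d0; lra.
  move=> /(_ isT).
  have := ler_normB l (l - w r); rewrite subKr; lra.
Qed.

Lemma continuous_cadlag a b (y : R -> F) : continuous y -> cadlag a b y.
Proof.
move=> cy; split=> [t _ U /(cy t) /near_to_right //|t _].
by exists (y t) => U /(cy t) /near_to_left.
Qed.

Lemma clamp_dist a b c t : a <= c <= b -> `|clamp a b t - c| <= b - a.
Proof.
move=> /andP[ac cb]; have /andP[] := clamp_itv t (le_trans ac cb).
by rewrite ler_norml => *; apply/andP; split; lra.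
Qed.

End Boundedness.

Section Picard.
Context {R : realType} {F : normedModType R}.
Variables (w : R -> F -> F) (a b c L : R) (yc : F).
Hypotheses (cF : geom_complete F) (acb : a <= c <= b) (L0 : 0 < L).
Hypothesis wreg : forall y : R -> F, continuous y -> cadlag a b (fun t => w t (y t)).
Hypothesis wlip : forall t x y, a <= t < b -> `|w t x - w t y| <= L * `|x - y|.

Let ab : a <= b. Proof. by case/andP: acb; exact: le_trans. Qed.

Theorem cauchy_problem : exists y, [/\ continuous y, y c = yc &
  forall t, a <= t < b -> rderiv y t (w t (y t))].
Proof.
have [ac cb] := andP acb.
have /choice[W HW] : forall y : R -> F, exists W : R -> F, continuous y ->
    continuous W /\ forall t, a <= t < b -> rderiv W t (w t (y t)).
  move=> y; have [cy|ncy] := pselect (continuous y); last by exists y.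
  by have [W [cW _ HW]] := cadlag_primitive cF ab (wreg cy); exists W.
pose Phi y t := yc + (W y (clamp a b t) - W y c).
have clampc : clamp a b c = c by exact: clampE.
have cPhi y : continuous y -> continuous (Phi y).
  move=> cy t; apply: cvgD; first exact: cvg_cst.
  apply: cvgB; last exact: cvg_cst.
  apply: (@cvg_comp _ _ _ (clamp a b) (W y) _ (nbhs (clamp a b t))).
    exact: continuous_clamp.
  by have [+ _] := HW y cy; exact.
have dPhi y t : continuous y -> a <= t < b -> rderiv (Phi y) t (w t (y t)).
  move=> cy /andP[at_ tb]; rewrite -[w t _]add0r; apply: rderivD; first exact: rderiv_cst.
  rewrite -[w t _]subr0; apply: rderivB; last exact: rderiv_cst.
  have /(rderiv_near _ _) : rderiv (W y) t (w t (y t)) by apply: (HW y cy).2; rewrite at_.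
  apply; first by rewrite clampE// at_ ltW.
  near=> s; rewrite clampE//; apply/andP; split.
    by apply: (le_trans at_); apply: ltW; near: s; exact: nbhs_right_gt.
  by apply: ltW; near: s; exact: nbhs_right_lt.
pose yn := fix yn n := if n is k.+1 then Phi (yn k) else fun=> yc.
have cyn n : continuous (yn n).
  by elim: n => [|n IH]; [move=> t; exact: cvg_cst|exact: cPhi].
have ync n : yn n c = yc.
  by case: n => // n; rewrite /= /Phi clampc subrr addr0.
have [M M0 HM] := cadlag_bounded ab (continuous_cadlag a b
  (fun t => cvgB (cyn 1%N t) (cyn 0%N t))).
have yclamp n t : yn n (clamp a b t) = yn n t.
  by case: n => // n; rewrite /= /Phi (clampE (clamp_itv _ ab)).
pose wt n t : R := M / 2 ^+ n * expR (2 * L * `|t - c|).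
have step n t : a <= t <= b -> `|yn n.+1 t - yn n t| <= wt n t.
  elim: n t => [|n IH] t atb.
    apply: le_trans (HM t atb) _; rewrite /wt expr0 divr1 ler_peMr//.
    by rewrite -expR0 ler_expR !mulr_ge0// ltW.
  pose G t := yn n.+2 t - yn n.+1 t.
  have cG : continuous G by move=> s; apply: cvgB; exact: cyn.
  have Gc : G c = 0 by rewrite /G !ync subrr.
  have dG s : a <= s < b -> rderiv G s (w s (yn n.+1 s) - w s (yn n s)).
    move=> sab; apply: rderivB; [exact: (dPhi (yn n.+1) s (cyn n.+1) sab)|exact: (dPhi (yn n) s (cyn n) sab)].
  have wn s : a <= s < b -> `|w s (yn n.+1 s) - w s (yn n s)| <= L * wt n s.
    move=> sab; apply: le_trans (wlip _ _ sab) _; rewrite ler_pM2l// IH//.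
    by case/andP: sab => -> /ltW ->.
  have [ct|tc] := leP c t.
    have -> : yn n.+2 t - yn n.+1 t = G t - G c by rewrite Gc subr0.
    (* A primitive of [L * wt n] that coincides with [wt n.+1] after [c]: differentiation produces
       the factor [2 * L], whose 2 is absorbed by the power. *)
    pose B s : R^o := M / 2 ^+ n.+1 * expR (- (2 * L * c)) * expR (2 * L * s).
    have BE s : c <= s -> B s = wt n.+1 s.
      move=> cs; rewrite /B /wt ger0_norm ?subr_ge0// -mulrA -expRD.
      by congr (_ * expR _); ring.
    apply: le_trans (@rderiv_mvi _ _ G B c t ct cG _ _) _.
    - move=> s; apply: (@cvgM R); first exact: cvg_cst.
      apply: (@cvg_comp _ _ _ (fun s => 2 * L * s) expR _ (nbhs (2 * L * s))).
        by apply: (@cvgM R); [exact: cvg_cst|exact: cvg_id].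
      exact: continuous_expR.
    - move=> s /andP[cs st].
      have sab : a <= s < b by rewrite (le_trans ac cs) (lt_le_trans st)//; case/andP: atb.
      exists (w s (yn n.+1 s) - w s (yn n s)), (L * wt n s); split => //.
      + exact: dG.
      + have := rderivZ (M / 2 ^+ n.+1 * expR (- (2 * L * c))) (rderiv_expR (2 * L) s).
        congr (rderiv _ _ _).
        rewrite -[_ *: _]/(_ * _) /wt ger0_norm ?subr_ge0//.
        rewrite mulrBr expRD exprS; field.
        by rewrite expf_neq0.
      + exact: wn.
    by rewrite !BE// gerBl /wt !mulr_ge0 ?expR_ge0 ?invr_ge0 ?exprn_ge0.
  have -> : `|yn n.+2 t - yn n.+1 t| = `|G c - G t| by rewrite Gc sub0r normrN.
  pose B s : R^o := - (M / 2 ^+ n.+1 * expR (2 * L * c)) * expR (- (2 * L) * s).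
  have BE s : s <= c -> B s = - wt n.+1 s.
    move=> sc; rewrite /B /wt ler0_norm ?subr_le0//.
    rewrite (_ : 2 * L * - (s - c) = 2 * L * c + - (2 * L) * s); last by ring.
    by rewrite expRD; ring.
  apply: le_trans (@rderiv_mvi _ _ G B t c (ltW tc) cG _ _) _.
  - move=> s; apply: (@cvgM R); first exact: cvg_cst.
    apply: (@cvg_comp _ _ _ (fun s => - (2 * L) * s) expR _ (nbhs (- (2 * L) * s))).
      by apply: (@cvgM R); [exact: cvg_cst|exact: cvg_id].
    exact: continuous_expR.
  - move=> s /andP[ts sc].
    have sab : a <= s < b.
      by rewrite (lt_le_trans sc)// andbT; apply: le_trans ts; case/andP: atb.
    exists (w s (yn n.+1 s) - w s (yn n s)), (L * wt n s); split => //.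
    + exact: dG.
    + have := rderivZ (- (M / 2 ^+ n.+1 * expR (2 * L * c))) (rderiv_expR (- (2 * L)) s).
      congr (rderiv _ _ _).
      rewrite -[_ *: _]/(_ * _) /wt ler0_norm ?subr_le0 1?ltW//.
      rewrite (_ : 2 * L * - (s - c) = 2 * L * c + - (2 * L) * s); last by ring.
      rewrite expRD exprS; field.
      by rewrite expf_neq0.
    + exact: wn.
  rewrite (BE c)// (BE t (ltW tc)).
  have : 0 <= wt n.+1 c by rewrite /wt !mulr_ge0 ?expR_ge0 ?invr_ge0 ?exprn_ge0.
  move=> h; change (- wt n.+1 c - (- wt n.+1 t) <= wt n.+1 t :> R).
  by rewrite opprK addrC gerBl.
pose C := M * expR (2 * L * (b - a)).
have C0 : 0 <= C by rewrite mulr_ge0// expR_ge0.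
have gstep n t : `|yn n.+1 t - yn n t| <= C / 2 ^+ n.
  rewrite -(yclamp n.+1 t) -(yclamp n t); apply: le_trans (step n _ (clamp_itv _ ab)) _.
  have h : M * expR (2 * L * `|clamp a b t - c|) <= C.
    rewrite ler_wpM2l// ler_expR ler_wpM2l ?mulr_ge0 ?(ltW L0)//.
    exact: clamp_dist.
  have i0 : 0 <= (2 ^+ n)^-1 :> R by rewrite invr_ge0 exprn_ge0.
  have -> : wt n (clamp a b t) = M * expR (2 * L * `|clamp a b t - c|) * (2 ^+ n)^-1.
    by rewrite /wt mulrAC.
  exact: ler_wpM2r.
have [Y HY] := geom_unif cF gstep.
have cY : continuous Y := @geom_unif_continuous _ _ yn Y (2 * C) cyn HY.
have YPhi t : a <= t <= b -> Y t = Phi Y t.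
  move=> atb; apply/eqP; rewrite -subr_eq0 -normr_le0; apply/ler_addgt0Pl => e e0; rewrite addr0.
  (* The first summand bounds the distance of [Y] to the iterate, the second one the effect of
     replacing this iterate by [Y] on the right-hand side over the whole interval. *)
  pose D := 2 * C + L * (2 * C) * (b - a).
  have [n Hn] := geom_small D e0.
  apply: le_trans Hn.
  pose G t := yn n.+1 t - Phi Y t.
  have cG : continuous G by move=> s; apply: cvgB; [exact: cyn|exact: cPhi].
  have Gc : G c = 0 by rewrite /G ync /Phi clampc subrr addr0 subrr.
  pose K := L * (2 * C / 2 ^+ n).
  have K0 : 0 <= K.
    by rewrite mulr_ge0 ?(ltW L0)// !mulr_ge0// invr_ge0 exprn_ge0.
  have dG s : a <= s < b -> exists2 v, rderiv G s v & `|v| <= K.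
    move=> sab; exists (w s (yn n s) - w s (Y s)).
      apply: rderivB; [exact: (dPhi (yn n) s (cyn n) sab)|exact: (dPhi Y s cY sab)].
    by apply: le_trans (wlip _ _ sab) _; rewrite ler_pM2l// distrC.
  have Gt : `|G t| <= K * (b - a).
    have [ct|tc] := leP c t.
      rewrite -[G t]subr0 -Gc; apply: le_trans (@rderiv_lip _ _ G K c t ct cG _) _.
        move=> s /andP[cs st]; apply: dG; rewrite (le_trans ac cs) (lt_le_trans st)//.
        by case/andP: atb.
      by rewrite ler_wpM2l//; case/andP: atb; move: ac; lra.
    rewrite -normrN -[- G t]add0r -Gc; apply: le_trans (@rderiv_lip _ _ G K t c (ltW tc) cG _) _.
      move=> s /andP[ts sc]; apply: dG; rewrite (lt_le_trans sc)// andbT.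
      by apply: le_trans ts; case/andP: atb.
    by rewrite ler_wpM2l//; case/andP: atb; move: cb; lra.
  rewrite (_ : Y t - Phi Y t = (Y t - yn n.+1 t) + G t); last by rewrite /G; module R.
  apply: le_trans (ler_normD _ _) _.
  have h1 := HY n.+1 t.
  have h2 : 2 * C / 2 ^+ n.+1 <= 2 * C / 2 ^+ n.
    rewrite ler_wpM2l ?mulr_ge0// exprS invfM ler_piMl ?invr_ge0 ?exprn_ge0//.
    by rewrite invf_le1// ler1n.
  rewrite /D mulrDl; apply: lerD; first exact: le_trans h1 h2.
  by apply: le_trans Gt _; rewrite /K le_eqVlt; apply/orP; left; apply/eqP; ring.
exists Y; split => //; first by rewrite YPhi// /Phi clampc subrr addr0.
move=> t atb; apply: rderiv_near (dPhi Y t cY atb).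
  by rewrite YPhi//; case/andP: atb => -> /ltW ->.
have [at_ tb] := andP atb.
near=> s; apply: YPhi; apply/andP; split.
  by apply: (le_trans at_); apply: ltW; near: s; exact: nbhs_right_gt.
by apply: ltW; near: s; exact: nbhs_right_lt.
Unshelve. all: by end_near. Qed.

End Picard.

(** * Lebesgue integrals of functions with one-sided limits *)

Section CadlagIntegral.
Context {R : realType}.
Implicit Types (a b t : R) (w : R -> R^o).
Local Notation mu := (@lebesgue_measure R).

(** The function is the pointwise limit of the difference quotients of its continuous primitive. *)
Lemma cadlag_measurable a b w : a <= b -> cadlag a b w ->
  measurable_fun `[a, b[ (w : R -> R).
Proof.
move=> ab cw.
have [W [cW _ HW]] := cadlag_primitive (@geom_complete_complete R R^o) ab cw.
pose h (n : nat) t : R := n.+1%:R * (W (t + n.+1%:R^-1) - W t : R).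
apply: (@measurable_fun_cvg _ _ _ _ h).
  move=> n; apply: measurable_funTS; apply: continuous_measurable_fun => t.
  apply: (@cvgM R); first exact: cvg_cst.
  apply: cvgB; last exact: cW.
  apply: (@cvg_comp _ _ _ (fun t => t + n.+1%:R^-1) W _ (nbhs (t + n.+1%:R^-1))); last exact: cW.
  by apply: cvgD; [exact: cvg_id|exact: cvg_cst].
move=> t; rewrite /= in_itv /= => /HW Wt.
apply/cvgrPdist_le => e e0.
have /near_rightP[d d0 Hd] := Wt e e0.
near=> n.
have n0 : 0 < n.+1%:R^-1 :> R by rewrite invr_gt0.
have nd : n.+1%:R^-1 < d.
  by near: n; exact: (near_infty_natSinv_lt (PosNum d0)).
have := Hd (t + n.+1%:R^-1); rewrite ltrDl n0 ltrD2l nd => /(_ isT).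
rewrite (_ : t + n.+1%:R^-1 - t = n.+1%:R^-1); last by rewrite addrC addKr.
move=> H; rewrite distrC /h.
have -> : n.+1%:R * (W (t + n.+1%:R^-1) - W t : R) - w t =
   n.+1%:R * (W (t + n.+1%:R^-1) - W t - n.+1%:R^-1 *: w t : R).
  by rewrite [_ *: _]/(_ * _) [RHS]mulrBr [X in _ = _ - X]mulrA mulfV ?mul1r// gt_eqF.
by rewrite normrM ger0_norm// mulrC -ler_pdivlMr// invrK.
Unshelve. all: by end_near. Qed.

Lemma cadlag_integrable a b w : a <= b -> cadlag a b w ->
  mu.-integrable `[a, b[ (EFin \o (w : R -> R)).
Proof.
move=> ab cw; apply: measurable_bounded_integrable => //=.
- by rewrite lebesgue_measure_itv/=; case: ifP => _; rewrite ?ltry// -EFinB ltry.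
- exact: cadlag_measurable.
- have [M M0 HM] := cadlag_bounded ab cw.
  exists M; split; first exact: num_real.
  move=> r Mr t /=; rewrite in_itv/= => /andP[at_ tb].
  by apply: le_trans (ltW Mr); apply: HM; rewrite at_ ltW.
Qed.

Lemma cadlag_sub a b c d (F : topologicalType) (w : R -> F) : a <= c -> d <= b ->
  cadlag a b w -> cadlag c d w.
Proof.
move=> ac db [rw lw]; split=> t /andP[h1 h2].
  by apply: rw; rewrite (le_trans ac h1) (lt_le_trans h2).
by apply: lw; rewrite (le_lt_trans ac h1) (le_trans h2).
Qed.

Let Rint_cat a s t w : a <= s -> s <= t -> cadlag a t w ->
  \int[mu]_(r in `[a, t[) w r = \int[mu]_(r in `[a, s[) w r + \int[mu]_(r in `[s, t[) w r :> R.
Proof.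
move=> as_ st cw.
have E : `[a, s[%classic `|` `[s, t[%classic = `[a, t[%classic :> set R.
  by rewrite -itv_bndbnd_setU.
rewrite -E; apply: Rintegral_setU => //.
  rewrite E; exact: cadlag_integrable (le_trans as_ st) cw.
apply/disj_setPRL => r /=; rewrite !in_itv/= => /andP[sr _].
by apply/negP; rewrite negb_and -!leNgt sr orbT.
Qed.

Let Rint_dist s t w c K : s <= t -> cadlag s t w ->
  (forall r, s <= r < t -> `|w r - c| <= K) ->
  `|\int[mu]_(r in `[s, t[) w r - (t - s) * c : R| <= K * (t - s).
Proof.
move=> st cw HK.
have mst : fine (mu `[s, t[) = t - s.
  rewrite lebesgue_measure_itv/= lte_fin; case: ltP => // ts.
  by apply/eqP; rewrite eq_sym subr_eq0 eq_le st ts.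
have cst_int k : mu.-integrable `[s, t[ (EFin \o (fun=> k : R)).
  by apply: cadlag_integrable st _; apply: continuous_cadlag => x; exact: cvg_cst.
have -> : (t - s) * c = \int[mu]_(r in `[s, t[) (c : R).
  by rewrite Rintegral_cst//= mst mulrC.
rewrite -RintegralB//; last first.
  exact: cadlag_integrable.
have cwc : cadlag s t (fun r => w r - c).
  split=> r rst; first by apply: cvgB; [exact: cw.1|exact: cvg_cst].
  by have [l wl] := cw.2 r rst; exists (l - c); apply: cvgB; [|exact: cvg_cst].
apply: le_trans (le_normr_Rintegral _ _) _ => //.
  exact: cadlag_integrable cwc.
rewrite -mst -(Rintegral_cst mu _ K)//; apply: le_Rintegral => //.
apply: (cadlag_integrable (w := fun r => `|w r - c|) st).
  split=> r rst; first by apply: cvg_norm; exact: cwc.1.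
  by have [l wl] := cwc.2 r rst; exists `|l|; exact: cvg_norm.
Qed.

(** The integral as a function of its upper bound also has right derivative [w t], so it differs
    from [W] by a constant. This lets integral payoffs be treated as coordinates of a differential
    equation. *)
Lemma cadlag_Rintegral a b w (W : R -> R^o) : a <= b -> cadlag a b w ->
  continuous W -> (forall t, a <= t < b -> rderiv W t (w t)) ->
  \int[mu]_(t in `[a, b]) w t = W b - W a :> R.
Proof.
move=> ab cw cW HW.
rewrite -Rintegral_itv_bndo_bndc; last exact: cadlag_integrable.
pose V t : R^o := \int[mu]_(r in `[a, clamp a b t[) w r.
have Va : V a = 0 by rewrite /V clampE ?lexx// set_itvco0 Rintegral_set0.
have Vst s t : a <= s -> s <= t -> t <= b -> V t - V s = \int[mu]_(r in `[s, t[) w r.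
  move=> as_ st tb; rewrite /V !clampE ?as_ ?tb ?(le_trans as_ st) ?(le_trans st tb)//.
  rewrite (Rint_cat as_ st); last exact: cadlag_sub cw.
  by rewrite addrAC subrr add0r.
have [M M0 HM] := cadlag_bounded ab cw.
have Vlip s t : a <= s -> s <= t -> t <= b -> `|V t - V s| <= M * (t - s).
  move=> as_ st tb; rewrite Vst//.
  have := @Rint_dist s t w 0 M st (cadlag_sub as_ tb cw).
  rewrite mulr0 subr0; apply => r /andP[sr rt]; rewrite subr0 HM//.
  by rewrite (le_trans as_ sr) (le_trans (ltW rt)).
have Vclamp t : V (clamp a b t) = V t by rewrite /V (clampE (clamp_itv _ ab)).
have cV : continuous V.
  move=> t; apply/cvgrPdist_le => e e0.
  have M1 : 0 < M + 1 by rewrite ltr_wpDl.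
  have /cvgrPdist_le /(_ (e / (M + 1))) := @continuous_clamp R a b t.
  rewrite divr_gt0// => /(_ isT); apply: filterS => s.
  rewrite ler_pdivlMr// => h; apply: le_trans h.
  rewrite -(Vclamp t) -(Vclamp s).
  have /andP[at_ tb] := clamp_itv t ab; have /andP[as_ sb] := clamp_itv s ab.
  have [st|ts] := leP (clamp a b s) (clamp a b t).
    apply: le_trans (Vlip _ _ as_ st tb) _.
    by rewrite ger0_norm ?subr_ge0// mulrC ler_wpM2l ?subr_ge0// lerDl.
  rewrite distrC; apply: le_trans (Vlip _ _ at_ (ltW ts) sb) _.
  by rewrite distrC gtr0_norm ?subr_gt0// mulrC ler_wpM2l ?subr_ge0 ?(ltW ts)// lerDl.
have dV t : a <= t < b -> rderiv V t (w t).
  move=> /andP[at_ tb] e e0.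
  have /cvgrPdist_le /(_ e e0) /near_rightP[d d0 wd] := cw.1 t (introT andP (conj at_ tb)).
  apply/near_rightP; exists (Num.min d (b - t)); first by rewrite lt_min d0 subr_gt0.
  move=> s /andP[ts]; rewrite -ltrBlDl lt_min ltrBlDl ltrBlDl subrKC => /andP[sd sb].
  rewrite Vst ?(ltW ts) ?(ltW sb)//.
  apply: Rint_dist (ltW ts) (cadlag_sub at_ (ltW sb) cw) _ => r /andP[].
  rewrite le_eqVlt => /predU1P[<-|tr] rs; first by rewrite subrr normr0 ltW.
  by rewrite distrC wd// tr (lt_trans rs).
have : `|(V b - W b) - (V a - W a)| <= 0 * (b - a).
  apply: (@rderiv_lip _ _ (fun t => V t - W t) _ a b ab).
    by move=> t; apply: cvgB; [exact: cV|exact: cW].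
  move=> t tab; exists 0; last by rewrite normr0.
  by rewrite -(subrr (w t)); apply: rderivB; [exact: dV|exact: HW].
rewrite mul0r normr_le0 subr_eq0 => /eqP; rewrite Va sub0r => /eqP.
rewrite subr_eq => /eqP; rewrite {1}/V clampE ?ab ?lexx// => ->.
by rewrite addrC.
Qed.

(** Dominated convergence phrased for primitives, the form in which forcing terms enter Gronwall's
    inequality. *)
Lemma cadlag_dominated a b (w : nat -> R -> R^o) (W : nat -> R -> R^o) M : a <= b ->
  (forall n, cadlag a b (w n)) -> (forall n, continuous (W n)) ->
  (forall n t, a <= t < b -> rderiv (W n) t (w n t)) ->
  (forall n t, a <= t < b -> `|w n t| <= M) ->
  (forall t, a <= t < b -> w ^~ t @ \oo --> (0 : R^o)) ->
  (W n b - W n a : R) @[n --> \oo] --> (0 : R).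
Proof.
move=> ab cw cW dW wM w0.
have H : (\int[mu]_(t in `[a, b[) (w n t)%:E)%E @[n --> \oo] --> (\int[mu]_(t in `[a, b[) (cst 0 t))%E.
  apply: (@dominated_cvg _ _ _ mu _ _ (fun n t => (w n t)%:E) _ (fun=> M%:E)) => //.
  - by move=> n; apply/measurable_EFinP; exact: cadlag_measurable.
  - move=> t /=; rewrite in_itv/= => tab.
    by apply: cvg_EFin; [exact: nearW|exact: w0].
  - by apply: (cadlag_integrable (w := fun=> M) ab); apply: continuous_cadlag => x; exact: cvg_cst.
rewrite integral0 in H.
have -> : (fun n => W n b - W n a : R) = fun n => fine (\int[mu]_(t in `[a, b[) (w n t)%:E)%E.
  apply/funext => n; rewrite -(cadlag_Rintegral ab (cw n) (cW n) (dW n)).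
  by rewrite -Rintegral_itv_bndo_bndc//; exact: cadlag_integrable.
exact: fine_cvg H.
Qed.

End CadlagIntegral.

(** * Brouwer's theorem and convex cones *)

Section BrouwerCube.
Context {R : realType} {q : nat}.
Implicit Types (x y z : 'rV[R]_q).

Lemma rV_norm_le (x : 'rV[R]_q) (c : R) : 0 <= c -> (forall i, `|x 0 i| <= c) -> `|x| <= c.
Proof.
move=> c0 H; rewrite [`|x|]mx_normrE; apply/bigmax_leP; split => // -[i j] _ /=.
by rewrite (ord1 i).
Qed.

Lemma rV_coord_le (x : 'rV[R]_q) i : `|x 0 i| <= `|x|.
Proof.
by rewrite [leRHS]mx_normrE; apply/bigmax_geP; right => /=; exists (0, i).
Qed.

Definition cube : set 'rV[R]_q := [set x | forall i, `|x 0 i| <= 1].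

Lemma cube_compact : compact cube.
Proof.
have := @rV_compact R q (fun=> `[(-1), 1]%classic) (fun=> @segment_compact R (-1) 1).
congr compact; apply/seteqP; split => x /= H i; have := H i; rewrite /= in_itv/= ?ler_norml//.
Qed.

Variable F : 'I_q -> 'rV[R]_q -> R.
Hypothesis Fcont : forall i x, cube x -> F i @ within cube (nbhs x) --> F i x.
Hypothesis Fid : forall i x, cube x -> `|F i x - x 0 i| <= 1.

Let natr_dist (a b : nat) : (a <= b.+1)%N -> (b <= a.+1)%N -> `|a%:R - b%:R| <= 1 :> R.
Proof.
move=> ab ba; have h1 : a%:R <= b%:R + 1 :> R by rewrite natr1 ler_nat.
have h2 : b%:R <= a%:R + 1 :> R by rewrite natr1 ler_nat.
by rewrite ler_norml; apply/andP; split; lra.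
Qed.

(** An affine map from [[0, P.+1]] to [[-1, 1]] in each coordinate; the minimum accounts for the
    labelling being defined on all integer vectors. *)
Let grid (P : nat) (v : 'I_q -> nat) : 'rV[R]_q :=
  \row_i (2 * (minn (v i) P.+1)%:R / P.+1%:R - 1).

Let grid_cube P v : cube (grid P v).
Proof.
move=> i; rewrite mxE ler_norml; apply/andP; split.
  by rewrite lerBrDl subrr divr_ge0// mulr_ge0.
rewrite lerBlDr -[1 + 1]/(2 : R) ler_pdivrMr ?ltr0n// ler_pM2l//.
by rewrite ler_nat geq_minr.
Qed.

(** The label [i.+1] certifies that [F i] is nonnegative. Label 0 certifies that every [F i] is
    nonpositive: either it is negative at the vertex, or the vertex has [v i = 0], that is,
    coordinate -1, where [Fid] gives the sign. *)
Let lbl P (v : 'I_q -> nat) : nat :=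
  \max_(i < q | (0 < v i)%N && (0 <= F i (grid P v))) i.+1.

Let lbl_attained P v i : lbl P v = i.+1 -> exists j : 'I_q,
  [/\ j = i :> nat, (0 < v j)%N & 0 <= F j (grid P v)].
Proof.
move=> E.
have [j /andP[vj Fj] jE] : exists2 j : 'I_q, (0 < v j)%N && (0 <= F j (grid P v)) & lbl P v = j.+1.
  have : (0 < #|[pred j : 'I_q | (0 < v j)%N && (0 <= F j (grid P v))%R]|)%N.
    apply/card_gt0P; have [[j Hj]|nex] := pselect (exists j : 'I_q, (0 < v j)%N && (0 <= F j (grid P v))).
      by exists j.
    by move: E; rewrite /lbl big_pred0// => j; apply/negP => Hj; apply: nex; exists j.
  by move=> /(@eq_bigmax_cond _ _ (fun j : 'I_q => j.+1)) [j jP jE]; exists j.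
by exists j; split => //; move: E; rewrite jE => -[].
Qed.

Let approx_zero P : exists2 z, cube z & forall i,
  (exists y, [/\ cube y, `|y - z| <= 2 / P.+1%:R & 0 <= F i y]) /\
  (exists y, [/\ cube y, `|y - z| <= 2 / P.+1%:R & F i y <= 0]).
Proof.
have [] := @kuhn_lemma q P (lbl P).
- move=> v; apply/bigmax_leqP => i _; exact: ltn_ord.
- move=> v i v0; apply/eqP => /lbl_attained[j [/ord_inj -> ]].
  by rewrite v0.
- move=> v i vP; rewrite /lbl.
  apply: (@leq_bigmax_cond _ (fun i : 'I_q => (0 < v i)%N && (0 <= F i (grid P v)))
    (fun i => i.+1) i).
  rewrite vP /=; have := Fid i (grid_cube P v).
  rewrite [X in _ - X]mxE vP minnn mulfK ?pnatr_eq0//.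
  by rewrite ler_norml => /andP[+ _]; lra.
- move=> x Hx; exists (grid P (vert x 0)); first exact: grid_cube.
  have dist j k : `|grid P (vert x j) - grid P (vert x k)| <= 2 / P.+1%:R.
    apply: rV_norm_le => [|i]; first by rewrite divr_ge0.
    rewrite !mxE; set a := (minn _ _)%:R; set b := (minn _ _)%:R.
    rewrite (_ : _ - _ = 2 / P.+1%:R * (a - b)); last by ring.
    rewrite normrM ger0_norm ?divr_ge0// ler_piMr ?divr_ge0//.
    by rewrite /a /b; apply: natr_dist; rewrite /vert; case: (x.2 i < j)%N; case: (x.2 i < k)%N; lia.
  move=> i; split.
    have [j _ /lbl_attained[k [ki vk Fk]]] := Hx i.+1 (ltn_ord i).
    exists (grid P (vert x j)); split => //.
    by rewrite -(ord_inj ki).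
  have [j _ l0] := Hx 0%N isT.
  exists (grid P (vert x j)); split => //.
  have [v0|v0] := posnP (vert x j i).
    have := Fid i (grid_cube P (vert x j)).
    by rewrite [X in _ - X]mxE v0 min0n mulr0 mul0r sub0r opprK ler_norml => /andP[_]; lra.
  rewrite leNgt; apply/negP => F0.
  have := @leq_bigmax_cond _ (fun i : 'I_q => (0 < vert x j i)%N && (0 <= F i (grid P (vert x j))))
    (fun i => i.+1) i.
  by rewrite v0 (ltW F0) -/(lbl P (vert x j)) l0 => /(_ isT).
Qed.

(** Brouwer's theorem in the form of Poincare and Miranda: [Fid] forces [F i] to be nonnegative on
    the face at 1 and nonpositive on the face at -1. Completely labelled simplices of vanishing size
    contain both signs of each [F i], so all [F i] vanish at a cluster point. *)
Theorem brouwer_cube : exists2 x, cube x & forall i, F i x = 0.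
Proof.
have /choice[z Hz] : forall P : nat, exists z, cube z /\ forall i,
  (exists y, [/\ cube y, `|y - z| <= 2 / P.+1%:R & 0 <= F i y]) /\
  (exists y, [/\ cube y, `|y - z| <= 2 / P.+1%:R & F i y <= 0]).
  by move=> P; have [z] := approx_zero P; exists z.
have [x [cx clx]] : cube `&` cluster (z @ \oo) !=set0.
  by apply: cube_compact; exists 0%N => // n _; case: (Hz n).
exists x => // i; apply/eqP/negPn/negP => Fx0.
have e0 : 0 < `|F i x| / 2 by rewrite divr_gt0 ?normr_gt0.
have /cvgrPdist_le /(_ _ e0) := @Fcont i x cx.
rewrite /within /= => /nbhs_ballP[d /= d0 Hd].
have d2 : 0 < d / 2 by rewrite divr_gt0.
have d4 : 0 < d / 4 by rewrite divr_gt0.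
have [N _ HN] := near_infty_natSinv_lt (PosNum d4).
have [w [[n Nn <-] /=]] := clx (z @` [set n | (N <= n)%N]) (ball x (d / 2))
   (ex_intro2 _ _ N I (fun n Nn => ex_intro2 _ _ n Nn erefl)) (nbhsx_ballx x _ d2).
rewrite -ball_normE /= => zx.
have close y : `|y - z n| <= 2 / n.+1%:R -> cube y -> `|F i x - F i y| <= `|F i x| / 2.
  move=> yz cy; apply: Hd => //; rewrite -ball_normE /=.
  rewrite (_ : x - y = (x - z n) - (y - z n)); last by module R.
  apply: le_lt_trans (ler_normB _ _) _.
  have := HN n Nn; rewrite /= => h; move: zx yz.
  by set A := `|_|; set B := `|_|; move: h; set k := _^-1; lra.
have [_ /(_ i)[[y [cy yz Fy]] [y' [cy' yz' Fy']]]] := Hz n.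
have h1 := close _ yz cy; have h2 := close _ yz' cy'.
have [Fx|Fx] := leP 0 (F i x).
  move: Fx0 h2; rewrite (ger0_norm Fx) => Fx0; rewrite ler_norml => /andP[_].
  have : 0 < F i x by rewrite lt_def Fx0.
  by move: Fy'; lra.
move: h1; rewrite (ltr0_norm Fx) ler_norml => /andP[+ _].
by move: Fy Fx; lra.
Qed.

End BrouwerCube.

Lemma cvg_sumr {R : realType} {V : normedModType R} {T : Type} (G : set_system T)
  {FG : Filter G} (I : Type) (r : seq I) (f : I -> T -> V) (l : I -> V) :
  (forall i, f i @ G --> l i) -> (fun x => \sum_(i <- r) f i x) @ G --> \sum_(i <- r) l i.
Proof.
move=> fl; elim: r => [|i r IH].
  by rewrite big_nil; under eq_fun do rewrite big_nil; exact: cvg_cst.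
by rewrite big_cons; under eq_fun do rewrite big_cons; exact: cvgD.
Qed.

Lemma continuous_sum_sqr {R : realType} (V : topologicalType) (I : finType) (f : I -> V -> R) :
  (forall i, continuous (f i)) -> continuous (fun x => \sum_i f i x * f i x).
Proof.
move=> cf x; apply: (@cvg_sumr R R^o _ (nbhs x) _ _ _ (fun i y => f i y * f i y)) => i.
by apply: cvgM; exact: cf.
Qed.

Lemma continuous_cstB {R : realType} (V : topologicalType) (c : R) (f : V -> R) :
  continuous f -> continuous (fun x => c - f x).
Proof. by move=> cf x; apply: cvgB; [exact: cvg_cst|exact: cf]. Qed.

Section ConeDensity.
Context {R : realType} {n : nat}.
Implicit Types (a u v x : 'rV[R]_n) (A : set 'rV[R]_n).

Definition dot u v : R := \sum_i u 0 i * v 0 i.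

Lemma dot_ge u i : u 0 i ^+ 2 <= dot u u.
Proof.
rewrite /dot (bigD1 i) //= expr2 lerDl sumr_ge0// => j _.
by rewrite -expr2 sqr_ge0.
Qed.

Lemma dot_ge0 u : 0 <= dot u u.
Proof. by apply: sumr_ge0 => i _; rewrite -expr2 sqr_ge0. Qed.

Let dist2 u x : R := dot (u - x) (u - x).

Let continuous_dist2 u : continuous (dist2 u).
Proof.
have -> : dist2 u = (fun x => \sum_i (u 0 i - x 0 i) * (u 0 i - x 0 i)).
  by apply/funext => x; apply: eq_bigr => i _; rewrite !mxE.
apply: (@continuous_sum_sqr R _ _ (fun i x => u 0 i - x 0 i)) => i.
apply: (@continuous_cstB R 'rV[R]_n (u 0 i) (fun x => x 0 i)).
exact: coord_continuous.
Qed.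

(* The vector from the projection of a point on the closure of a convex cone to that
   point defines a half-space that contains the cone. *)
Lemma cone_dense A : A !=set0 ->
  (forall a b, A a -> A b -> A (a + b)) -> (forall c a, 0 < c -> A a -> A (c *: a)) ->
  (forall v, (forall a, A a -> dot v a <= 0) -> v = 0) ->
  forall u e, 0 < e -> exists2 a, A a & `|u - a| <= e.
Proof.
move=> [a0 Aa0] AD AZ Av u e e0.
pose B := closure A.
(* Only points at least as close to [u] as [a0] compete for the projection, and they form a compact
   set. *)
pose C := B `&` [set x | dist2 u x <= dist2 u a0].
have cC : compact C.
  apply: bounded_closed_compact.
    pose M := `|u| + (1 + dist2 u a0).
    exists M; split; first exact: num_real.
    move=> r Mr x /= [_ xu]; apply: le_trans (ltW Mr).
    rewrite (_ : x = u - (u - x)); last by rewrite subKr.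
    apply: le_trans (ler_normB _ _) _; rewrite lerD2l.
    apply: rV_norm_le => [|i]; first by rewrite addr_ge0// dot_ge0.
    have h : (u - x) 0 i ^+ 2 <= dist2 u a0 by apply: le_trans (dot_ge _ i) xu.
    have := sqr_ge0 (`|(u - x) 0 i| - 1); rewrite sqrrB1 -normrX ger0_norm ?sqr_ge0//.
    have := normr_ge0 ((u - x) 0 i); move: h.
    by set s := _ ^+ 2; set k := `|_|; rewrite mulr2n; lra.
  apply: closedI; first exact: closed_closure.
  apply: (@closed_comp _ _ (dist2 u) [set r | r <= dist2 u a0]); last exact: closed_le.
  by move=> x _; exact: continuous_dist2.
have [||c cC' cmin] := @compact_EVT_min _ R (dist2 u) C _ cC.
- by exists a0; split; [exact: subset_closure|rewrite /= lexx].
- by apply: continuous_subspaceT; exact: continuous_dist2.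
have {cC'} [Bc cu] : C c by exact: set_mem.
have cminB x : B x -> dist2 u c <= dist2 u x.
  move=> Bx; have [xu|ux] := leP (dist2 u x) (dist2 u a0).
    by apply: cmin; apply/mem_set.
  exact: le_trans cu (ltW ux).
have BA x a : B x -> A a -> B (x + a).
  move=> Bx Aa U /nbhs_ballP[d d0 Ud].
  have [y [Ay yx]] := Bx (ball x d) (nbhsx_ballx _ _ d0).
  exists (y + a); split; first exact: AD.
  apply: Ud; move: yx; rewrite -ball_normE /= opprD addrACA subrr addr0; exact.
suff uc : u - c = 0.
  have [|a [Aa]] := Bc (ball u e); first by rewrite -(subr0_eq uc); exact: nbhsx_ballx.
  by rewrite -ball_normE /= => /ltW; exists a.
apply: Av => a Aa; rewrite leNgt; apply/negP => va0.
pose v := u - c.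
have a2 : 0 <= dot a a := dot_ge0 a.
(* Moving from [c] by [t *: a] changes the squared distance by [t ^+ 2 * dot a a - 2 * t * dot v a],
   which is negative for this [t]. The added 1 keeps the denominator positive. *)
pose t := dot v a / (1 + dot a a).
have t0 : 0 < t by rewrite divr_gt0// ltr_wpDr.
have := cminB _ (BA _ _ Bc (AZ t a t0 Aa)).
have -> : dist2 u (c + t *: a) = dist2 u c - 2 * t * dot v a + t ^+ 2 * dot a a.
  rewrite /dist2 opprD addrA -/v /dot !mulr_sumr -sumrB -big_split /=.
  by apply: eq_bigr => i _; rewrite !mxE; ring.
suff : t ^+ 2 * dot a a < 2 * t * dot v a by lra.
rewrite (_ : t ^+ 2 * _ = t * (t * dot a a)); last by ring.
rewrite (_ : 2 * t * _ = t * (2 * dot v a)) ?ltr_pM2l//; last by ring.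
have -> : dot v a = t * (1 + dot a a) by rewrite /t divfK// gt_eqF// ltr_wpDr.
have : 0 <= t * dot a a by rewrite mulr_ge0// ltW.
by set w := t * dot a a; rewrite mulrDr mulr1 -/w; lra.
Qed.

End ConeDensity.

(** * Needle variations of a Lipschitz field *)

Section Ramp.
Context {R : realType}.
Implicit Types (s e t : R).

(** The primitive of the indicator [slot s e] of [[s, e)], that is, the time spent in the slot so
    far. *)
Definition ramp s e t : R^o := clamp 0 (e - s) (t - s).

Definition slot s e t : R := if s <= t < e then 1 else 0.

Lemma continuous_ramp s e : continuous (ramp s e).
Proof.
move=> t; apply: (@cvg_comp _ _ _ (fun t => t - s) (clamp 0 (e - s)) _ (nbhs (t - s))).
  by apply: cvgB; [exact: cvg_id|exact: cvg_cst].
exact: continuous_clamp.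
Qed.

Lemma ramp_ge0 s e t : s <= e -> 0 <= ramp s e t.
Proof. by rewrite -subr_ge0 => se; have /andP[] := clamp_itv (t - s) se. Qed.

Lemma ramp_le s e t : s <= e -> ramp s e t <= e - s.
Proof. by rewrite -subr_ge0 => se; have /andP[] := clamp_itv (t - s) se. Qed.

Lemma ramp0 s e t : s <= e -> t <= s -> ramp s e t = 0.
Proof.
by move=> se ts; apply: max_l; rewrite ge_min orbC subr_le0 ts.
Qed.

Lemma ramp_end s e t : s <= e -> e <= t -> ramp s e t = e - s.
Proof.
by move=> se et; rewrite /ramp /clamp min_l ?lerD2r// max_r// subr_ge0.
Qed.

Lemma ramp_mid s e t : s <= t -> t <= e -> ramp s e t = t - s.
Proof. by move=> st te; apply: clampE; rewrite subr_ge0 st lerD2r. Qed.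

Lemma rderiv_ramp s e t : s <= e -> rderiv (ramp s e) t (slot s e t).
Proof.
move=> se; rewrite /slot; case: ifPn => [/andP[st te]|].
  have h : rderiv (fun r => r - s : R^o) t 1.
    by rewrite -[1]subr0; apply: rderivB; [exact: rderiv_id|exact: rderiv_cst].
  apply: rderiv_near h; first by rewrite ramp_mid// ltW.
  near=> r; rewrite ramp_mid//.
    by apply: (le_trans st); apply: ltW; near: r; exact: nbhs_right_gt.
  by apply: ltW; near: r; exact: nbhs_right_lt.
rewrite negb_and -ltNge -leNgt => /orP[ts|et].
  apply: rderiv_near (rderiv_cst (0 : R^o) t); first by rewrite ramp0// ltW.
  near=> r; rewrite ramp0//.
  by apply: ltW; near: r; exact: nbhs_right_lt.
apply: rderiv_near (rderiv_cst (e - s : R^o) t); first by rewrite ramp_end.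
near=> r; rewrite ramp_end//.
by apply: (le_trans et); apply: ltW; near: r; exact: nbhs_right_gt.
Unshelve. all: by end_near. Qed.

Lemma slot_ge0 s e t : 0 <= slot s e t.
Proof. by rewrite /slot; case: ifP. Qed.

End Ramp.

Section NeedleControls.
Context {R : realType} {V : choiceType}.
Implicit Types (a b : R * V -> R) (S : seq (R * V)) (o t : R) (nu : R * V).

Definition spike (s e : R) (z : V) (u : R -> V) : R -> V :=
  fun t => if s <= t < e then z else u t.

Variable u0 : R -> V.

(* The needle [nu] occupies a slot of length [a nu] after time [nu.1]; the slots are
   shifted by the total length of the previous ones, so that they are disjoint when
   the needles are sorted by time. *)
Fixpoint needle_ctrl a S o : R -> V :=
  if S is nu :: S' then
    spike (nu.1 + o) (nu.1 + o + a nu) nu.2 (needle_ctrl a S' (o + a nu))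
  else u0.

(** The candidate for the first-order displacement. The response [y nu] is switched on linearly
    while its needle acts, which keeps the candidate continuous; after all the slots it is the
    linear combination of the responses. *)
Fixpoint needle_ramp {F : normedModType R} (y : R * V -> R -> F) a S o t : F :=
  if S is nu :: S' then
    (ramp (nu.1 + o) (nu.1 + o + a nu) t : R) *: y nu t + needle_ramp y a S' (o + a nu) t
  else 0.

Fixpoint needle_slot {F : normedModType R} (y : R * V -> R -> F) a S o t : F :=
  if S is nu :: S' then
    slot (nu.1 + o) (nu.1 + o + a nu) t *: y nu t + needle_slot y a S' (o + a nu) t
  else 0.

Lemma needle_ctrl_vals a S o t :
  needle_ctrl a S o t = u0 t \/ exists2 nu, nu \in S & needle_ctrl a S o t = nu.2.
Proof.
elim: S o => [|nu S IH] o /=; first by left.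
rewrite /spike; case: ifP => _; first by right; exists nu; rewrite ?mem_head.
by have [->|[k kS ->]] := IH (o + a nu); [left|right; exists k => //; rewrite inE kS orbT].
Qed.

Lemma continuous_needle_ramp {F : normedModType R} (y : R * V -> R -> F) a S o :
  (forall nu, continuous (y nu)) -> continuous (needle_ramp y a S o).
Proof.
move=> cy; elim: S o => [|nu S IH] o t /=; first exact: cvg_cst.
by apply: cvgD; [apply: cvgZ; [exact: continuous_ramp|exact: cy]|exact: IH].
Qed.

Lemma rderiv_needle_ramp {F : normedModType R} (y v : R * V -> R -> F) a S o t :
  (forall nu, 0 <= a nu) -> (forall nu, rderiv (y nu) t (v nu t)) ->
  rderiv (needle_ramp y a S o) t (needle_slot y a S o t + needle_ramp v a S o t).
Proof.
move=> a0 yv; elim: S o => [|nu S IH] o /=; first by rewrite addr0; exact: rderiv_cst.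
rewrite addrACA; apply: rderivD; last exact: IH.
by apply: rderiv_scale; [apply: rderiv_ramp; rewrite lerDl|exact: yv].
Qed.

Lemma needle_ramp0 {F : normedModType R} (y : R * V -> R -> F) a S o t :
  (forall nu, 0 <= a nu) -> {in S, forall nu, t <= nu.1 + o} -> needle_ramp y a S o t = 0.
Proof.
move=> a0; elim: S o => [//|nu S IH] o H /=.
rewrite ramp0 ?lerDl ?H ?mem_head// scale0r add0r IH// => k kS.
by rewrite addrA (le_trans (H k _)) ?lerDl// inE kS orbT.
Qed.

Lemma needle_ramp_end {F : normedModType R} (y : R * V -> R -> F) a S o t :
  (forall nu, 0 <= a nu) -> {in S, forall nu, nu.1 + o + \sum_(k <- S) a k <= t} ->
  needle_ramp y a S o t = \sum_(nu <- S) a nu *: y nu t.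
Proof.
move=> a0; elim: S o => [|nu S IH] o H /=; first by rewrite big_nil.
rewrite big_cons ramp_end ?lerDl//; last first.
  apply: le_trans (H nu (mem_head _ _)); rewrite big_cons lerD2l lerDl.
  by apply: sumr_ge0.
rewrite addrAC subrr add0r IH// => k kS.
by have := H k; rewrite inE kS orbT big_cons => /(_ isT); rewrite !addrA.
Qed.

Lemma needle_ramp_norm {F : normedModType R} (y : R * V -> R -> F) a S o t M :
  (forall nu, 0 <= a nu) -> {in S, forall nu, `|y nu t| <= M} ->
  `|needle_ramp y a S o t| <= M * \sum_(nu <- S) a nu.
Proof.
move=> a0; elim: S o => [|nu S IH] o H /=; first by rewrite big_nil mulr0 normr0.
rewrite big_cons mulrDr; apply: le_trans (ler_normD _ _) _; apply: lerD.
  rewrite normrZ mulrC; apply: ler_pM => //; first exact: H (mem_head _ _).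
  rewrite ger0_norm ?ramp_ge0 ?lerDl//.
  by apply: le_trans (ramp_le _ _) _; rewrite ?lerDl// addrAC subrr add0r.
by apply: IH => k kS; apply: H; rewrite inE kS orbT.
Qed.

Lemma needle_ramp_zero {F : normedModType R} a S o t :
  needle_ramp (fun _ _ => 0 : F) a S o t = 0.
Proof. by elim: S o => [//|nu S IH] o /=; rewrite scaler0 add0r. Qed.

Lemma needle_off {F : normedModType R} (y : R * V -> R -> F) a S o t :
  (forall nu, 0 <= a nu) -> {in S, forall nu, t < nu.1 + o} ->
  needle_ctrl a S o t = u0 t /\ needle_slot y a S o t = 0.
Proof.
move=> a0; elim: S o => [//|nu S IH] o H /=.
have tn := H nu (mem_head _ _); rewrite /spike /slot leNgt tn /=.
have [|-> ->] := IH (o + a nu).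
  by move=> k kS; rewrite addrA (lt_le_trans (H k _)) ?lerDl// inE kS orbT.
by rewrite scale0r addr0.
Qed.

(** Sorting by time makes the slots disjoint, so at most one needle acts at a time. Quantifying over
    [w] lets a single case split serve several slot sums. *)
Lemma needle_cases {F : normedModType R} (y : R * V -> R -> F) a S o t :
  (forall nu, 0 <= a nu) -> 0 <= o -> sorted (fun k nu => k.1 <= nu.1) S ->
  (needle_ctrl a S o t = u0 t /\ forall (G : normedModType R) (w : R * V -> R -> G), needle_slot w a S o t = 0) \/
  exists nu, [/\ nu \in S, needle_ctrl a S o t = nu.2,
    (forall (G : normedModType R) (w : R * V -> R -> G), needle_slot w a S o t = w nu t) &
    nu.1 <= t < nu.1 + (o + \sum_(k <- S) a k)].
Proof.
move=> a0; elim: S o => [|nu S IH] o o0 Ss /=; first by left.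
have trans : transitive (fun k nu : R * V => k.1 <= nu.1) by move=> ? ? ?; exact: le_trans.
have Sa : 0 <= \sum_(k <- S) a k by exact: sumr_ge0.
have [nut|nut] := boolP (nu.1 + o <= t < nu.1 + o + a nu).
  right; exists nu; have [n1 n2] := andP nut.
  have off : {in S, forall k, t < k.1 + (o + a nu)}.
    move=> k kS; apply: lt_le_trans n2 _; rewrite -addrA lerD2r.
    have := order_path_min trans Ss.
    by move=> /allP/(_ k kS).
  split; rewrite ?mem_head /spike ?nut//.
    move=> G w; have [_ ->] := needle_off w a0 off.
    by rewrite /slot nut scale1r addr0.
  rewrite (le_trans _ n1) ?lerDl//= big_cons (lt_le_trans n2)//.
  by rewrite -addrA lerD2l lerD2l lerDl.
have oa0 : 0 <= o + a nu by rewrite addr_ge0.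
have [[cE sE]|[k [kS cE sE kt]]] := IH (o + a nu) oa0 (path_sorted Ss).
  left; rewrite /spike (negbTE nut); split => // G w.
  by rewrite sE /slot (negbTE nut) scale0r addr0.
right; exists k; rewrite inE kS orbT /spike (negbTE nut); split => //.
  by move=> G w; rewrite sE /slot (negbTE nut) scale0r add0r.
by rewrite big_cons (addrA o).
Qed.

(** The two controls can differ only between corresponding slot ends, two per needle, and each end
    moves by at most the sum on the right. [beta] is at least 1 there, so the increment of its
    primitive [B] bounds the measure of the set of disagreement. *)
Lemma needle_ctrl_diff a b S o o' (T : R) : 0 <= T ->
  exists (B : R -> R^o) (beta : R -> R),
  [/\ continuous B, forall t, rderiv B t (beta t) /\ 0 <= beta t,
      forall t, needle_ctrl a S o t <> needle_ctrl b S o' t -> 1 <= beta t &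
      B T - B 0 <= 2 * (size S)%:R * (`|o - o'| + \sum_(nu <- S) `|a nu - b nu|)].
Proof.
move=> T0; elim: S o o' => [|nu S IH] o o' /=.
  exists (fun=> 0), (fun=> 0); split => //.
  - by move=> t; exact: cvg_cst.
  - by move=> t; split => //; exact: rderiv_cst.
  - by rewrite subrr mulr0 mul0r.
have [B [beta [cB dB Hbeta Bd]]] := IH (o + a nu) (o' + b nu).
pose s := nu.1 + o; pose s' := nu.1 + o'.
pose e := s + a nu; pose e' := s' + b nu.
have mm x y : Num.min x y <= Num.max x y :> R by rewrite ge_min le_max lexx.
pose r1 := ramp (Num.min s s') (Num.max s s'); pose r2 := ramp (Num.min e e') (Num.max e e').
exists (fun t => r1 t + r2 t + B t),
  (fun t => slot (Num.min s s') (Num.max s s') t + slot (Num.min e e') (Num.max e e') t + beta t).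
split.
- move=> t; apply: cvgD; last exact: cB.
  by apply: cvgD; exact: continuous_ramp.
- move=> t; have [h1 h2] := dB t; split; last by rewrite !addr_ge0 ?slot_ge0.
  by apply: rderivD => //; apply: rderivD; exact: rderiv_ramp.
- move=> t; rewrite /spike -/s -/s' -/e -/e'.
  have slot1 x y : (x <= t) != (y <= t) -> slot (Num.min x y) (Num.max x y) t = 1.
    rewrite /slot ge_min lt_max !ltNge.
    by case: (x <= t); case: (y <= t).
  have b0 : 0 <= beta t by case: (dB t).
  have [ss'|/slot1 -> _] := eqVneq (s <= t) (s' <= t); last first.
    by rewrite -addrA lerDl addr_ge0// slot_ge0.
  have [ee'|/slot1 -> _] := eqVneq (e <= t) (e' <= t); last first.
    by rewrite addrAC lerDr addr_ge0// slot_ge0.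
  rewrite !ltNge ss' ee'; case: ifP => // _ /Hbeta /le_trans; apply.
  by rewrite lerDr addr_ge0 ?slot_ge0.
- rewrite big_cons -[(size S).+1%:R]natr1.
  set D := `|o - o'| + _.
  have D1 : `|s - s'| <= D.
    rewrite /s /s' opprD addrACA subrr add0r lerDl addr_ge0// sumr_ge0//.
  have D2 : `|e - e'| <= D.
    rewrite /e /e' opprD addrACA; apply: le_trans (ler_normD _ _) _.
    rewrite /s /s' opprD addrACA subrr add0r /D addrA lerDl.
    by apply: sumr_ge0.
  have D3 : `|o + a nu - (o' + b nu)| + \sum_(nu0 <- S) `|a nu0 - b nu0| <= D.
    by rewrite /D addrA lerD2r opprD addrACA ler_normD.
  have maxmin x y : Num.max x y - Num.min x y = `|x - y| :> R.
    by have [xy|yx] := leP x y; [rewrite ler0_norm ?subr_le0// opprB|rewrite gtr0_norm ?subr_gt0].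
  have R1 : r1 T - r1 0 <= D.
    apply: le_trans D1; rewrite -maxmin; apply: (@le_trans _ _ (r1 T)).
      by rewrite gerBl ramp_ge0.
    exact: ramp_le.
  have R2 : r2 T - r2 0 <= D.
    apply: le_trans D2; rewrite -maxmin; apply: (@le_trans _ _ (r2 T)).
      by rewrite gerBl ramp_ge0.
    exact: ramp_le.
  have R3 : B T - B 0 <= 2 * (size S)%:R * D.
    by apply: le_trans Bd _; rewrite ler_wpM2l// mulr_ge0.
  have -> : r1 T + r2 T + B T - (r1 0 + r2 0 + B 0) = (r1 T - r1 0) + (r2 T - r2 0) + (B T - B 0) by module R.
  have -> : 2 * ((size S)%:R + 1) * D = D + D + 2 * (size S)%:R * D by ring.
  by apply: lerD => //; apply: lerD.
Qed.

Lemma needle_ctrl0 S o : needle_ctrl (fun=> 0) S o = u0.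
Proof.
elim: S o => [//|nu S IH] o /=; rewrite IH; apply/funext => t; rewrite /spike.
by rewrite addr0; case: ltP => h; rewrite ?andbF ?andbT//; rewrite leNgt (lt_le_trans h).
Qed.

End NeedleControls.

Section NeedleVariations.
Context {R : realType} {F : normedModType R} {V : choiceType}.
Variables (T L : R) (U : set (R -> V)) (Z : set V) (Phi : R -> F -> V -> F).
Variables (x0 : R -> F) (u0 : R -> V) (A : R -> F -> F).
Hypotheses (cF : geom_complete F) (T0 : 0 < T) (L0 : 0 < L).
Hypothesis Uu0 : U u0.
Hypothesis Ucst : forall z, Z z -> U (fun=> z).
Hypothesis Uspike : forall u s e z, U u -> Z z -> 0 <= s -> s <= e -> e < T ->
  U (spike s e z u).
Hypothesis Phi_reg : forall u y, U u -> continuous y -> cadlag 0 T (fun t => Phi t (y t) (u t)).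
Hypothesis Phi_lip : forall u t x y, U u -> 0 <= t < T ->
  `|Phi t x (u t) - Phi t y (u t)| <= L * `|x - y|.
Hypothesis cx0 : continuous x0.
Hypothesis dx0 : forall t, 0 <= t < T -> rderiv x0 t (Phi t (x0 t) (u0 t)).
Hypothesis AB : forall t x y, A t (x - y) = A t x - A t y.
Hypothesis AZ : forall t c x, A t (c *: x) = c *: A t x.
Hypothesis A_le : forall t x, 0 <= t < T -> `|A t x| <= L * `|x|.
Hypothesis A_reg : forall y, continuous y -> cadlag 0 T (fun t => A t (y t)).
Hypothesis Phi_diff : forall t e, 0 <= t < T -> 0 < e -> exists2 d, 0 < d &
  forall k, `|k| <= d ->
  `|Phi t (x0 t + k) (u0 t) - Phi t (x0 t) (u0 t) - A t k| <= e * `|k|.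

Variable S : seq (R * V).
Hypothesis S_sorted : sorted (fun k nu => k.1 <= nu.1) S.
Hypothesis S_ok : forall nu, nu \in S -> 0 <= nu.1 < T /\ Z nu.2.

Let AD t x y : A t (x + y) = A t x + A t y.
Proof. by rewrite -[y in LHS]opprK AB -[- y]scaleN1r AZ scaleN1r opprK. Qed.

Let A0 t : A t 0 = 0. Proof. by have := AZ t 0 0; rewrite !scale0r. Qed.

Definition impulse (nu : R * V) (t : R) : F := Phi t (x0 t) nu.2 - Phi t (x0 t) (u0 t).

Definition amplitude r (a : R * V -> R) := (forall nu, 0 <= a nu) /\ \sum_(nu <- S) a nu <= r.

Lemma needle_radius : exists2 r, 0 < r & forall nu, nu \in S -> nu.1 + r < T.
Proof.
elim: S S_ok => [|nu S' IH] ok; first by exists 1.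
have [r r0 Hr] := IH (fun k kS => ok k (mem_behead (s := nu :: S') kS)).
have [/andP[nu0 nuT] _] := ok nu (mem_head _ _).
exists (Num.min r ((T - nu.1) / 2)); first by rewrite lt_min r0 divr_gt0// subr_gt0.
move=> k; rewrite inE => /predU1P[->|kS].
  have : Num.min r ((T - nu.1) / 2) <= (T - nu.1) / 2 by rewrite ge_min lexx orbT.
  by move: nuT; lra.
apply: le_lt_trans (Hr k kS); rewrite lerD2l ge_min lexx//.
Qed.

Let field_bound : exists2 M, 0 <= M & forall t, 0 <= t <= T ->
  `|Phi t (x0 t) (u0 t)| <= M /\ forall nu, nu \in S -> `|Phi t (x0 t) nu.2| <= M.
Proof.
have [M0 M00 HM0] := cadlag_bounded (ltW T0) (Phi_reg Uu0 cx0).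
suff [M M_ge0 HM] : exists2 M, 0 <= M & forall t, 0 <= t <= T ->
    forall nu, nu \in S -> `|Phi t (x0 t) nu.2| <= M.
  exists (Num.max M0 M) => [|t t0T]; first by rewrite le_max M00.
  split; first by rewrite le_max HM0.
  by move=> nu nuS; rewrite le_max HM ?orbT.
elim: S S_ok => [|nu S' IH] ok; first by exists 0.
have [M M_ge0 HM] := IH (fun k kS => ok k (mem_behead (s := nu :: S') kS)).
have [_ Znu] := ok nu (mem_head _ _).
have [M1 M10 HM1] := cadlag_bounded (ltW T0) (Phi_reg (Ucst Znu) cx0).
exists (Num.max M1 M) => [|t t0T k]; first by rewrite le_max M10.
by rewrite inE le_max => /predU1P[->|kS]; [rewrite HM1|rewrite HM ?orbT].
Qed.

Lemma needle_ctrl_ok r a : (forall nu, nu \in S -> nu.1 + r < T) -> amplitude r a ->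
  U (needle_ctrl u0 a S 0).
Proof.
move=> rT [a0 ar].
suff H : forall (S' : seq (R * V)) o, (forall nu, nu \in S' -> 0 <= nu.1 < T /\ Z nu.2) ->
    (forall nu, nu \in S' -> nu.1 + r < T) -> 0 <= o ->
    o + \sum_(nu <- S') a nu <= r -> U (needle_ctrl u0 a S' o).
  by apply: H => //; rewrite add0r.
elim => [//|nu S' IH] o ok {}rT o0 /= or.
have [/andP[nu0 _] Znu] := ok nu (mem_head _ _).
rewrite big_cons in or.
have Sa : 0 <= \sum_(k <- S') a k by apply: sumr_ge0.
have nua := a0 nu.
apply: Uspike => //.
- apply: IH => //.
  + by move=> k kS; apply: ok; rewrite inE kS orbT.
  + by move=> k kS; apply: rT; rewrite inE kS orbT.
  + by rewrite addr_ge0.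
  + by rewrite -addrA.
- by rewrite addr_ge0.
- by rewrite lerDl.
- by have := rT nu (mem_head _ _); lra.
Qed.

Lemma flow u : U u -> exists x, [/\ continuous x, x 0 = x0 0 &
  forall t, 0 <= t < T -> rderiv x t (Phi t (x t) (u t))].
Proof.
move=> Uu.
apply: (@cauchy_problem _ _ (fun t x => Phi t x (u t)) 0 T 0 L) => //.
- by rewrite lexx ltW.
- by move=> y; exact: Phi_reg.
- by move=> t x y; exact: Phi_lip.
Qed.

(** Gronwall's inequality with a forcing term that vanishes where the controls agree and is at most
    [2 * M] elsewhere. *)
Lemma flow_near M u v x y : U u -> U v ->
  continuous x -> continuous y -> x 0 = y 0 ->
  (forall t, 0 <= t < T -> rderiv x t (Phi t (x t) (u t))) ->
  (forall t, 0 <= t < T -> rderiv y t (Phi t (y t) (v t))) ->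
  (forall t, 0 <= t < T -> `|Phi t (y t) (u t)| <= M /\ `|Phi t (y t) (v t)| <= M) ->
  forall (B : R -> R^o) (beta : R -> R), continuous B ->
  (forall t, rderiv B t (beta t) /\ 0 <= beta t) ->
  (forall t, u t <> v t -> 1 <= beta t) ->
  forall t, 0 <= t <= T -> `|x t - y t| <= expR (L * T) * (2 * M * (B T - B 0)).
Proof.
move=> Uu Uv cx cy xy0 dx dy HM B beta cB dB Hb t /andP[t0 tT].
have M0 : 0 <= M by have [h _] := HM 0 (introT andP (conj (lexx 0) T0)); exact: le_trans h.
have H := @gronwall _ _ (fun t => x t - y t) (fun t => 2 * M * B t) L 0 t t0 (ltW L0).
apply: le_trans (H _ _ _) _.
- by move=> s; apply: cvgB; [exact: cx|exact: cy].
- by move=> s; apply: (@cvgM R); [exact: cvg_cst|exact: cB].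
- move=> s /andP[s0 st].
  have sT : 0 <= s < T by rewrite s0 (lt_le_trans st).
  have [Bs bs] := dB s.
  exists (Phi s (x s) (u s) - Phi s (y s) (v s)), (2 * M * beta s); split.
  + by apply: rderivB; [exact: dx|exact: dy].
  + exact: (rderivZ (2 * M) Bs).
  + by rewrite !mulr_ge0.
  + rewrite (_ : _ - _ = (Phi s (x s) (u s) - Phi s (y s) (u s)) +
       (Phi s (y s) (u s) - Phi s (y s) (v s))); last by module R.
    apply: le_trans (ler_normD _ _) _; apply: lerD; first exact: Phi_lip.
    have [<-|uv] := pselect (u s = v s).
      by rewrite subrr normr0 !mulr_ge0.
    have [h1 h2] := HM s sT.
    apply: le_trans (ler_normB _ _) _.
    apply: (@le_trans _ _ (2 * M)); first by lra.
    by rewrite ler_peMr ?mulr_ge0//; exact: Hb.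
- rewrite xy0 subrr normr0 add0r subr0 -mulrBr.
  have Bt : B t <= B T.
    have := @rderiv_mvi _ _ (fun=> 0 : R^o) B t T tT (fun=> cvg_cst _) cB.
    rewrite subrr normr0 subr_ge0; apply => s _; have [h1 h2] := dB s.
    by exists 0, (beta s); rewrite normr0; split => //; exact: rderiv_cst.
  have B0 : B 0 <= B t.
    have := @rderiv_mvi _ _ (fun=> 0 : R^o) B 0 t t0 (fun=> cvg_cst _) cB.
    rewrite subrr normr0 subr_ge0; apply => s _; have [h1 h2] := dB s.
    by exists 0, (beta s); rewrite normr0; split => //; exact: rderiv_cst.
  apply: ler_pM; rewrite ?expR_ge0 ?mulr_ge0 ?subr_ge0//.
    by rewrite ler_expR ler_pM2l.
  by rewrite ler_wpM2l ?mulr_ge0// lerD2r.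
Qed.

Definition flow_family r (X : (R * V -> R) -> R -> F) := forall a, amplitude r a ->
  [/\ U (needle_ctrl u0 a S 0), continuous (X a), X a 0 = x0 0 &
      forall t, 0 <= t < T -> rderiv (X a) t (Phi t (X a t) (needle_ctrl u0 a S 0 t))].

Lemma needle_family : exists2 r, 0 < r & (forall nu, nu \in S -> nu.1 + r < T) /\
  exists X, flow_family r X.
Proof.
have [r r0 rT] := needle_radius.
exists r => //; split => //.
have /choice[X HX] : forall a, exists x, amplitude r a ->
  [/\ U (needle_ctrl u0 a S 0), continuous x, x 0 = x0 0 &
      forall t, 0 <= t < T -> rderiv x t (Phi t (x t) (needle_ctrl u0 a S 0 t))].
  move=> a; have [am|nam] := pselect (amplitude r a); last by exists x0.
  have Ua := needle_ctrl_ok rT am.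
  by have [x [h1 h2 h3]] := flow Ua; exists x.
by exists X.
Qed.

Variables (r : R) (X : (R * V -> R) -> R -> F).
Hypotheses (r0 : 0 < r) (rT : forall nu, nu \in S -> nu.1 + r < T) (XP : flow_family r X).

Let ctrl_bound M a t : (forall t, 0 <= t <= T ->
  `|Phi t (x0 t) (u0 t)| <= M /\ forall nu, nu \in S -> `|Phi t (x0 t) nu.2| <= M) ->
  0 <= t < T -> `|Phi t (x0 t) (needle_ctrl u0 a S 0 t)| <= M.
Proof.
move=> HM /andP[t0 tT]; have [h1 h2] := HM t (introT andP (conj t0 (ltW tT))).
by have [->|[nu nuS ->]] := needle_ctrl_vals u0 a S 0 t; [|exact: h2].
Qed.

Lemma needle_dist0 : exists2 C, 0 <= C & forall a, amplitude r a ->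
  forall t, 0 <= t <= T -> `|X a t - x0 t| <= C * \sum_(nu <- S) a nu.
Proof.
have [M M0 HM] := field_bound.
exists (expR (L * T) * (2 * M * (2 * (size S)%:R))); first by rewrite !mulr_ge0// expR_ge0.
move=> a am t t0T; have [Ua cX X0 dX] := XP am.
have [B [beta [cB dB Hb Bd]]] := needle_ctrl_diff u0 a (fun=> 0) S 0 0 (ltW T0).
rewrite needle_ctrl0 in Hb.
have M_ t' : 0 <= t' < T -> `|Phi t' (x0 t') (needle_ctrl u0 a S 0 t')| <= M /\ `|Phi t' (x0 t') (u0 t')| <= M.
  move=> tt; split; first exact: ctrl_bound HM tt.
  have tt' : 0 <= t' <= T by case/andP: tt => -> /ltW ->.
  by have [] := HM t' tt'.
apply: le_trans (flow_near Ua Uu0 cX cx0 X0 dX dx0 M_ cB dB Hb t0T) _.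
rewrite -!mulrA ler_wpM2l ?expR_ge0// ler_pM2l// ler_wpM2l//.
apply: le_trans Bd _; rewrite subrr normr0 add0r -mulrA ler_pM2l// ler_wpM2l//.
by rewrite le_eqVlt; apply/orP; left; apply/eqP; apply: eq_bigr => nu _; rewrite subr0 ger0_norm//; case: am.
Qed.

Lemma needle_lip : exists2 C, 0 <= C & forall a b, amplitude r a -> amplitude r b ->
  forall t, 0 <= t <= T -> `|X a t - X b t| <= C * \sum_(nu <- S) `|a nu - b nu|.
Proof.
have [M M0 HM] := field_bound; have [C C0 HC] := needle_dist0.
(* The field is bounded by [M] along [x0]; along [X b] it exceeds this by at most [L] times the
   distance between the two trajectories, itself at most [C * r]. *)
pose M' := M + L * (C * r).
have M'0 : 0 <= M' by rewrite addr_ge0// !mulr_ge0// ltW.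
exists (expR (L * T) * (2 * M' * (2 * (size S)%:R))); first by rewrite !mulr_ge0// expR_ge0.
move=> a b am bm t t0T; have [Ua cX X0 dX] := XP am; have [Ub cY Y0 dY] := XP bm.
have [B [beta [cB dB Hb Bd]]] := needle_ctrl_diff u0 a b S 0 0 (ltW T0).
have near u s : U u -> 0 <= s < T -> `|Phi s (x0 s) (u s)| <= M -> `|Phi s (X b s) (u s)| <= M'.
  move=> Uu sT uM; rewrite -[Phi s _ _](subrK (Phi s (x0 s) (u s))) /M' addrC.
  apply: le_trans (ler_normD _ _) _; apply: lerD => //.
  apply: le_trans (Phi_lip _ _ Uu sT) _; rewrite ler_pM2l//.
  have sT' : 0 <= s <= T by case/andP: sT => -> /ltW ->.
  by apply: le_trans (HC b bm s sT') _; apply: ler_wpM2l => //; case: bm.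
have M_ t' : 0 <= t' < T -> `|Phi t' (X b t') (needle_ctrl u0 a S 0 t')| <= M' /\
    `|Phi t' (X b t') (needle_ctrl u0 b S 0 t')| <= M'.
  by move=> tt; split; (apply: near; [| |exact: ctrl_bound HM tt]).
have XY0 : X a 0 = X b 0 by rewrite X0 Y0.
apply: le_trans (flow_near Ua Ub cX cY XY0 dX dY M_ cB dB Hb t0T) _.
rewrite -!mulrA ler_wpM2l ?expR_ge0// ler_pM2l// ler_wpM2l//.
by apply: le_trans Bd _; rewrite subrr normr0 add0r -mulrA.
Qed.

Variable y : R * V -> R -> F.
Hypothesis y_init : forall nu, nu \in S -> y nu nu.1 = impulse nu nu.1.
Hypothesis cy : forall nu, continuous (y nu).
Hypothesis dy : forall nu t, 0 <= t < T -> rderiv (y nu) t (A t (y nu t)).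

Let A_sum a o S' t :
  A t (needle_ramp y a S' o t) = needle_ramp (fun nu t => A t (y nu t)) a S' o t.
Proof. by elim: S' o => [|nu S' IH] o /=; rewrite ?A0// AD AZ IH. Qed.

(** The jump and the response agree at [nu.1], and both are right continuous, so exchanging them
    during a short slot costs little. *)
Let impulse_near k : 0 < k -> exists2 d, 0 < d & forall nu t, nu \in S ->
  nu.1 <= t < nu.1 + d -> `|impulse nu t - y nu t| <= k.
Proof.
move=> k0.
elim: S S_ok y_init => [|nu S' IH] ok yi; first by exists 1.
have [||d d0 Hd] := IH.
- by move=> n nS; apply: ok; rewrite inE nS orbT.
- by move=> n nS; apply: yi; rewrite inE nS orbT.
have [nuT Znu] := ok nu (mem_head _ _).
have c : cadlag 0 T (fun t => impulse nu t - y nu t).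
  have [r1 l1] := Phi_reg (Ucst Znu) cx0.
  have [r2 l2] := Phi_reg Uu0 cx0.
  have [r3 l3] := continuous_cadlag 0 T (@cy nu).
  split=> [t tT|t tT].
    by apply: cvgB; [apply: cvgB; [exact: r1|exact: r2]|exact: r3].
  have [a1 h1] := l1 t tT; have [a2 h2] := l2 t tT; have [a3 h3] := l3 t tT.
  by exists (a1 - a2 - a3); apply: cvgB; [apply: cvgB|].
have /cvgrPdist_le /(_ k k0) /near_rightP[d' d'0 Hd'] := c.1 nu.1 nuT.
exists (Num.min d d'); first by rewrite lt_min d0.
move=> n t; rewrite inE => /predU1P[->|nS] /andP[nt tn].
  move: nt; rewrite le_eqVlt => /predU1P[<-|nt].
    by rewrite yi ?mem_head// subrr normr0 ltW.
  have := Hd' t; rewrite yi ?mem_head// subrr sub0r normrN; apply.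
  by rewrite nt/= (lt_le_trans tn)// lerD2l ge_min lexx orbT.
by apply: Hd => //; rewrite nt/= (lt_le_trans tn)// lerD2l ge_min lexx.
Qed.

Let y_bound : exists2 M, 0 <= M & forall t, 0 <= t <= T -> forall nu, nu \in S -> `|y nu t| <= M.
Proof.
elim: S => [|nu S' [M M0 HM]]; first by exists 0.
have [M1 M10 HM1] := cadlag_bounded (ltW T0) (continuous_cadlag 0 T (@cy nu)).
exists (Num.max M1 M) => [|t t0T k]; first by rewrite le_max M10.
by rewrite inE le_max => /predU1P[->|kS]; [rewrite HM1|rewrite HM ?orbT].
Qed.

(* The remainder of the linearisation of the dynamics tends to 0 pointwise in time
   only, whence the appeal to dominated convergence along sequences of amplitudes. *)
Lemma needle_expansion e : 0 < e -> exists2 r', 0 < r' & forall a, amplitude r a ->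
  \sum_(nu <- S) a nu <= r' ->
  `|X a T - x0 T - \sum_(nu <- S) a nu *: y nu T| <= e * \sum_(nu <- S) a nu.
Proof.
move=> e0; apply: contrapT => Hne.
have /choice[a Ha] : forall n : nat, exists a, [/\ amplitude r a,
    \sum_(nu <- S) a nu <= n.+1%:R^-1 &
    e * \sum_(nu <- S) a nu < `|X a T - x0 T - \sum_(nu <- S) a nu *: y nu T|].
  move=> n; apply: contrapT => Hna; apply: Hne; exists n.+1%:R^-1; first by rewrite invr_gt0.
  move=> a am ar; rewrite leNgt; apply/negP => h; apply: Hna; exists a.
  by split.
have am n : amplitude r (a n) by case: (Ha n).
have an0 n nu : 0 <= a n nu by case: (am n).
pose sg n := \sum_(nu <- S) a n nu.
have sg_le n : sg n <= n.+1%:R^-1 by case: (Ha n).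
have sg_ge0 n : 0 <= sg n by apply: sumr_ge0.
have TT : 0 <= T <= T by rewrite lexx ltW.
have [C C0 HC] := needle_dist0.
have [Y Y0 HY] := y_bound.
have sg_gt0 n : 0 < sg n.
  rewrite lt_def sg_ge0 andbT; apply/eqP => s0.
  have [_ _] := Ha n; rewrite -/(sg n) s0 mulr0.
  have := HC (a n) (am n) T TT; rewrite -/(sg n) s0 mulr0 normr_le0 => /eqP ->.
  rewrite sub0r normrN; apply/negP; rewrite -leNgt.
  rewrite -(@needle_ramp_end R V F y (a n) S 0 T)//; last first.
    by move=> nu nuS; rewrite addr0 -/(sg n) s0 addr0; have [/andP[_ /ltW]] := S_ok nuS.
  by apply: le_trans (needle_ramp_norm _ (an0 n) (HY T TT)) _; rewrite -/(sg n) s0 mulr0.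
have sg0 : sg n @[n --> \oo] --> (0 : R).
  apply/cvgrPdist_le => k k0; near=> n.
  rewrite sub0r normrN ger0_norm//; apply: le_trans (sg_le n) _.
  by apply/ltW; near: n; exact: (near_infty_natSinv_lt (PosNum k0)).
pose u n := needle_ctrl u0 (a n) S 0.
have Uu n : U (u n) by case: (XP (am n)).
have cX n : continuous (X (a n)) by case: (XP (am n)).
have dX n t : 0 <= t < T -> rderiv (X (a n)) t (Phi t (X (a n) t) (u n t)).
  by case: (XP (am n)) => _ _ _; apply.
pose rho n t := Phi t (X (a n) t) (u0 t) - Phi t (x0 t) (u0 t) - A t (X (a n) t - x0 t).
(* The linearisation error relative to the total amplitude: it is bounded by [2 * L * C] and tends
   to 0 at each time, because the distance of [X (a n)] to [x0] is at most [C * sg n]. *)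
pose w n t : R^o := `|rho n t| / sg n.
have cw n : cadlag 0 T (w n).
  have [r1 l1] := Phi_reg Uu0 (cX n).
  have [r2 l2] := Phi_reg Uu0 cx0.
  have [|r3 l3] := @A_reg (fun t => X (a n) t - x0 t).
    by move=> t; apply: cvgB; [exact: cX|exact: cx0].
  split=> [t tT|t tT].
    apply: (@cvgM R); last exact: cvg_cst.
    by apply: cvg_norm; apply: cvgB; [apply: cvgB; [exact: r1|exact: r2]|exact: r3].
  have [a1 h1] := l1 t tT; have [a2 h2] := l2 t tT; have [a3 h3] := l3 t tT.
  exists (`|a1 - a2 - a3| / sg n); apply: (@cvgM R); last exact: cvg_cst.
  by apply: cvg_norm; apply: cvgB; [apply: cvgB|].
have /choice[P HP] : forall n, exists P : R -> R^o, [/\ continuous P, P 0 = 0 &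
    forall t, 0 <= t < T -> rderiv P t (w n t)].
  by move=> n; exact: cadlag_primitive (@geom_complete_complete R R^o) (ltW T0) (cw n).
have tT' t : 0 <= t < T -> 0 <= t <= T by case/andP => -> /ltW ->.
have P0 : (P n T - P n 0 : R) @[n --> \oo] --> (0 : R).
  apply: (@cadlag_dominated R 0 T w P (2 * L * C) (ltW T0)) => //.
  - by move=> n; case: (HP n).
  - by move=> n; case: (HP n).
  - move=> n t tT; rewrite /w normrM normfV normr_id (gtr0_norm (sg_gt0 n)).
    rewrite ler_pdivrMr//; apply: le_trans (ler_normB _ _) _.
    rewrite (_ : 2 * L * C * _ = L * (C * sg n) + L * (C * sg n)); last by ring.
    have h := HC (a n) (am n) t (tT' t tT).
    apply: lerD.
      by apply: le_trans (Phi_lip _ _ Uu0 tT) _; rewrite ler_pM2l.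
    by apply: le_trans (A_le _ tT) _; rewrite ler_pM2l.
  - move=> t tT; apply/cvgrPdist_le => k k0.
    have C1 : 0 < C + 1 by rewrite ltr_wpDl.
    have [d d0 Hd] := Phi_diff tT (divr_gt0 k0 C1).
    have dC : 0 < d / (C + 1) by rewrite divr_gt0.
    near=> n.
    rewrite sub0r normrN /w normrM normfV normr_id (gtr0_norm (sg_gt0 n)).
    have h := HC (a n) (am n) t (tT' t tT).
    have hd : `|X (a n) t - x0 t| <= d.
      apply: le_trans h _; apply: (@le_trans _ _ ((C + 1) * sg n)).
        by rewrite -/(sg n) ler_wpM2r// lerDl.
      rewrite mulrC -ler_pdivlMr//.
      apply: le_trans (sg_le n) _; apply/ltW; near: n.
      exact: (near_infty_natSinv_lt (PosNum dC)).
    rewrite ler_pdivrMr//.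
    have := Hd _ hd; rewrite subrKC => /le_trans; apply.
    rewrite -mulrA ler_pM2l// mulrC ler_pdivrMr//.
    by apply: le_trans h _; rewrite -/(sg n) [leRHS]mulrC ler_wpM2r// lerDl.
(* The total forcing will be at most [3 * k1 * sg n], so that Gronwall's factor [expR (L * T)]
   brings it to 3/4 of the tolerance. *)
pose k1 := e / 4 / expR (L * T).
have k10 : 0 < k1 by rewrite !divr_gt0// expR_gt0.
have [d d0 Hd] := impulse_near k10.
have LCY : 0 < L * C + L * Y + 1 by rewrite ltr_wpDl// addr_ge0// mulr_ge0// ltW.
have k2 : 0 < k1 / (L * C + L * Y + 1) by rewrite divr_gt0.
near \oo => n.
have sd : sg n < d.
  apply: le_lt_trans (sg_le n) _; near: n; exact: (near_infty_natSinv_lt (PosNum d0)).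
have sk : (L * C + L * Y) * sg n <= k1.
  apply: (@le_trans _ _ ((L * C + L * Y + 1) * sg n)).
    by rewrite ler_wpM2r// lerDl.
  rewrite mulrC -ler_pdivlMr//; apply: le_trans (sg_le n) _; apply/ltW.
  near: n; exact: (near_infty_natSinv_lt (PosNum k2)).
have Pn : P n T - P n 0 <= k1.
  apply: le_trans (ler_norm _) _.
  have : `|0 - (P n T - P n 0)| <= k1.
    by near: n; move/cvgrPdist_le : P0 => /(_ k1 k10).
  by rewrite sub0r normrN.
have [cP _ dP] := HP n.
pose z t := needle_ramp y (a n) S 0 t.
pose chi t := needle_slot (fun _ _ => 1 : R^o) (a n) S 0 t.
(* A primitive of the forcing bound: the linearisation error at all times, and [2 * k1] during the
   slots, whose total length is [sg n]. *)
pose B t : R^o := sg n * P n t + 2 * k1 * needle_ramp (fun _ _ => 1 : R^o) (a n) S 0 t.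
have cz : continuous z by exact: continuous_needle_ramp.
have c1 : continuous (needle_ramp (fun _ _ => 1 : R^o) (a n) S 0).
  by apply: continuous_needle_ramp => nu t; exact: cvg_cst.
have cB : continuous B.
  move=> t; apply: cvgD; apply: (@cvgM R); try exact: cvg_cst.
    exact: cP.
  exact: c1.
have slot_end : {in S, forall nu, nu.1 + 0 + \sum_(k <- S) a n k <= T}.
  by move=> nu nuS; rewrite addr0; have := rT nuS; have [_ h] := am n; move: h; lra.
have slot_start : {in S, forall nu, 0 <= nu.1 + 0}.
  by move=> nu nuS; rewrite addr0; have [/andP[]] := S_ok nuS.
have BT : B T - B 0 <= 3 * k1 * sg n.
  rewrite /B needle_ramp_end// needle_ramp0// mulr0 addr0.
  under eq_bigr do rewrite [_ *: _]mulr1.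
  rewrite -/(sg n) (_ : _ - _ = sg n * (P n T - P n 0) + 2 * k1 * sg n); last by ring.
  rewrite (_ : 3 * k1 * sg n = sg n * k1 + 2 * k1 * sg n); last by ring.
  by rewrite lerD2r ler_pM2l.
have : `|X (a n) T - x0 T - z T| <= expR (L * (T - 0)) * (`|X (a n) 0 - x0 0 - z 0| + (B T - B 0)).
  apply: (@gronwall _ _ (fun t => X (a n) t - x0 t - z t) B L 0 T (ltW T0) (ltW L0)) => //.
    by move=> t; apply: cvgB; [apply: cvgB; [exact: cX|exact: cx0]|exact: cz].
  move=> t tT.
  exists (Phi t (X (a n) t) (u n t) - Phi t (x0 t) (u0 t) - (needle_slot y (a n) S 0 t + A t (z t))),
    (sg n * w n t + 2 * k1 * chi t).
  have chi0 : 0 <= chi t.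
    by rewrite /chi; have [[_ ->]|[nu [_ _ -> _]]] :=
      needle_cases u0 (fun _ _ => 1 : R^o) t (an0 n) (lexx 0) S_sorted.
  have w0 : 0 <= sg n * w n t by rewrite mulr_ge0// divr_ge0.
  split.
  - apply: rderivB; first by apply: rderivB; [exact: dX|exact: dx0].
    rewrite /z A_sum; apply: rderiv_needle_ramp => // nu; exact: dy.
  - apply: rderivD; first by apply: rderivZ; exact: dP.
    apply: rderivZ; rewrite -[chi t]addr0.
    have := @rderiv_needle_ramp R V _ (fun _ _ => 1 : R^o) (fun _ _ => 0) (a n) S 0 t (an0 n)
      (fun nu => rderiv_cst (1 : R^o) t).
    by rewrite needle_ramp_zero.
  - by rewrite addr_ge0// mulr_ge0// mulr_ge0// ltW.
  have hX := HC (a n) (am n) t (tT' t tT).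
  have [[uE sE]|[nu [nuS uE sE nut]]] := needle_cases u0 (fun _ _ => 1 : R^o) t (an0 n) (lexx 0) S_sorted.
    rewrite /chi !sE /u uE add0r mulr0 addr0.
    rewrite (_ : _ - _ = rho n t + A t (X (a n) t - x0 t - z t)); last first.
      by rewrite /rho (AB t _ (z t)); module R.
    apply: le_trans (ler_normD _ _) _; rewrite addrC; apply: lerD; first exact: A_le.
    by rewrite /w mulrC divfK// gt_eqF.
  rewrite /chi !sE /u uE mulr1.
  (* During a slot the error consists of the displacement of the state under the needle, the
     exchange of the jump for the response, and the linear term. The first and the last amount to at
     most [k1] by the choice of [n], the middle one to at most [k1] by the choice of [d]. *)
  rewrite (_ : _ - _ = (Phi t (X (a n) t) nu.2 - Phi t (x0 t) nu.2) + (impulse nu t - y nu t) - A t (z t)); last first.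
    by rewrite /impulse; module R.
  apply: (@le_trans _ _ (2 * k1)); last first.
    by rewrite -[leLHS]add0r; apply: lerD; [rewrite mulr_ge0// ltW|rewrite -[leLHS]add0r lerD].
  apply: le_trans (ler_normB _ _) _.
  have [_ Znu] := S_ok nuS.
  have h1 : `|Phi t (X (a n) t) nu.2 - Phi t (x0 t) nu.2| <= L * C * sg n.
    by apply: le_trans (Phi_lip _ _ (Ucst Znu) tT) _; rewrite -mulrA ler_pM2l.
  have h2 : `|impulse nu t - y nu t| <= k1.
    apply: Hd => //; case/andP: nut => -> /lt_le_trans; apply.
    by rewrite add0r lerD2l ltW.
  have h3 : `|A t (z t)| <= L * Y * sg n.
    apply: le_trans (A_le _ tT) _; rewrite -mulrA ler_pM2l//.
    exact: needle_ramp_norm (HY t (tT' t tT)).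
  have := ler_normD (Phi t (X (a n) t) nu.2 - Phi t (x0 t) nu.2) (impulse nu t - y nu t).
  by move: sk h1 h2 h3; rewrite mulrDl; lra.
have z0 : z 0 = 0 by rewrite /z needle_ramp0.
have [_ _ X0 _] := XP (am n).
rewrite X0 subrr z0 subrr normr0 add0r subr0.
have [_ _] := Ha n.
rewrite /z needle_ramp_end// => /lt_le_trans h /h; apply/negP; rewrite -leNgt.
apply: (@le_trans _ _ (expR (L * T) * (3 * k1 * sg n))).
  by rewrite ler_pM2l ?expR_gt0.
rewrite (_ : _ * _ = 3 / 4 * e * sg n); last first.
  by rewrite /k1; field; rewrite gt_eqF ?expR_gt0.
rewrite -/(sg n) ler_pM2r//; move: e0; lra.
Unshelve. all: by end_near. Qed.

End NeedleVariations.

(** * Piecewise continuous and piecewise differentiable functions *)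

Section Partitions.
Context {R : realType}.
Implicit Types (a b t : R) (s D : seq R).

Lemma itv_partition_find a b s t : itv_partition a b s -> a < t <= b ->
  exists2 i, (i < size s)%N & nth 0 (a :: s) i < t <= nth 0 s i.
Proof.
elim: s a => [|x s IH] a ps /andP[at_ tb].
  by move: at_ tb; rewrite (itv_partition_nil ps) => /lt_le_trans h /h; rewrite ltxx.
have [tx|xt] := leP t x; first by exists 0%N => //=; rewrite at_.
have [|i si ti] := IH x (itv_partition_cons ps); first by rewrite xt.
by exists i.+1.
Qed.

Lemma itv_partition_itv a b s i : itv_partition a b s -> (i < size s)%N ->
  [/\ a <= nth 0 (a :: s) i, nth 0 (a :: s) i < nth 0 s i & nth 0 s i <= b].
Proof.
elim: s a i => [//|x s IH] a i ps si.
have [/= /andP[ax px] _] := ps; have pxs := itv_partition_cons ps.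
have xb := itv_partition_le pxs.
case: i si => [|i] si /=; first by split.
by have [h1 h2 h3] := IH x i pxs si; split => //; apply: le_trans h1; exact: ltW.
Qed.

Lemma itv_partition_notin a b s i t : itv_partition a b s -> (i < size s)%N ->
  nth 0 (a :: s) i < t < nth 0 s i -> t \notin s.
Proof.
elim: s a i => [//|x s IH] a i ps si.
have [/= /andP[ax px] _] := ps; have pxs := itv_partition_cons ps.
case: i si => [|i] si /= /andP[h1 h2]; rewrite inE negb_or.
  rewrite lt_eqF//=; apply/negP => ts.
  have trans : transitive (fun x y : R => x < y) by move=> ? ? ?; exact: lt_trans.
  by move: (order_path_min trans px) => /allP/(_ t ts); rewrite ltNge (ltW h2).
rewrite (IH x i pxs si) ?h1 ?h2// andbT gt_eqF//; apply: le_lt_trans h1.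
by have [] := itv_partition_itv pxs (si : (i < size s)%N).
Qed.

Lemma itv_partition_of a b D : a < b -> exists2 s, itv_partition a b s &
  forall t, a < t < b -> t \in D -> t \in s.
Proof.
move=> ab; pose s := sort <=%R (undup [seq t <- D | a < t < b]).
have sE t : (t \in s) = (t \in D) && (a < t < b).
  by rewrite mem_sort mem_undup mem_filter andbC.
exists (rcons s b); last by move=> t tab tD; rewrite mem_rcons inE sE tab tD orbT.
split; last by rewrite last_rcons.
rewrite rcons_path; apply/andP; split; last first.
  have := mem_last a s; rewrite inE => /predU1P[->//|].
  by rewrite sE => /and3P[].
rewrite path_sortedE; last by move=> ? ? ?; exact: lt_trans.
apply/andP; split; first by apply/allP => t; rewrite sE => /and3P[].
by rewrite lt_sorted_uniq_le sort_uniq undup_uniq /=; exact: sort_le_sorted.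
Qed.

Lemma near_right_notin D t : \forall r \near t^'+, r \notin D.
Proof.
elim: D => [|d D IH]; first by apply: nearW.
have [dt|td] := leP d t; near=> r; rewrite inE negb_or; (apply/andP; split; last by near: r).
  rewrite gt_eqF//; apply: (le_lt_trans dt); near: r; exact: nbhs_right_gt.
by rewrite lt_eqF//; near: r; exact: nbhs_right_lt.
Unshelve. all: by end_near. Qed.

Lemma near_left_notin D t : \forall r \near t^'-, r \notin D.
Proof.
elim: D => [|d D IH]; first by apply: nearW.
have [td|dt] := leP t d; near=> r; rewrite inE negb_or; (apply/andP; split; last by near: r).
  rewrite lt_eqF//; apply: lt_le_trans td; near: r; exact: nbhs_left_lt.
by rewrite gt_eqF//; near: r; exact: nbhs_left_gt.
Unshelve. all: by end_near. Qed.

End Partitions.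

Section PiecewiseContinuity.
Context {R : realType} {Y : topologicalType}.
Implicit Types (T t : R) (U : set Y) (u : R -> Y) (D : seq R).

(** For positive [T] this is [NPC0] without a subdivision: one-sided limits are stated at each time
    and continuity off a finite set, a form that is convenient for spikes and for composition. *)
Definition regulated T U u := [/\ forall t, 0 <= t <= T -> U (u t),
  forall t, 0 <= t < T -> u @ t^'+ --> u t,
  forall t, 0 < t <= T -> exists2 l, U l & u @ t^'- --> l,
  u @ T^'- --> u T &
  exists D, forall t, 0 < t < T -> t \notin D -> u @ t --> u t].

Lemma regulated_cadlag T U u : regulated T U u -> cadlag 0 T u.
Proof. by move=> [_ h1 h2 _ _]; split => // t /h2[l]; exists l. Qed.

Lemma NPC0_regulated T U u : NPC0 T U u -> regulated T U u.
Proof.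
move=> [uU [s ps sP] ur uT]; split => //.
- move=> t t0T; have [i si /andP[it ti]] := itv_partition_find ps t0T.
  have [h1 _ h3] := sP i si; move: ti; rewrite le_eqVlt => /predU1P[->//|ti].
  exists (u t); first by apply: uU; rewrite in_itv/= ltW//; case/andP: t0T.
  have /(h1 t) cu : t \in `](nth 0 (0 :: s) i), (nth 0 s i)[ by rewrite in_itv/= it.
  by move=> A /cu /near_to_left.
- exists s => t /andP[t0 tT] ts.
  have [|i si /andP[it ti]] := itv_partition_find ps (_ : 0 < t <= T).
    by rewrite t0 ltW.
  have [h1 _ _] := sP i si; apply: h1; rewrite in_itv/= it/= lt_neqAle ti andbT.
  by apply: contra ts => /eqP ->; exact: mem_nth.
Qed.

Lemma regulated_NPC0 T U u : 0 < T -> regulated T U u -> NPC0 T U u.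
Proof.
move=> T0 [uU ur ul uT [D uD]].
split; [by move=> t; rewrite in_itv/=; exact: uU| |by move=> t; rewrite in_itv/=; exact: ur|by []].
have [s ps sD] := itv_partition_of D T0.
exists s => // i si; have [h1 h2 h3] := itv_partition_itv ps si.
have h4 := le_lt_trans h1 h2.
split.
- move=> t; rewrite in_itv/= => tab; have [ta tb] := andP tab.
  have t0T : 0 < t < T by rewrite (le_lt_trans h1 ta) (lt_le_trans tb).
  apply: uD => //; apply/negP => tD.
  by have := itv_partition_notin ps si tab; rewrite (sD t t0T tD).
- exists (u (nth 0 (0 :: s) i)); last by apply: ur; rewrite h1 (lt_le_trans h2).
  by apply: uU; rewrite h1 (le_trans (ltW h2)).
- by apply: ul; rewrite h4.
Qed.

End PiecewiseContinuity.

Section RightDerivativePC1.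
Context {R : realType} {F : normedModType R}.
Implicit Types (T t : R) (x w : R -> F) (D : seq R).

Lemma rderiv_unique (y : R -> F) t v v' : rderiv y t v -> rderiv y t v' -> v = v'.
Proof.
move=> yv yv'; apply/eqP; rewrite -subr_eq0 -normr_le0; apply/ler_addgt0Pl => e e0.
rewrite addr0.
have e2 : 0 < e / 2 by rewrite divr_gt0.
near t^'+ => s.
have st : 0 < s - t by rewrite subr_gt0; near: s; exact: nbhs_right_gt.
rewrite -(ler_pM2l st) -[s - t in leLHS]gtr0_norm// -normrZ.
rewrite (_ : _ *: _ = (y s - y t - (s - t) *: v') - (y s - y t - (s - t) *: v)); last by module R.
apply: le_trans (ler_normB _ _) _.
rewrite (_ : _ * e = e / 2 * (s - t) + e / 2 * (s - t)); last by field.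
by apply: lerD; near: s; [exact: yv'|exact: yv].
Unshelve. all: by end_near. Qed.

(** The mean value inequality for [x s - s *: w t] bounds the difference quotients on both sides of
    [t], although only right derivatives are given. *)
Lemma rderiv_is_derive1 x w t : continuous x ->
  (\forall s \near t, rderiv x s (w s)) -> w @ t --> w t ->
  derivable x t 1 /\ derive1 x t = w t.
Proof.
move=> cx dx cw.
suff H : h^-1 *: ((x \o shift t) h%:A - x t) @[h --> 0^'] --> w t.
  split; first by apply/cvg_ex; exists (w t).
  by rewrite derive1E; exact: cvg_lim H.
apply/cvgrPdist_le => e e0.
have : \forall s \near t, rderiv x s (w s) /\ `|w t - w s| <= e.
  by apply: filterS2 dx ((cvgrPdist_le _ _).1 cw e e0).
move=> /nbhs_ballP[d /= d0 Hd].
have lip a b : a <= b -> `|t - a| < d -> `|t - b| < d ->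
    `|(x b - b *: w t) - (x a - a *: w t)| <= e * (b - a).
  move=> ab ad bd.
  apply: (@rderiv_lip _ _ (fun s => x s - s *: w t) e a b ab).
    move=> s; apply: cvgB; first exact: cx.
    by apply: cvgZr_tmp; exact: cvg_id.
  move=> s /andP[as_ sb]; have [] := Hd s.
    rewrite -ball_normE /=; move: ad bd; rewrite !ltr_norml => /andP[? ?] /andP[? ?].
    by apply/andP; split; lra.
  move=> xs ws; exists (w s - w t); last by rewrite distrC.
  apply: rderivB => //.
  have := rderiv_scale (rderiv_id s) (rderiv_cst (w t) s).
  by rewrite scale1r scaler0 addr0.
exists d => // h; rewrite /ball_ /= sub0r normrN => hd h0.
rewrite [h%:A]mulr1 distrC.
have -> : h^-1 *: (x (h + t) - x t) - w t = h^-1 *: ((x (h + t) - (h + t) *: w t) - (x t - t *: w t)).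
  rewrite -[w t in LHS]scale1r -[1 in LHS](mulVf h0); module R.
rewrite normrZ normfV mulrC ler_pdivrMr ?normr_gt0//.
have tt : `|t - t| < d by rewrite subrr normr0.
have ht : t - (h + t) = - h by ring.
have th : `|t - (h + t)| < d by rewrite ht normrN.
have [h1|h1] := leP 0 h.
  have := lip t (h + t); rewrite lerDr => /(_ h1 tt th); rewrite addrK ger0_norm//.
rewrite distrC; have := lip (h + t) t; rewrite gerDr => /(_ (ltW h1) th tt).
by rewrite ht ltr0_norm.
Qed.

Section OnInterval.
Variables (T : R) (x w : R -> F).
Hypotheses (T0 : 0 < T) (cx : continuous x) (wreg : regulated T setT w).
Hypothesis dx : forall t, 0 <= t < T -> rderiv x t (w t).

Let Dw : exists D, forall t, 0 < t < T -> t \notin D ->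
  [/\ derivable x t 1, derive1 x t = w t & w @ t --> w t].
Proof.
have [_ _ _ _ [D wD]] := wreg; exists D => t t0T tD.
suff [] : derivable x t 1 /\ derive1 x t = w t by split => //; exact: wD.
apply: rderiv_is_derive1 => //; last exact: wD.
have [t0 tT] := andP t0T.
have : \forall s \near t, s \in `]0, T[ by apply: near_in_itvoo; rewrite in_itv/= t0.
by apply: filterS => s; rewrite in_itv/= => /andP[s0 sT]; apply: dx; rewrite ltW.
Qed.

Let derive1_right t : 0 <= t < T -> derive1 x @ t^'+ --> w t.
Proof.
move=> tT; have [D HD] := Dw; have [_ /(_ t tT) wt _ _ _] := wreg.
apply: cvg_trans wt; apply: near_eq_cvg.
have [t0 tT'] := andP tT.
near=> s; apply/esym; have [||_ -> //] := HD s; last by near: s; exact: near_right_notin.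
apply/andP; split; last by near: s; exact: nbhs_right_lt.
by apply: (le_lt_trans t0); near: s; exact: nbhs_right_gt.
Unshelve. all: by end_near. Qed.

Let derive1_left t (l : F) : 0 < t <= T -> w @ t^'- --> l -> derive1 x @ t^'- --> l.
Proof.
move=> tT wt; have [D HD] := Dw.
apply: cvg_trans wt; apply: near_eq_cvg.
have [t0 tT'] := andP tT.
near=> s; apply/esym; have [||_ -> //] := HD s; last by near: s; exact: near_left_notin.
apply/andP; split; first by near: s; exact: nbhs_left_gt.
by apply: lt_le_trans tT'; near: s; exact: nbhs_left_lt.
Unshelve. all: by end_near. Qed.

Lemma rderiv_PC1 (G : set F) : (forall t, 0 <= t <= T -> G (x t)) -> PC1 T G x.
Proof.
move=> xG; split.
- exact: continuous_subspaceT.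
- have [D HD] := Dw; have [s ps sD] := itv_partition_of D T0.
  exists s; split => // i si; have [h1 h2 h3] := itv_partition_itv ps si.
  have inD t : t \in `](nth 0 (0 :: s) i), (nth 0 s i)[ -> 0 < t < T /\ t \notin D.
    rewrite in_itv/= => tab; have [ta tb] := andP tab.
    have t0T : 0 < t < T by rewrite (le_lt_trans h1 ta) (lt_le_trans tb).
    split => //; apply/negP => tD.
    by have := itv_partition_notin ps si tab; rewrite (sD t t0T tD).
  split.
  + by move=> t /inD[t0T tD]; case: (HD t t0T tD).
  + move=> t tab.
    have [t0T tD] := inD t tab; have [_ xt wt] := HD t t0T tD.
    suff : derive1 x @ t --> derive1 x t by [].
    rewrite xt.
    apply: cvg_trans wt; apply: near_eq_cvg.
    near=> r; have [||_ -> //] := HD r.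
      by apply: (inD r _).1; near: r; exact: (near_in_itvoo tab).
    by apply: (inD r _).2; near: r; exact: (near_in_itvoo tab).
  + by apply/cvg_ex; exists (w (nth 0 (0 :: s) i)); apply: derive1_right; rewrite h1 (lt_le_trans h2).
  + have tb : 0 < nth 0 s i <= T by rewrite (le_lt_trans h1 h2).
    have [_ _ /(_ _ tb)[l _ wl] _ _] := wreg.
    by apply/cvg_ex; exists l; exact: derive1_left wl.
- by move=> t; rewrite in_itv/=; exact: xG.
Unshelve. all: by end_near. Qed.

(** The subdivision picked by [ext_derive] is arbitrary. At its points before [T] the right limit of
    the derivative is [w t] by right continuity, and at [T] the left limit is [w T]; elsewhere the
    derivative exists and equals [w t] by uniqueness of right derivatives. *)
Lemma rderiv_ext_derive (G : set F) t : (forall s, 0 <= s <= T -> G (x s)) ->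
  0 <= t <= T -> ext_derive T x t = w t.
Proof.
move=> xG /andP[t0]; have [_ xs _] := rderiv_PC1 xG.
have := xgetPex [::] xs; rewrite /ext_derive; set s := xget _ _ => -[ps sP].
have [_ _ _ wT _] := wreg.
rewrite /ext_derive_on le_eqVlt; case: eqVneq => [-> _|_ /= tT].
  by apply: cvg_lim => //; apply: derive1_left wT; rewrite T0 lexx.
have t0T : 0 <= t < T by rewrite t0.
case: ifPn => [_|]; first by apply: cvg_lim => //; exact: derive1_right.
rewrite inE negb_or eq_sym => /andP[t_neq0 ts].
have t_gt0 : 0 < t by rewrite lt_neqAle t_neq0.
have [|i si /andP[it ti]] := itv_partition_find ps (_ : 0 < t <= T).
  by rewrite t_gt0 ltW.
have [/(_ t) xt _ _ _] := sP i si.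
rewrite derive1E; apply: (@rderiv_unique x t); last exact: dx.
apply: rderiv_derive; apply: xt; rewrite in_itv/= it/= lt_neqAle ti andbT.
by apply: contra ts => /eqP ->; exact: mem_nth.
Qed.

End OnInterval.

Lemma continuous_clamp_comp T x : 0 < T -> {within `[0, T], continuous x} ->
  continuous (x \o clamp 0 T).
Proof.
move=> T0 cx t; have cT := clamp_itv t (ltW T0).
move/subspace_continuousP : cx => /(_ (clamp 0 T t)) cx.
have {}cx : x @ within `[0, T] (nbhs (clamp 0 T t)) --> x (clamp 0 T t).
  by apply: cx; rewrite /= in_itv.
apply: (@cvg_comp _ _ _ (clamp 0 T) x _ _ _ _ cx) => A; rewrite /within /= => nA.
suff : nbhs t (clamp 0 T @^-1` A) by [].
apply: (@filterS _ (nbhs t) _ _ _ _ (@continuous_clamp R 0 T t _ nA)) => s; apply.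
have /andP[h1 h2] := clamp_itv s (ltW T0).
by rewrite /= in_itv/= h1 h2.
Qed.

Lemma PC1_rderiv T (G : set F) x w t : 0 < T -> PC1 T G x ->
  {in `[0, T], forall s, ext_derive T x s = w s} ->
  0 <= t < T -> rderiv (x \o clamp 0 T) t (w t).
Proof.
move=> T0 [cx xs _] dx t0T; have [t0 tT] := andP t0T.
have := xgetPex [::] xs.
have : ext_derive T x t = w t by apply: dx; rewrite in_itv/= t0 ltW.
rewrite /ext_derive; set s := xget _ _ => + [ps sP].
have cX := continuous_clamp_comp T0 cx.
have XE r : 0 <= r <= T -> (x \o clamp 0 T) r = x r by move=> ?; rewrite /= clampE.
have Xt : (x \o clamp 0 T) t = x t by rewrite XE// t0 ltW.
have near_eq : \forall r \near t^'+, (x \o clamp 0 T) r = x r.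
  near=> r; apply: XE; apply/andP; split.
    by apply: (le_trans t0); apply: ltW; near: r; exact: nbhs_right_gt.
  by apply: ltW; near: r; exact: nbhs_right_lt.
rewrite /ext_derive_on lt_eqF//; case: ifPn => [ts limE|].
  have [i si [ta tb]] : exists2 i, (i < size s)%N & nth 0 (0 :: s) i = t /\ t < nth 0 s i.
    have [i [si ti]] : exists i, (i < (size s).+1)%N /\ nth 0 (0 :: s) i = t.
      by exists (index t (0 :: s)); rewrite nth_index// -[X in (_ < X)%N]/(size (0 :: s)) index_mem.
    have si' : (i < size s)%N.
      rewrite ltn_neqAle -ltnS si andbT; apply/eqP => e; move: tT; rewrite -ti e.
      by rewrite (itv_partition_nth_size 0 ps) ltxx.
    exists i => //; split => //; rewrite -ti.
    by have [] := itv_partition_itv ps si'.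
  have [d1 _ /cvg_ex[l dl] _] := sP i si.
  rewrite ta in d1 dl.
  have lw : l = w t by rewrite -limE; apply/esym; apply: cvg_lim dl.
  rewrite lw in dl.
  have [_ _ bT] := itv_partition_itv ps si.
  move=> e e0.
  have /cvgrPdist_le /(_ e e0) /near_rightP[d d0 Hd] := dl.
  apply/near_rightP; exists (Num.min d (nth 0 s i - t)).
    by rewrite lt_min d0 subr_gt0.
  move=> r /andP[tr]; rewrite -ltrBlDl lt_min ltrBlDl ltrBlDl subrKC => /andP[rd rb].
  pose X := x \o clamp 0 T.
  have dX q : t < q < r -> exists2 v, rderiv X q v & `|v - w t| <= e.
    move=> /andP[tq qr]; exists (derive1 x q); last first.
      by rewrite distrC; apply: Hd; rewrite tq (lt_trans qr).
    have qT : q < T by rewrite (lt_le_trans _ bT)// (lt_trans qr).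
    have q0 : 0 <= q by rewrite ltW// (le_lt_trans t0).
    have : rderiv x q (derive1 x q).
      by rewrite derive1E; apply: rderiv_derive; apply: d1; rewrite in_itv/= tq (lt_trans qr).
    apply: (@rderiv_near _ _ x X); first by rewrite /X XE// q0 ltW.
    near=> p; rewrite /X XE//; apply/andP; split.
      by apply: (le_trans q0); apply: ltW; near: p; exact: nbhs_right_gt.
    by apply: ltW; near: p; exact: nbhs_right_lt.
  pose Y q := X q - q *: w t.
  have cY : continuous Y.
    by move=> q; apply: cvgB; [exact: cX|apply: cvgZr_tmp; exact: cvg_id].
  rewrite (_ : _ - _ = Y r - Y t); last by rewrite /Y /X; module R.
  (* At [t] itself only the limit of the derivative is known, so the estimate starts at [q] after
     [t], and [q] then tends to [t]. *)
  have lip q : t < q < r -> `|Y r - Y q| <= e * (r - t).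
    move=> /andP[tq qr]; apply: (@le_trans _ _ (e * (r - q))); last first.
      by rewrite ler_pM2l// lerD2l lerN2 ltW.
    apply: (@rderiv_lip _ _ Y e q r (ltW qr) cY) => p /andP[qp pr].
    have [|v Xv vw] := dX p; first by rewrite (lt_le_trans tq qp).
    exists (v - w t) => //; apply: rderivB => //.
    have := rderiv_scale (rderiv_id p) (rderiv_cst (w t) p).
    by rewrite scale1r scaler0 addr0.
  have : `|Y r - Y q| @[q --> t^'+] --> `|Y r - Y t|.
    apply: cvg_norm; apply: cvgB; first exact: cvg_cst.
    by move=> A /(cY t) /near_to_right.
  move=> /cvg_lim <-//; apply: limr_le.
    apply/cvg_ex; exists `|Y r - Y t|; apply: cvg_norm; apply: cvgB; first exact: cvg_cst.
    by move=> A /(cY t) /near_to_right.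
  near=> q; apply: lip; apply/andP; split.
    by near: q; exact: nbhs_right_gt.
  by near: q; exact: nbhs_right_lt.
rewrite inE negb_or eq_sym => /andP[t_neq0 ts] <-.
have t_gt0 : 0 < t by rewrite lt_neqAle t_neq0.
have [|i si /andP[it ti]] := itv_partition_find ps (_ : 0 < t <= T).
  by rewrite t_gt0 ltW.
have [/(_ t) xt _ _ _] := sP i si.
apply: rderiv_near Xt near_eq _; rewrite derive1E; apply: rderiv_derive; apply: xt.
rewrite in_itv/= it/= lt_neqAle ti andbT.
by apply: contra ts => /eqP ->; exact: mem_nth.
Unshelve. all: by end_near. Qed.

End RightDerivativePC1.

(** * Differentials along a trajectory *)

Section Topology.
Context {R : realType}.

Lemma within_cvg {X Y : topologicalType} (D : set X) (psi : X -> Y) {I : Type}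
  (G : set_system I) {FG : Filter G} (g : I -> X) p :
  {within D, continuous psi} -> D p -> g @ G --> p -> (\forall s \near G, D (g s)) ->
  psi \o g @ G --> psi p.
Proof.
move=> /subspace_continuousP cpsi Dp gp Dg.
apply: cvg_comp (cpsi p Dp) => A; rewrite /within /= => nA.
suff : G (g @^-1` A) by [].
have h : G (g @^-1` (fun x => D x -> A x)) by exact: gp nA.
by apply: filterS2 h Dg => s /[apply].
Qed.

Lemma cvg_pair_to {X Y : topologicalType} {I : Type} (G : set_system I) {FG : Filter G}
  (f : I -> X) (g : I -> Y) (a : X) (b : Y) :
  f @ G --> a -> g @ G --> b -> (fun i => (f i, g i)) @ G --> (a, b).
Proof. by move=> fa gb; exact: (cvg_pair fa gb). Qed.

(** Balls of the state space need not be compact. Hypotheses on compact sets are exploited by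
    contradiction, along a convergent sequence of counterexamples, and this is the compact set to
    feed to them. *)
Lemma compact_cvg_range {X : topologicalType} (xi : nat -> X) (x : X) :
  xi @ \oo --> x -> compact ([set x] `|` range xi).
Proof.
move=> xix F PF FK; apply: contrapT => ncl.
have ncl' p : ([set x] `|` range xi) p -> ~ cluster F p.
  by move=> Kp cp; apply: ncl; exists p.
have : ~ cluster F x by apply: ncl'; left.
move=> /existsNP[A /existsNP[B /not_implyP[FA /not_implyP[Bx /set0P/negP/negPn/eqP AB]]]].
have [N _ HN] := xix _ Bx.
pose K0 := [set xi n | n in `I_N].
have FK0 : F K0.
  apply: filterS2 FA FK => z Az [zx|[n _ nz]].
    by have : (A `&` B) z; [split => //; rewrite zx; exact: nbhs_singleton|rewrite AB].
  exists n => //=; rewrite ltnNge; apply/negP => Nn.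
  by have : (A `&` B) z; [split => //; rewrite -nz; exact: HN|rewrite AB].
have [p [K0p cp]] : K0 `&` cluster F !=set0.
  by apply: finite_compact FK0; apply: finite_image; exact: finite_II.
by apply: (ncl' p) => //; right; case: K0p => n _ <-; exists n.
Qed.

End Topology.

Section Differentials.
Context {R : realType} {X Y : normedModType R}.
Implicit Types (f : X -> Y) (x : X).

Lemma dG_gateaux f x : gateaux_differentiable f x -> is_gateaux f x (dG f x).
Proof. by move=> [D fD]; exact: (@getI _ [set D | is_gateaux f x D] D fD). Qed.

Lemma dH_hadamard f x : hadamard_differentiable f x -> is_hadamard f x (dH f x).
Proof. by move=> [D fD]; exact: (@getI _ [set D | is_hadamard f x D] D fD). Qed.

Lemma dF_is_diff f x : differentiable f x -> is_diff x f (dF f x).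
Proof.
move=> df; have dc : ('d f x : X -> Y) \in bounded_linear.
  apply/mem_set; split; last exact: diff_continuous.
  by move=> a u v; rewrite linearP.
have dfD : is_diff x f (BLin dc) by exact: DiffDef.
by rewrite /dF; apply: (@getPex _ [set D : blin X Y | is_diff x f D]); exists (BLin dc).
Qed.

Lemma dF_eq f x (D : blin X Y) : is_diff x f D -> dF f x = D.
Proof.
move=> fD; have df : differentiable f x by case: fD.
have [_ e1] := dF_is_diff df; have [_ e2] := fD.
by apply: val_inj; rewrite /= -e1 -e2.
Qed.

Lemma dF_expansion f x e : differentiable f x -> 0 < e ->
  exists2 d, 0 < d & forall k, `|k| <= d -> `|f (x + k) - f x - dF f x k| <= e * `|k|.
Proof.
move=> df e0; have [_ dE] := dF_is_diff df.
have dx := diff_locallyx df; set k := 'o _ in dx.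
have /(littleoP [littleo of k]) /nbhs_ballP[d /= d0 Hd] := e0.
exists (d / 2); first by rewrite divr_gt0.
move=> h hd; rewrite [x + h]addrC dx dE.
rewrite (_ : _ - _ - _ = k h); last by module R.
apply: Hd; rewrite -ball_normE /ball_ /= sub0r normrN (le_lt_trans hd)//.
by rewrite ltr_pdivrMr// mulr_natr mulr2n ltrDl.
Qed.

Lemma gateaux_rderiv f x h (D : blin X Y) t : is_gateaux f (x + t *: h) D ->
  rderiv (fun s => f (x + s *: h)) t (D h).
Proof.
move=> /(_ h) /cvgrPdist_le fD e e0.
have /near_rightP[d d0 Hd] := fD e e0.
apply/near_rightP; exists d => // s /andP[ts sd].
have st : 0 < s - t by rewrite subr_gt0.
have := Hd (s - t); rewrite st ltrBlDl add0r sd => /(_ isT).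
rewrite -addrA -scalerDl subrKC distrC => H.
rewrite (_ : _ - _ = (s - t) *: ((s - t)^-1 *: (f (x + s *: h) - f (x + t *: h)) - D h)).
  by rewrite normrZ gtr0_norm// mulrC ler_pM2r.
by rewrite scalerBr scalerA mulfV ?scale1r// gt_eqF.
Qed.

(** One-sided Gateaux differentials are right derivatives along segments, so the mean value
    inequality applies to the restriction of [f] to the segment. *)
Lemma gateaux_lipschitz f (x y : X) (L : R) :
  (forall s, 0 <= s <= 1 -> {for x + s *: (y - x), continuous f} /\
    exists2 D, is_gateaux f (x + s *: (y - x)) D & opnorm D <= L) ->
  `|f y - f x| <= L * `|y - x|.
Proof.
move=> H; pose g s := f (x + clamp 0 1 s *: (y - x)).
have cg : continuous g.
  move=> s; have [cf _] := H _ (clamp_itv s ler01).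
  apply: (@cvg_comp _ _ _ (fun s => x + clamp 0 1 s *: (y - x)) f _ _ _ _ cf).
  apply: cvgD; first exact: cvg_cst.
  by apply: cvgZr_tmp; exact: continuous_clamp.
have h01 : (0 : R) <= 1 by [].
have g1 : g 1 = f y by rewrite /g clampE ?lexx ?ler01// scale1r subrKC.
have g0 : g 0 = f x by rewrite /g clampE ?lexx ?ler01// scale0r addr0.
rewrite -g1 -g0.
apply: le_trans (@rderiv_lip _ _ g (L * `|y - x|) 0 1 h01 cg _) _; last by rewrite subr0 mulr1.
move=> s /andP[s0 s1]; have [|_ [D fD DL]] := H s; first by rewrite s0 ltW.
exists (D (y - x)); last first.
  by apply: le_trans (le_opnorm _ _) _; rewrite ler_wpM2r.
apply: rderiv_near (gateaux_rderiv fD).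
  by rewrite /g clampE// s0 ltW.
near=> r; rewrite /g clampE//; apply/andP; split.
  by apply: (le_trans s0); apply: ltW; near: r; exact: nbhs_right_gt.
by apply: ltW; near: r; exact: nbhs_right_lt.
Unshelve. all: by end_near. Qed.

End Differentials.

Section ControlRange.
Context {R : realType} {V : normedModType R}.
Implicit Types (U : set V) (u : R -> V).

Let segment_image (a b : R) u U : a < b -> {in `]a, b[, continuous u} ->
  u @ a^'+ --> u a -> u @ b^'- --> u b -> (forall t, a <= t <= b -> U (u t)) ->
  exists2 M, compact M /\ M `<=` U & forall t, a <= t <= b -> M (u t).
Proof.
move=> ab cu ua ub uU; exists (u @` `[a, b]).
  split; last by move=> _ [t /= + <-]; rewrite in_itv/=; exact: uU.
  apply: continuous_compact; last exact: segment_compact.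
  exact/continuous_within_itvP.
by move=> t tab; exists t => //=; rewrite in_itv.
Qed.

(** Real induction glues images of closed segments. Near a time approached from the left, the
    control is closed up by its left limit, which lies in [U], so the compact set stays inside
    [U]. *)
Lemma regulated_compact_range (T : R) U u : 0 < T -> regulated T U u ->
  exists2 M, compact M /\ M `<=` U & forall t, 0 <= t <= T -> M (u t).
Proof.
move=> T0 [uU ur ul uT [D uD]].
pose Q t := exists2 M, compact M /\ M `<=` U & forall s, 0 <= s <= t -> M (u s).
apply: (@real_ind _ Q 0 T (ltW T0)).
- exists [set u 0]; first split.
  + exact: compact_set1.
  + by move=> _ ->; apply: uU; rewrite lexx ltW.
  + by move=> s; rewrite -eq_le => /eqP <-.
- move=> t t0T [M [cM MU] Mu]; have [t0 tT] := andP t0T.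
  have [d d0 Hd] := (near_rightP _ _).1 (near_right_notin D t).
  apply/near_rightP; exists (Num.min d (T - t)); first by rewrite lt_min d0 subr_gt0.
  move=> s /andP[ts]; rewrite -ltrBlDl lt_min ltrBlDl ltrBlDl subrKC => /andP[sd sT].
  have cont r : t < r <= s -> u @ r --> u r.
    move=> /andP[tr rs]; apply: uD.
      by rewrite (le_lt_trans t0 tr) (le_lt_trans rs).
    by apply: Hd; rewrite tr (le_lt_trans rs).
  have [||||M' [cM' M'U] M'u] := @segment_image t s u U ts.
  + by move=> r; rewrite in_itv/= => /andP[tr rs]; apply: cont; rewrite tr ltW.
  + exact: ur.
  + by move=> A /(cont s) /near_to_left; apply; rewrite ts lexx.
  + by move=> r /andP[tr rs]; apply: uU; rewrite (le_trans t0 tr) (le_trans rs (ltW sT)).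
  exists (M `|` M'); first by split; [exact: compactU|rewrite subUset].
  move=> r /andP[r0 rs]; have [rt|tr] := leP r t; [left; apply: Mu|right; apply: M'u].
    by rewrite r0.
  by rewrite ltW.
- move=> t t0T HQ; have [t0 tT] := andP t0T.
  have [lim Ulim ulim] := ul t t0T.
  have [d d0 Hd] := (near_leftP _ _).1 (near_left_notin D t).
  pose c := Num.max (t / 2) (t - d / 2).
  have c0 : 0 < c by rewrite lt_max divr_gt0.
  have ct : c < t by rewrite gt_max; apply/andP; split; lra.
  have cd : t - d < c by rewrite lt_max; apply/orP; right; lra.
  have [M [cM MU] Mu] := HQ c (introT andP (conj (ltW c0) ct)).
  pose v s := if s == t then lim else u s.
  have vt : v t = lim by rewrite /v eqxx.
  have vu r : r < t -> v r = u r by move=> rt; rewrite /v lt_eqF.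
  have cont r : c <= r < t -> v @ r --> v r.
    move=> /andP[cr rt]; rewrite vu//.
    have ur' : u @ r --> u r.
      apply: uD; first by rewrite (lt_le_trans c0 cr) (lt_le_trans rt).
      by apply: Hd; rewrite (lt_le_trans cd cr).
    apply: cvg_trans ur'; apply: near_eq_cvg.
    have : \forall s \near r, s \in `](r - 1), t[ by apply: near_in_itvoo; rewrite in_itv/= rt ltrBlDr ltrDl ltr01.
    by apply: filterS => s; rewrite in_itv/= => /andP[_ st]; rewrite vu.
  have [||||M' [cM' M'U] M'u] := @segment_image c t v U ct.
  + by move=> r; rewrite in_itv/= => /andP[cr rt]; apply: cont; rewrite ltW.
  + by move=> A /(cont c) /near_to_right; apply; rewrite lexx.
  + rewrite vt; apply: cvg_trans ulim; apply: near_eq_cvg.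
    near=> s; rewrite vu//; near: s; exact: nbhs_left_lt.
  + move=> r /andP[cr]; rewrite le_eqVlt => /predU1P[->|rt]; first by rewrite vt.
    by rewrite vu//; apply: uU; rewrite (le_trans (ltW c0) cr) (le_trans (ltW rt)).
  exists (M `|` M' `|` [set u t]).
    split; first by apply: compactU; [exact: compactU|exact: compact_set1].
    rewrite !subUset; split; first by split.
    by move=> _ ->; apply: uU; rewrite (ltW t0).
  move=> r /andP[r0]; rewrite le_eqVlt => /predU1P[->|rt]; first by right.
  left; have [rc|cr] := leP r c; first by left; apply: Mu; rewrite r0.
  by right; rewrite -vu//; apply: M'u; rewrite (ltW cr) ltW.
Unshelve. all: by end_near. Qed.

End ControlRange.

(** Stating the passage to the limit for an arbitrary filter [G] settles right limits, left limits
    and two-sided continuity at once; [z] differs from [u t] when [G] approaches a jump from the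
    left. *)
Lemma regulated_comp {R : realType} {V W : topologicalType} (T : R) (U : set V)
  (u : R -> V) (psi : R -> V -> W) : 0 < T -> regulated T U u ->
  (forall t z (G : set_system R), Filter G -> 0 <= t <= T -> U z -> G --> t -> u @ G --> z ->
    (\forall s \near G, 0 <= s <= T) -> (fun s => psi s (u s)) @ G --> psi t z) ->
  regulated T setT (fun t => psi t (u t)).
Proof.
move=> T0 [uU ur ul uT [D uD]] lim.
have right t : 0 <= t < T -> \forall s \near t^'+, 0 <= s <= T.
  move=> /andP[t0 tT]; near=> s; apply/andP; split.
    by apply: (le_trans t0); apply: ltW; near: s; exact: nbhs_right_gt.
  by apply: ltW; near: s; exact: nbhs_right_lt.
have left t : 0 < t <= T -> \forall s \near t^'-, 0 <= s <= T.
  move=> /andP[t0 tT]; near=> s; apply/andP; split.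
    by apply: ltW; near: s; exact: nbhs_left_gt.
  by apply: le_trans tT; apply: ltW; near: s; exact: nbhs_left_lt.
split => //.
- move=> t tT; have tT' : 0 <= t <= T by case/andP: tT => -> /ltW ->.
  apply: (lim t (u t)) => //; [exact: uU|by move=> A /near_to_right|exact: ur|exact: right].
- move=> t tT; have [z Uz uz] := ul t tT; exists (psi t z) => //.
  have tT' : 0 <= t <= T by case/andP: tT => /ltW -> ->.
  apply: (lim t z) => //; [by move=> A /near_to_left|exact: left].
- have TT : 0 < T <= T by rewrite T0 lexx.
  apply: (lim T (u T)) => //; [by rewrite lexx ltW|by apply: uU; rewrite lexx ltW|by move=> A /near_to_left|exact: left].
- exists D => t tT tD; have tT' : 0 <= t <= T by case/andP: tT => /ltW -> /ltW ->.
  apply: (lim t (u t)) => //; [exact: uU|exact: uD|].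
  have : \forall s \near t, s \in `]0, T[ by apply: near_in_itvoo; rewrite in_itv.
  by apply: filterS => s; rewrite in_itv/= => /andP[/ltW -> /ltW ->].
Unshelve. all: by end_near. Qed.

Section RegularAlong.
Context {R : realType} {E : completeNormedModType R} {V : normedModType R}.
Context {l m q : nat} (P : bolza E V l m q) {F : normedModType R}.
Local Notation T := (horizon P).
Local Notation U := (control_set P).
Local Notation Om := (state_domain P).
Variables (x0 X0 : R -> E) (phi : R -> E -> V -> F).
Hypotheses (T0 : 0 < T) (oOm : open Om) (cX0 : continuous X0).
Hypothesis X0E : forall t, 0 <= t <= T -> X0 t = x0 t.
Hypothesis X0Om : forall t, 0 <= t <= T -> Om (X0 t).
Hypothesis reg : regular_along P x0 phi.

Lemma regular_continuous t xi z : 0 <= t <= T -> Om xi -> U z ->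
  {for xi, continuous (fun y => phi t y z)}.
Proof.
move=> tT Oxi Uz; have [cphi _ _ _ _] := reg.
have D : (`[0, T] `*` Om `*` U)%classic (t, xi, z) by split => //; split => //=; rewrite in_itv.
apply: (within_cvg (g := fun y => (t, y, z)) cphi D).
  apply: cvg_pair_to; last exact: cvg_cst.
  by apply: cvg_pair_to; [exact: cvg_cst|exact: cvg_id].
have : nbhs xi Om by apply: open_nbhs_nbhs.
by apply: filterS => y Oy; split => //; split => //=; rewrite in_itv.
Qed.

Lemma regular_lim (y : R -> E) u t z (G : set_system R) : Filter G ->
  (forall t, 0 <= t <= T -> U (u t)) -> continuous y ->
  (forall t, 0 <= t <= T -> Om (y t)) -> 0 <= t <= T -> U z -> G --> t -> u @ G --> z ->
  (\forall s \near G, 0 <= s <= T) -> (fun s => phi s (y s) (u s)) @ G --> phi t (y t) z.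
Proof.
move=> FG uU cy yOm tT Uz Gt uz Gs; have [cphi _ _ _ _] := reg.
have Dt : (`[0, T] `*` Om `*` U)%classic (t, y t, z).
  by split => //; split; [rewrite /= in_itv|exact: yOm].
apply: (within_cvg (g := fun s => (s, y s, u s)) cphi Dt).
  apply: cvg_pair_to => //; apply: cvg_pair_to => //.
  by apply: cvg_comp Gt _; exact: cy.
by apply: filterS Gs => s sT; split; [split; [rewrite /= in_itv|exact: yOm]|exact: uU].
Qed.

Lemma regular_dF_lim u t z (G : set_system R) : Filter G ->
  (forall t, 0 <= t <= T -> U (u t)) -> 0 <= t <= T -> U z -> G --> t -> u @ G --> z ->
  (\forall s \near G, 0 <= s <= T) ->
  (fun s => dF (fun y => phi s y (u s)) (x0 s)) @ G --> dF (fun y => phi t y z) (x0 t).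
Proof.
move=> FG uU tT Uz Gt uz Gs; have [_ _ _ cdF _] := reg.
have Dt : (`[0, T] `*` U)%classic (t, z) by split => //; rewrite /= in_itv.
apply: (within_cvg (g := fun s => (s, u s)) cdF Dt); first exact: cvg_pair_to.
by apply: filterS Gs => s sT; split; [rewrite /= in_itv|exact: uU].
Qed.

Lemma regular_dF_regulated u : regulated T U u ->
  regulated T setT (fun t => dF (fun y => phi t y (u t)) (x0 t)).
Proof.
move=> ru; have [uU _ _ _ _] := ru.
apply: (regulated_comp (psi := fun t z => dF (fun y => phi t y z) (x0 t)) T0 ru)
  => t z G FG tT Uz Gt uz Gs.
exact: regular_dF_lim.
Qed.

Lemma regular_dF_expansion t z e : 0 <= t <= T -> U z -> 0 < e ->
  exists2 d, 0 < d & forall k, `|k| <= d ->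
  `|phi t (X0 t + k) z - phi t (X0 t) z - dF (fun y => phi t y z) (x0 t) k| <= e * `|k|.
Proof.
move=> tT Uz e0; have [_ _ diff _ _] := reg.
have dx : differentiable (fun y => phi t y z) (x0 t) by apply: diff => //; rewrite in_itv.
by have [d d0 Hd] := dF_expansion dx e0; exists d => // k kd; rewrite X0E//; exact: Hd.
Qed.

Section CompactControls.
Variable M : set V.
Hypotheses (cM : compact M) (M0 : M !=set0) (MU : M `<=` U).

(* A sequence of states converging to [X0 s], together with its limit, is a compact set,
   on which the Gateaux differentials are bounded by assumption. *)
Let dG_bound_at s : 0 <= s <= T -> exists n : nat, forall t xi z, 0 <= t <= T -> M z ->
  `|xi - X0 s| < n.+1%:R^-1 ->
  Om xi /\ opnorm (dG (fun y => phi t y z) xi) <= n%:R.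
Proof.
move=> sT; apply: contrapT => Hn.
have [d /= d0 dOm] : nbhs_ball (X0 s) Om.
  by apply/nbhs_ballP; apply: open_nbhs_nbhs; split => //; exact: X0Om.
have [N _ HN] := near_infty_natSinv_lt (PosNum d0).
have /choice[w Hw] : forall n : nat, exists w : R * E * V, [/\ 0 <= w.1.1 <= T, M w.2,
    `|w.1.2 - X0 s| < n.+1%:R^-1, Om w.1.2 &
    n%:R < opnorm (dG (fun y => phi w.1.1 y w.2) w.1.2)].
  move=> n; apply: contrapT => Hw; apply: Hn; exists (maxn n N) => t xi z tT Mz xis.
  have le1 k : (k <= maxn n N)%N -> (maxn n N).+1%:R^-1 <= k.+1%:R^-1 :> R.
    by move=> h; rewrite lef_pV2 ?posrE// ler_nat.
  have Oxi : Om xi.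
    apply: dOm; rewrite -ball_normE /= distrC; apply: lt_trans (HN N (leqnn N)).
    by apply: lt_le_trans xis (le1 _ _); rewrite leq_maxr.
  split => //; rewrite leNgt; apply/negP => h; apply: Hw; exists (t, xi, z); split => //=.
    by apply: lt_le_trans xis (le1 _ _); rewrite leq_maxl.
  by apply: le_lt_trans h; rewrite ler_nat leq_maxl.
have xil : (fun n => (w n).1.2) @ \oo --> X0 s.
  apply/cvgrPdist_lt => e e0; near=> n; rewrite distrC.
  have [_ _ h _ _] := Hw n; apply: lt_trans h _.
  by near: n; exact: (near_infty_natSinv_lt (PosNum e0)).
have := compact_cvg_range xil; set K := _ `|` _ => cK.
have [_ _ _ _ bnd] := reg.
have KOm : K `<=` Om by move=> _ [->|[n _ <-]]; [exact: X0Om|case: (Hw n)].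
have K0 : K !=set0 by exists (X0 s); left.
have := bnd K M cK K0 KOm cM M0 MU.
set S := [set _ | _ in _] => supS.
have wS n : ((opnorm (dG (fun y => phi (w n).1.1 y (w n).2) (w n).1.2))%:E <= ereal_sup S)%E.
  apply: ereal_sup_ubound; exists (w n) => //.
  have [h1 h2 _ _ _] := Hw n; split => //; split; first by rewrite /= in_itv.
  by right; exists n.
case E1 : (ereal_sup S) supS => [r| |] // _; last by have := wS 0%N; rewrite E1.
have [n rn] : exists n : nat, r < n%:R.
  by exists (Num.bound `|r|); apply: le_lt_trans (ler_norm _) (archi_boundP (normr_ge0 r)).
have [_ _ _ _ h] := Hw n; have := wS n; rewrite E1 lee_fin leNgt => /negP; apply.
exact: lt_trans rn h.
Unshelve. all: by end_near. Qed.

(** A single integer encodes both the radius and the bound on the differentials, and it can only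
    improve when it grows; compactness of [[0, T]] therefore yields one that fits all times.
    Convexity of balls turns the bound into a Lipschitz estimate. *)
Lemma regular_lipschitz :
  exists d L, [/\ 0 < d, 0 < L & forall t s xi eta z, 0 <= t <= T -> 0 <= s <= T ->
    `|xi - X0 s| < d -> `|eta - X0 s| < d -> M z ->
    [/\ Om xi, Om eta & `|phi t xi z - phi t eta z| <= L * `|xi - eta|]].
Proof.
pose Q (n : nat) s := forall t xi z, 0 <= t <= T -> M z ->
  `|xi - X0 s| < n.+1%:R^-1 ->
  Om xi /\ opnorm (dG (fun y => phi t y z) xi) <= n%:R.
have [N _ HN] : \forall n \near \oo, `[0, T]%classic `<=` Q n.
  have /compact_near_coveringP := @segment_compact R 0 T; apply.
  move=> s /=; rewrite in_itv/= => sT.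
  have [n0 Hn0] := dG_bound_at sT.
  have n00 : 0 < n0.+1%:R^-1 / 2 :> R by rewrite divr_gt0// invr_gt0.
  have /cvgrPdist_lt /(_ _ n00) nX := @cX0 s.
  near=> s' n => t xi z tT Mz xis.
  have n0n : (n0 <= n)%N by near: n; exact: nbhs_infty_ge.
  have Xs : `|X0 s - X0 s'| < n0.+1%:R^-1 / 2 by near: s'.
  have nn : n.+1%:R^-1 < n0.+1%:R^-1 / 2 :> R.
    by near: n; exact: (near_infty_natSinv_lt (PosNum n00)).
  have [|Oxi dG] := Hn0 t xi z tT Mz.
    rewrite (_ : xi - X0 s = (xi - X0 s') - (X0 s - X0 s')); last by module R.
    apply: le_lt_trans (ler_normB _ _) _.
    move: xis Xs nn; set A := `|_|; set B := `|_|; set a := n.+1%:R^-1; set b := n0.+1%:R^-1.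
    by clearbody A B a b; lra.
  by split => //; apply: le_trans dG _; rewrite ler_nat.
exists N.+1%:R^-1, (N%:R + 1); split => //.
move=> t s xi eta z tT sT xis etas Mz.
have sT' : `[0, T]%classic s by rewrite /= in_itv.
have HQ := HN N (leqnn N) s sT' t _ z tT Mz.
have [Oxi _] := HQ _ xis; have [Oeta _] := HQ _ etas; split => //.
apply: (@gateaux_lipschitz _ _ _ (fun y => phi t y z) eta xi) => r /andP[r0 r1].
have near_ : `|eta + r *: (xi - eta) - X0 s| < N.+1%:R^-1.
  rewrite (_ : _ - _ = r *: (xi - X0 s) + (1 - r) *: (eta - X0 s)); last by module R.
  apply: le_lt_trans (ler_normD _ _) _; rewrite !normrZ !ger0_norm ?subr_ge0//.
  move: xis etas; set A := `|_|; set B := `|_|; set C := _^-1 => AC BC.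
  rewrite (_ : C = r * C + (1 - r) * C); last by ring.
  have [->|r_gt0] := eqVneq r 0; first by rewrite !mul0r !add0r subr0 !mul1r.
  apply: ltr_leD; first by rewrite ltr_pM2l// lt_def r_gt0.
  by rewrite ler_wpM2l ?subr_ge0// ltW.
have [Or dGr] := HQ _ near_; split; first exact: regular_continuous (MU Mz).
have [_ gat _ _ _] := reg.
exists (dG (fun y => phi t y z) (eta + r *: (xi - eta))).
  by apply: dG_gateaux; apply: gat => //; exact: MU.
by apply: le_trans dGr _; rewrite lerDl.
Unshelve. all: by end_near. Qed.

End CompactControls.

End RegularAlong.

Section Retraction.
Context {R : realType} {E : normedModType R}.
Implicit Types (r : R) (v w : E).

Definition retract r v : E := if `|v| <= r then v else (r / `|v|) *: v.

Lemma retract_id r v : `|v| <= r -> retract r v = v.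
Proof. by rewrite /retract => ->. Qed.

Lemma retract_norm r v : 0 <= r -> `|retract r v| <= r.
Proof.
move=> r0; rewrite /retract; case: ifPn => //; rewrite -ltNge => rv.
have v0 : 0 < `|v| by exact: le_lt_trans rv.
by rewrite normrZ normrM normfV normr_id ger0_norm// divfK// gt_eqF.
Qed.

(** The difference splits into a contracted copy of [v - w] and a change of scaling factor along
    [w], each of norm at most [|v - w|]. In a general normed space the two must be added, whence the
    constant 2. *)
Lemma retract_lip r v w : 0 < r -> `|retract r v - retract r w| <= 2 * `|v - w|.
Proof.
move=> r0; wlog wv : v w / `|w| <= `|v|.
  move=> H; have [|/ltW] := leP `|w| `|v|; first exact: H.
  by move=> vw; rewrite distrC (distrC v); exact: H.
have vw : `|v| - `|w| <= `|v - w| by exact: lerB_dist.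
rewrite /retract; case: ifPn => [vr|].
  by rewrite (le_trans wv vr) mulr_natl mulr2n lerDl.
rewrite -ltNge => rv; have v0 : 0 < `|v| by exact: lt_trans rv.
have k1 : `|r / `|v| *: (v - w)| <= `|v - w|.
  rewrite normrZ ger0_norm ?divr_ge0 ?(ltW r0)// ler_piMl// ler_pdivrMr// mul1r.
  exact: ltW.
rewrite mulr_natl mulr2n.
case: ifPn => [wr|].
  rewrite (_ : _ - _ = (r / `|v|) *: (v - w) - (1 - r / `|v|) *: w); last by module R.
  apply: le_trans (ler_normB _ _) _; apply: lerD => //.
  rewrite normrZ ger0_norm ?subr_ge0 ?ler_pdivrMr ?mul1r ?(ltW rv)//.
  apply: le_trans vw.
  rewrite -(ler_pM2r v0) (_ : (1 - r / `|v|) * `|w| * `|v| = (`|v| - r) * `|w|); last by field; rewrite gt_eqF.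
  apply: ler_pM => //; first by rewrite subr_ge0 ltW.
  by rewrite lerD2l lerN2.
rewrite -ltNge => rw; have w0 : 0 < `|w| by exact: lt_trans rw.
rewrite (_ : _ - _ = (r / `|v|) *: (v - w) - (r / `|w| - r / `|v|) *: w); last by module R.
apply: le_trans (ler_normB _ _) _; apply: lerD => //.
rewrite normrZ ger0_norm; last first.
  by rewrite subr_ge0 ler_pM2l// lef_pV2 ?posrE.
apply: le_trans vw.
rewrite -(ler_pM2r v0) (_ : (r / `|w| - r / `|v|) * `|w| * `|v| = (`|v| - `|w|) * r); last by field; rewrite !gt_eqF.
by rewrite ler_wpM2l ?subr_ge0// ltW.
Qed.

Lemma retract_continuous r : 0 < r -> continuous (retract r).
Proof.
move=> r0 v; apply/cvgrPdist_le => e e0.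
have e2 : 0 < e / 2 by rewrite divr_gt0.
have : \forall w \near v, `|v - w| <= e / 2 by apply: (cvgrPdist_le _ _).1 e2; exact: cvg_id.
apply: filterS => w vw; apply: le_trans (retract_lip _ _ r0) _; lra.
Qed.

End Retraction.

Section ProductsAndRows.
Context {R : realType}.

Lemma pair_norm_le {E F : normedModType R} (x : E) (y : F) c :
  `|x| <= c -> `|y| <= c -> `|(x, y)| <= c.
Proof. by move=> xc yc; rewrite prod_normE /= ge_max xc. Qed.

Lemma fst_norm_le {E F : normedModType R} (z : E * F) : `|z.1| <= `|z|.
Proof. by rewrite [leRHS]prod_normE le_max lexx. Qed.

Lemma snd_norm_le {E F : normedModType R} (z : E * F) : `|z.2| <= `|z|.
Proof. by rewrite [leRHS]prod_normE le_max lexx orbT. Qed.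

Lemma rderiv_fst {E F : normedModType R} (y : R -> E * F) t v :
  rderiv y t v -> rderiv (fun s => (y s).1) t v.1.
Proof.
move=> yv e e0; apply: filterS (yv e e0) => s; apply: le_trans.
exact: (fst_norm_le (y s - y t - (s - t) *: v)).
Qed.

Lemma rderiv_snd {E F : normedModType R} (y : R -> E * F) t v :
  rderiv y t v -> rderiv (fun s => (y s).2) t v.2.
Proof.
move=> yv e e0; apply: filterS (yv e e0) => s; apply: le_trans.
exact: (snd_norm_le (y s - y t - (s - t) *: v)).
Qed.

Lemma rderiv_pair {E F : normedModType R} (y : R -> E) (z : R -> F) t v w :
  rderiv y t v -> rderiv z t w -> rderiv (fun s => (y s, z s)) t (v, w).
Proof.
move=> yv zw e e0; apply: filterS2 (yv e e0) (zw e e0) => s h1 h2.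
exact: pair_norm_le.
Qed.

Lemma rderiv_coord {l : nat} (y : R -> 'rV[R]_l) t v i :
  rderiv y t v -> rderiv (fun s => y s 0 i : R^o) t (v 0 i).
Proof.
move=> yv e e0; apply: filterS (yv e e0) => s; apply: le_trans.
have := rV_coord_le (y s - y t - (s - t) *: v) i; apply: le_trans.
by rewrite !mxE.
Qed.

Lemma cvg_row {l : nat} {I : Type} (G : set_system I) {FG : Filter G}
  (f : 'I_l -> I -> R) (a : 'I_l -> R) :
  (forall i, f i @ G --> a i) -> (fun x => \row_i f i x) @ G --> \row_i a i.
Proof.
move=> fa; have H : (fun x => \sum_i f i x *: (delta_mx 0 i : 'rV[R]_l)) @ G -->
    \sum_i a i *: (delta_mx 0 i : 'rV[R]_l).
  by apply: cvg_sumr => i; apply: cvgZr_tmp; exact: fa.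
have E (b : 'I_l -> R) : \row_i b i = \sum_i b i *: (delta_mx 0 i : 'rV[R]_l).
  by rewrite [LHS]row_sum_delta; apply: eq_bigr => i _; rewrite mxE.
by rewrite E; under eq_fun do rewrite E.
Qed.

Lemma geom_complete_prod {E F : normedModType R} :
  geom_complete E -> geom_complete F -> geom_complete (E * F)%type.
Proof.
move=> cE cF y C yC.
have [|a ya] := cE (fun n => (y n).1) C.
  by move=> n; apply: le_trans (yC n); exact: (fst_norm_le (y n.+1 - y n)).
have [|b yb] := cF (fun n => (y n).2) C.
  by move=> n; apply: le_trans (yC n); exact: (snd_norm_le (y n.+1 - y n)).
exists (a, b).
have -> : y = (fun n => ((y n).1, (y n).2)) by apply/funext => n; case: (y n).
exact: cvg_pair ya yb.
Qed.

(** The pointwise limit is linear, and the tail estimate, uniform on the unit ball, gives both its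
    boundedness and the convergence in operator norm. *)
Lemma geom_complete_blin {E F : normedModType R} : geom_complete F -> geom_complete (blin E F).
Proof.
move=> cF y C yC.
have yx n x : `|y n.+1 x - y n x| <= C * `|x| / 2 ^+ n.
  apply: le_trans (le_opnorm (y n.+1 - y n) x) _.
  by rewrite mulrAC; apply: ler_wpM2r => //; exact: yC.
have /choice[g Hg] : forall x, exists a : F, (fun n => y n x) @ \oo --> a.
  by move=> x; apply: (cF _ (C * `|x|)) => n; exact: yx.
have gl : linear g.
  move=> a u v; apply/esym; apply: (cvg_unique _ _ (Hg (a *: u + v))) => //.
  have -> : (fun n => y n (a *: u + v)) = (fun n => a *: y n u + y n v).
    by apply/funext => n; exact: blin_linear.
  by apply: cvgD => //; apply: cvgZl_tmp.
have gy n x : `|g x - y n x| <= 2 * (C * `|x|) / 2 ^+ n.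
  by apply: (@geom_tail _ _ (fun n => y n x)) => // k; exact: yx.
pose K := 2 * C + `|y 0%N|.
have C0 : 0 <= C by have := yC 0%N; rewrite expr0 divr1; exact: le_trans.
have gK x : `|g x| <= K * `|x|.
  rewrite -[g x](subrK (y 0%N x)); apply: le_trans (ler_normD _ _) _.
  rewrite /K mulrDl; apply: lerD; last exact: le_opnorm.
  by have := gy 0%N x; rewrite expr0 divr1 mulrA.
have gc : continuous g.
  move=> x; apply/cvgrPdist_le => e e0.
  have K1 : 0 < K + 1 by rewrite ltr_wpDl// addr_ge0 ?mulr_ge0.
  have : \forall z \near x, `|x - z| <= e / (K + 1).
    by apply: (cvgrPdist_le _ _).1; [exact: cvg_id|rewrite divr_gt0].
  apply: filterS => z xz.
  have -> : g x - g z = g (x - z).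
    by have := gl (-1) z x; rewrite !scaleN1r => /esym; rewrite addrC => ->; rewrite addrC.
  apply: le_trans (gK _) _; apply: (@le_trans _ _ ((K + 1) * `|x - z|)).
    by rewrite ler_wpM2r// lerDl.
  by rewrite mulrC -ler_pdivlMr.
have gb : g \in bounded_linear by apply/mem_set.
exists (BLin gb); apply/cvgrPdist_le => e e0.
have [n Hn] := geom_small (2 * C) e0.
exists n => // k /= nk.
apply: opnorm_le => x x1.
apply: le_trans (gy k x) _.
apply: le_trans Hn.
apply: (@le_trans _ _ (2 * C / 2 ^+ k)).
  apply: ler_wpM2r; first by rewrite invr_ge0 exprn_ge0.
  by rewrite ler_pM2l// ler_piMr.
apply: ler_wpM2l; first by rewrite mulr_ge0.
by rewrite lef_pV2 ?posrE ?exprn_gt0// ler_weXn2l// ler1n.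
Qed.

Lemma cvg_blin_eval {E F : normedModType R} {I : Type} (G : set_system I) {FG : Filter G}
  (D : I -> blin E F) (y : I -> E) (D' : blin E F) (y' : E) :
  D @ G --> D' -> y @ G --> y' -> (fun i => D i (y i)) @ G --> D' y'.
Proof.
move=> DD yy.
have h1 : (fun i => D' (y i)) @ G --> D' y'.
  by apply: cvg_comp yy _; exact: blin_continuous.
have h2 : (fun i => (D i - D') (y i)) @ G --> (0 : F).
  apply/cvgr0Pnorm_le => e e0.
  have h3 : (fun i => `|D i - D'| * `|y i|) @ G --> `|D' - D'| * `|y'|.
    by apply: cvgM; apply: cvg_norm => //; apply: cvgB => //; exact: cvg_cst.
  move: h3; rewrite subrr normr0 mul0r => /cvgrPdist_le /(_ e e0); apply: filterS => i.
  rewrite sub0r normrN normrM !normr_id; apply: le_trans; exact: le_opnorm.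
rewrite -[D' y']add0r.
have -> : (fun i => D i (y i)) = (fun i => (D i - D') (y i) + D' (y i)).
  by apply/funext => i /=; rewrite subrK.
exact: cvgD.
Qed.

End ProductsAndRows.

Section Spikes.
Context {R : realType} {Y : topologicalType}.

(** The spike lives on a half-open interval, which preserves right continuity, and ends before [T],
    which preserves the equality of the control at [T] with its left limit. *)
Lemma spike_regulated (T : R) (U : set Y) (u : R -> Y) s e z : regulated T U u -> U z ->
  0 <= s -> s <= e -> e < T -> regulated T U (spike s e z u).
Proof.
move=> [uU ur ul uT [D uD]] Uz s0 se eT.
have right t : \forall r \near t^'+, (s <= r < e) = (s <= t < e).
  have [ts|st] := ltP t s.
    near=> r; have -> : (s <= r) = false; last by [].
    by apply/negbTE; rewrite -ltNge; near: r; exact: nbhs_right_lt.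
  have [te|et] := ltP t e; near=> r; have tr : t < r by near: r; exact: nbhs_right_gt.
    rewrite (le_trans st (ltW tr))/=; near: r; exact: nbhs_right_lt.
  by rewrite andbF ltNge (le_trans et (ltW tr)) andbF.
have left t : (\forall r \near t^'-, s <= r < e) \/ (\forall r \near t^'-, (s <= r < e) = false).
  have [ts|st] := leP t s.
    right; near=> r; have -> : (s <= r) = false; last by [].
    apply/negbTE; rewrite -ltNge; apply: lt_le_trans ts; near: r; exact: nbhs_left_lt.
  have [te|et] := leP t e; [left|right]; near=> r; have rt : r < t by near: r; exact: nbhs_left_lt.
    rewrite (lt_le_trans rt te) andbT; apply: ltW; near: r; exact: nbhs_left_gt.
  apply/negbTE; rewrite negb_and -(leNgt e r); apply/orP; right; apply: ltW.
  by near: r; exact: nbhs_left_gt.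
split.
- by move=> t tT; rewrite /spike; case: ifP => // _; exact: uU.
- move=> t tT; rewrite /(spike _ _ _ _ t); case: ifP => h.
    by apply: cvg_near_cst; apply: filterS (right t) => r; rewrite /spike h => ->.
  apply: cvg_trans (ur t tT); apply: near_eq_cvg.
  by apply: filterS (right t) => r; rewrite /spike h => ->.
- move=> t tT; case: (left t) => h.
    by exists z => //; apply: cvg_near_cst; apply: filterS h => r; rewrite /spike => ->.
  have [a Ua ua] := ul t tT; exists a => //.
  apply: cvg_trans ua; apply: near_eq_cvg.
  by apply: filterS h => r; rewrite /spike => ->.
- have -> : spike s e z u T = u T by rewrite /spike ltNge (ltW eT) andbF.
  apply: cvg_trans uT; apply: near_eq_cvg; near=> r.
  rewrite /spike [r < e]ltNge.
  have -> : e <= r by apply: ltW; near: r; exact: nbhs_left_gt.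
  by rewrite andbF.
- exists (s :: e :: D) => t tT; rewrite !inE !negb_or => /and3P[ts te tD].
  have const : \forall r \near t, (s <= r < e) = (s <= t < e).
    have h1 : \forall r \near t, (s <= r) = (s <= t).
      have [st|st] := ltP s t.
        have : \forall r \near t, r \in `]s, (t + 1)[.
          by apply: near_in_itvoo; rewrite in_itv/= st ltrDl ltr01.
        by apply: filterS => r; rewrite in_itv/= => /andP[/ltW -> _]; rewrite ltW.
      have st' : t < s by rewrite lt_neqAle ts.
      have : \forall r \near t, r \in `](t - 1), s[.
        by apply: near_in_itvoo; rewrite in_itv/= st' andbT ltrBlDr ltrDl ltr01.
      by apply: filterS => r; rewrite in_itv/= => /andP[_ rs]; rewrite !leNgt rs st'.
    have h2 : \forall r \near t, (r < e) = (t < e).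
      have [et|et] := ltP t e.
        have : \forall r \near t, r \in `](t - 1), e[.
          by apply: near_in_itvoo; rewrite in_itv/= et andbT ltrBlDr ltrDl ltr01.
        by apply: filterS => r; rewrite in_itv/= => /andP[_ ->].
      have et' : e < t by rewrite lt_neqAle eq_sym te.
      have : \forall r \near t, r \in `]e, (t + 1)[.
        by apply: near_in_itvoo; rewrite in_itv/= et' ltrDl ltr01.
      by apply: filterS => r; rewrite in_itv/= => /andP[/ltW er _]; rewrite !ltNge er.
    by apply: filterS2 h1 h2 => r -> ->.
  rewrite /(spike _ _ _ _ t); case: ifP => h.
    by apply: cvg_near_cst; apply: filterS const => r; rewrite /spike h => ->.
  apply: cvg_trans (uD t tT tD); apply: near_eq_cvg.
  by apply: filterS const => r; rewrite /spike h => ->.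
Unshelve. all: by end_near. Qed.

Lemma cst_regulated (T : R) (U : set Y) z : U z -> regulated T U (fun=> z).
Proof.
move=> Uz; split => //; try by move=> *; exact: cvg_cst.
- by move=> t _; exists z => //; exact: cvg_cst.
- by exists [::] => t _ _; exact: cvg_cst.
Qed.

End Spikes.

(** * The Bolza problem as an augmented system *)

Lemma finite_common_radius {R : realType} (I : finType) (Q : I -> R -> Prop) :
  (forall i d d', 0 < d' -> d' <= d -> Q i d -> Q i d') -> (forall i, exists2 d, 0 < d & Q i d) ->
  exists2 d, 0 < d & forall i, Q i d.
Proof.
move=> mono H; suff [d d0 Hd] : exists2 d, 0 < d & forall i, i \in enum I -> Q i d.
  by exists d => // i; apply: Hd; rewrite mem_enum.
elim: (enum I) => [|i s [d d0 Hd]]; first by exists 1.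
have [d' d'0 Hd'] := H i; exists (Num.min d d'); first by rewrite lt_min d0.
have m0 : 0 < Num.min d d' by rewrite lt_min d0.
move=> j; rewrite inE => /predU1P[->|js]; first by apply: mono Hd'; rewrite // ge_min lexx orbT.
by apply: mono (Hd j js); rewrite // ge_min lexx.
Qed.

Lemma geom_complete_rV {R : realType} {l : nat} : geom_complete 'rV[R]_l.
Proof.
move=> y C H; have /choice[c Hc] : forall i, exists c : R^o, (fun n => y n 0 i : R^o) @ \oo --> c.
  move=> i; apply: (@geom_complete_complete R R^o _ C) => n.
  by apply: le_trans (H n); have := rV_coord_le (y n.+1 - y n) i; rewrite !mxE.
exists (\row_i c i); rewrite (_ : y = fun n => \row_i y n 0 i); first exact: cvg_row.
by apply/funext => n; apply/rowP => i; rewrite mxE.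
Qed.

Section AugmentedSystem.
Context {R : realType} {E : completeNormedModType R} {Y : normedModType R}.
Context {l m q : nat} (P : bolza E Y l m q) (x0 : R -> E) (u0 : R -> Y).
Local Notation T := (horizon P).
Local Notation U := (control_set P).
Local Notation Om := (state_domain P).
Local Notation f := (dynamics P).
Local Notation f0 := (running_payoff P).
Hypotheses (T0 : 0 < T) (oOm : open Om) (adm : admissible P x0 u0).
Hypotheses (rf0 : forall i, regular_along P x0 (f0 i)) (rf : regular_along P x0 f).

Local Notation F := (E * 'rV[R]_l)%type.

(* The running payoffs are integrated along with the state. *)
Definition aug_field (t : R) (x : E) (z : Y) : F := (f t x z, \row_i f0 i t x z).

(** The accumulated payoffs do not feed back into the system, so only the state component [x.1]
    enters the linearisation. *)
Definition aug_lin (t : R) (x : F) : F :=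
  (dF (fun y => f t y (u0 t)) (x0 t) x.1, \row_i dF (fun y => f0 i t y (u0 t)) (x0 t) x.1).

Let X0 := x0 \o clamp 0 T.

Lemma aug_u0 : regulated T U u0.
Proof. by case: adm => _ /NPC0_regulated. Qed.

Lemma aug_cX0 : continuous X0.
Proof. by case: adm => -[cx _ _] _ _ _; exact: continuous_clamp_comp. Qed.

Lemma aug_X0E t : 0 <= t <= T -> X0 t = x0 t.
Proof. by move=> tT; rewrite /X0 /= clampE. Qed.

Lemma aug_X0Om t : 0 <= t <= T -> Om (X0 t).
Proof. by move=> tT; rewrite aug_X0E//; have [[_ _ xOm] _ _ _] := adm; apply: xOm; rewrite in_itv. Qed.

Let tT' t : 0 <= t < T -> 0 <= t <= T. Proof. by case/andP => -> /ltW ->. Qed.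

Lemma aug_lim (y : R -> E) u t z (G : set_system R) : Filter G ->
  (forall t, 0 <= t <= T -> U (u t)) -> continuous y ->
  (forall t, 0 <= t <= T -> Om (y t)) -> 0 <= t <= T -> U z -> G --> t -> u @ G --> z ->
  (\forall s \near G, 0 <= s <= T) ->
  (fun s => aug_field s (y s) (u s)) @ G --> aug_field t (y t) z.
Proof.
move=> FG uU cy yOm tT Uz Gt uz Gs; apply: cvg_pair_to.
  exact: (regular_lim rf).
by apply: cvg_row => i; exact: (regular_lim (rf0 i)).
Qed.

Lemma aug_regulated (y : R -> E) u : regulated T U u -> continuous y ->
  (forall t, 0 <= t <= T -> Om (y t)) -> regulated T setT (fun t => aug_field t (y t) (u t)).
Proof.
move=> ru cy yOm; have [uU _ _ _ _] := ru.
apply: (regulated_comp (psi := fun t z => aug_field t (y t) z) T0 ru) => t z G FG tT Uz Gt uz Gs.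
exact: aug_lim.
Qed.

Lemma aug_lin_cadlag (y : R -> F) : continuous y -> cadlag 0 T (fun t => aug_lin t (y t)).
Proof.
move=> cy; apply: (@regulated_cadlag _ _ _ setT).
pose psi t z : F := (dF (fun x => f t x z) (x0 t) (y t).1,
   \row_i dF (fun x => f0 i t x z) (x0 t) (y t).1).
apply: (regulated_comp (psi := psi) T0 aug_u0) => t z G FG tT Uz Gt uz Gs.
have [uU _ _ _ _] := aug_u0.
have y1 : (fun s => (y s).1) @ G --> (y t).1.
  apply: (@cvg_comp _ _ _ y fst _ (nbhs (y t))); last exact: cvg_fst.
  by apply: cvg_comp Gt _; exact: cy.
apply: cvg_pair_to.
  by apply: cvg_blin_eval => //; exact: (regular_dF_lim rf).
by apply: cvg_row => i; apply: cvg_blin_eval => //; exact: (regular_dF_lim (rf0 i)).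
Qed.

Lemma aug_linB t x y : aug_lin t (x - y) = aug_lin t x - aug_lin t y.
Proof.
rewrite /aug_lin /= linearB; congr (_, _); apply/rowP => i.
by rewrite !mxE linearB.
Qed.

Lemma aug_linZ t c x : aug_lin t (c *: x) = c *: aug_lin t x.
Proof.
rewrite /aug_lin /= linearZ; congr (_, _); apply/rowP => i.
by rewrite !mxE linearZ.
Qed.

Lemma aug_lin_le : exists2 K, 0 < K & forall t x, 0 <= t < T -> `|aug_lin t x| <= K * `|x|.
Proof.
have [K0 K00 HK0] := cadlag_bounded (ltW T0) (regulated_cadlag (regular_dF_regulated T0 rf aug_u0)).
(* The bounds are written [d^-1], so that a common radius for all [i] is a common bound. *)
have [d d0 Hd] : exists2 d, 0 < d & forall i, forall t, 0 <= t <= T ->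
    `|dF (fun y => f0 i t y (u0 t)) (x0 t)| <= d^-1.
  apply: finite_common_radius => [i d d' d'0 dd' H t tT|i].
    by apply: le_trans (H t tT) _; rewrite lef_pV2 ?posrE// (lt_le_trans d'0).
  have [K1 K10 HK1] := cadlag_bounded (ltW T0) (regulated_cadlag (regular_dF_regulated T0 (rf0 i) aug_u0)).
  exists (K1 + 1)^-1; first by rewrite invr_gt0 ltr_wpDl.
  by move=> t tT; rewrite invrK; apply: le_trans (HK1 t tT) _; rewrite lerDl.
exists (K0 + d^-1); first by rewrite ltr_wpDl// invr_gt0.
move=> t x tT; apply: pair_norm_le.
  apply: le_trans (le_opnorm _ _) _; apply: ler_pM => //; first exact: opnorm_ge0.
    apply: le_trans (HK0 t (tT' tT)) _; rewrite lerDl invr_ge0; exact: ltW.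
  exact: fst_norm_le.
apply: rV_norm_le => [|i]; first by rewrite mulr_ge0// addr_ge0// invr_ge0 ltW.
rewrite mxE; apply: le_trans (le_opnorm _ _) _; apply: ler_pM => //; first exact: opnorm_ge0.
  by apply: le_trans (Hd i t (tT' tT)) _; rewrite lerDr.
exact: fst_norm_le.
Qed.

Lemma aug_cost : exists c : R -> 'rV[R]_l, [/\ continuous c, c 0 = 0 &
  forall t, 0 <= t < T -> rderiv c t (\row_i f0 i t (X0 t) (u0 t))].
Proof.
apply: cadlag_primitive (ltW T0) _; first exact: geom_complete_rV.
apply: (@regulated_cadlag _ _ _ setT).
have [uU _ _ _ _] := aug_u0.
apply: (regulated_comp (psi := fun t z => \row_i f0 i t (X0 t) z) T0 aug_u0) => t z G FG tT Uz Gt uz Gs.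
by apply: cvg_row => i; apply: (regular_lim (rf0 i)) => //; [exact: aug_cX0|exact: aug_X0Om].
Qed.

(** One number gives the radius [r] and the Lipschitz constant [r^-1]; both estimates survive when
    it decreases, so the minimum over all components works. *)
Lemma aug_tube M : compact M -> M !=set0 -> M `<=` U ->
  exists2 r, 0 < r & forall t xi eta z, 0 <= t <= T -> M z ->
  `|xi - X0 t| <= r -> `|eta - X0 t| <= r ->
  Om xi /\ `|aug_field t xi z - aug_field t eta z| <= r^-1 * `|xi - eta|.
Proof.
move=> cM M0 MU.
pose lip (G : normedModType R) (phi : R -> E -> Y -> G) r := forall t xi eta z, 0 <= t <= T -> M z ->
  `|xi - X0 t| <= r -> `|eta - X0 t| <= r ->
  Om xi /\ `|phi t xi z - phi t eta z| <= r^-1 * `|xi - eta|.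
have mono G phi d d' : 0 < d' -> d' <= d -> lip G phi d -> lip G phi d'.
  move=> d'0 dd' H t xi eta z tT Mz h1 h2.
  have [Ox h] := H t xi eta z tT Mz (le_trans h1 dd') (le_trans h2 dd').
  split => //; apply: le_trans h _; rewrite ler_wpM2r// lef_pV2 ?posrE//.
  exact: lt_le_trans dd'.
have ex G phi : regular_along P x0 phi -> exists2 r, 0 < r & lip G phi r.
  move=> rphi.
  have [d [L [d0 L0 H]]] := regular_lipschitz oOm aug_cX0 aug_X0Om rphi cM M0 MU.
  exists (Num.min (d / 2) L^-1); first by rewrite lt_min divr_gt0//= invr_gt0.
  move=> t xi eta z tT Mz h1 h2.
  have dd : Num.min (d / 2) L^-1 < d by rewrite gt_min; apply/orP; left; lra.
  have [Ox _ h] := H t t xi eta z tT tT (le_lt_trans h1 dd) (le_lt_trans h2 dd) Mz.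
  split => //; apply: le_trans h _; rewrite ler_wpM2r//.
  rewrite -[leLHS]invrK lef_pV2 ?posrE ?invr_gt0 ?lt_min ?divr_gt0 ?invr_gt0//.
  by rewrite ge_min lexx orbT.
have [r1 r10 H1] := ex _ _ rf.
have [r2 r20 H2] : exists2 r, 0 < r & forall i, lip R^o (f0 i) r.
  apply: finite_common_radius => [i d d' d'0 dd'|i]; first exact: mono.
  exact: ex (rf0 i).
have r0 : 0 < Num.min r1 r2 by rewrite lt_min r10.
have {}H1 : lip _ f (Num.min r1 r2) by apply: mono H1; rewrite // ge_min lexx.
have {}H2 i : lip R^o (f0 i) (Num.min r1 r2) by apply: mono (H2 i); rewrite // ge_min lexx orbT.
exists (Num.min r1 r2) => // t xi eta z tT Mz h1 h2.
have [Ox h] := H1 t xi eta z tT Mz h1 h2; split => //.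
apply: pair_norm_le => //; apply: rV_norm_le => [|i].
  by rewrite mulr_ge0// invr_ge0 ltW.
by rewrite !mxE; have [] := H2 i t xi eta z tT Mz h1 h2.
Qed.

Lemma aug_diff t e : 0 <= t < T -> 0 < e -> exists2 d, 0 < d & forall k : F, `|k| <= d ->
  `|aug_field t (X0 t + k.1) (u0 t) - aug_field t (X0 t) (u0 t) - aug_lin t k| <= e * `|k|.
Proof.
move=> tT e0; have [uU _ _ _ _] := aug_u0; have Ut := uU t (tT' tT).
have [d1 d10 H1] := regular_dF_expansion aug_X0E rf (tT' tT) Ut e0.
have [d2 d20 H2] : exists2 d, 0 < d & forall i, forall k, `|k| <= d ->
    `|f0 i t (X0 t + k) (u0 t) - f0 i t (X0 t) (u0 t) - dF (fun y => f0 i t y (u0 t)) (x0 t) k| <= e * `|k|.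
  apply: finite_common_radius => [i d d' d'0 dd' H k kd|i]; first by apply: H; exact: le_trans dd'.
  have [d d0 H] := regular_dF_expansion aug_X0E (rf0 i) (tT' tT) Ut e0.
  by exists d.
exists (Num.min d1 d2); first by rewrite lt_min d10.
move=> k; rewrite le_min => /andP[k1 k2].
have kk : e * `|k.1| <= e * `|k| by rewrite ler_pM2l//; exact: fst_norm_le.
apply: pair_norm_le.
  by apply: le_trans (H1 k.1 _) kk; apply: le_trans (fst_norm_le _) k1.
apply: rV_norm_le => [|i]; first by rewrite mulr_ge0// ltW.
rewrite !mxE; apply: le_trans (H2 i k.1 _) kk; exact: le_trans (fst_norm_le _) k2.
Qed.

End AugmentedSystem.

Section NeedleVariationsOfBolza.
Context {R : realType} {E : completeNormedModType R} {Y : normedModType R}.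
Context {l m q : nat} (P : bolza E Y l m q) (x0 : R -> E) (u0 : R -> Y).
Local Notation T := (horizon P).
Local Notation U := (control_set P).
Local Notation Om := (state_domain P).
Local Notation f := (dynamics P).
Local Notation f0 := (running_payoff P).
Hypotheses (T0 : 0 < T) (oOm : open Om) (adm : admissible P x0 u0).
Hypotheses (rf0 : forall i, regular_along P x0 (f0 i)) (rf : regular_along P x0 f).

Local Notation F := (E * 'rV[R]_l)%type.
Local Notation aug_field := (aug_field P).
Local Notation aug_lin := (aug_lin P x0 u0).

Definition aug_end (x : R -> E) (u : R -> Y) : F :=
  (x T, \row_i \int[lebesgue_measure]_(t in `[0, T]) f0 i t (x t) (u t)).

(** The passage from equations with right derivatives back to the Bolza problem: extended
    derivatives for the state and Lebesgue integrals for the payoffs. *)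
Lemma aug_trajectory (z : R -> F) u : regulated T U u -> continuous z -> (z 0).2 = 0 ->
  (forall t, 0 <= t <= T -> Om (z t).1) ->
  (forall t, 0 <= t < T -> rderiv z t (aug_field t (z t).1 (u t))) ->
  [/\ PC1 T Om (fun t => (z t).1),
      {in `[0, T], forall t, ext_derive T (fun t => (z t).1) t = f t (z t).1 (u t)} &
      aug_end (fun t => (z t).1) u = z T].
Proof.
move=> ru cz z0 zOm dz.
have cz1 : continuous (fun t => (z t).1).
  by move=> t; apply: (@cvg_comp _ _ _ z fst _ (nbhs (z t))); [exact: cz|exact: cvg_fst].
have [uU _ _ _ _] := ru.
have dz1 t : 0 <= t < T -> rderiv (fun t => (z t).1) t (f t (z t).1 (u t)).
  by move=> tT; exact: (rderiv_fst (dz t tT)).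
have regf : regulated T setT (fun t => f t (z t).1 (u t)).
  apply: (regulated_comp (psi := fun t v => f t (z t).1 v) T0 ru) => t v G FG tT Uv Gt uv Gs.
  exact: (regular_lim rf).
split.
- exact: (rderiv_PC1 T0 cz1 regf dz1 zOm).
- by move=> t; rewrite in_itv/= => tT; exact: (rderiv_ext_derive T0 cz1 regf dz1 zOm tT).
- rewrite /aug_end [RHS]surjective_pairing; congr (_, _).
  apply/rowP => i; rewrite mxE.
  have regi : regulated T setT (fun t => f0 i t (z t).1 (u t) : R^o).
    apply: (regulated_comp (psi := fun t v => f0 i t (z t).1 v) T0 ru) => t v G FG tT Uv Gt uv Gs.
    exact: (regular_lim (rf0 i)).
  rewrite (@cadlag_Rintegral R 0 T _ (fun t => (z t).2 0 i) (ltW T0) (regulated_cadlag regi)).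
  + by rewrite z0 mxE subr0.
  + move=> t; apply: (@cvg_comp _ _ _ (fun t => (z t).2) (fun v : 'rV[R]_l => v 0 i) _ (nbhs (z t).2)).
      by apply: (@cvg_comp _ _ _ z snd _ (nbhs (z t))); [exact: cz|exact: cvg_snd].
    exact: coord_continuous.
  + move=> t tT; have := rderiv_coord i (rderiv_snd (dz t tT)).
    by rewrite mxE.
Qed.

Let X0 := x0 \o clamp 0 T.

Lemma needle_variation (S : seq (R * Y)) (y : R * Y -> R -> F) :
  sorted (fun k nu => k.1 <= nu.1) S ->
  (forall nu, nu \in S -> [/\ 0 <= nu.1 < T, U nu.2 &
     y nu nu.1 = aug_field nu.1 (x0 nu.1) nu.2 - aug_field nu.1 (x0 nu.1) (u0 nu.1)]) ->
  (forall nu, continuous (y nu)) ->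
  (forall nu t, 0 <= t < T -> rderiv (y nu) t (aug_lin t (y nu t))) ->
  exists r C (W : (R * Y -> R) -> F), [/\ 0 < r, 0 <= C,
    forall a, amplitude S r a -> exists x u,
      [/\ PC1 T Om x, NPC0 T U u, {in `[0, T], forall t, ext_derive T x t = f t (x t) (u t)},
          x 0 = initial_state P & aug_end x u = W a],
    forall a b, amplitude S r a -> amplitude S r b ->
      `|W a - W b| <= C * \sum_(nu <- S) `|a nu - b nu| &
    forall e, 0 < e -> exists2 r', 0 < r' & forall a, amplitude S r a ->
      \sum_(nu <- S) a nu <= r' ->
      `|W a - aug_end x0 u0 - \sum_(nu <- S) a nu *: y nu T| <= e * \sum_(nu <- S) a nu].
Proof.
move=> sS SP cy dy.
have ru0 := aug_u0 adm; have cX0 := aug_cX0 T0 adm.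
have X0E t : 0 <= t <= T -> X0 t = x0 t by exact: aug_X0E.
have X0Om t : 0 <= t <= T -> Om (X0 t) by exact: (aug_X0Om adm).
have TT : 0 <= T <= T by rewrite lexx ltW.
have TO : 0 <= (0 : R) <= T by apply/andP; split => //; exact: ltW.
have [M1 [cM1 M1U] M1u0] := regulated_compact_range T0 ru0.
(* The range of [u0] together with the finitely many needle values lies in one compact set, on which
   a single Lipschitz constant is available. *)
pose M := M1 `|` [set nu.2 | nu in [set` S]].
have cM : compact M by apply: compactU => //; apply: finite_compact; exact: finite_image.
have SM nu : nu \in S -> M nu.2 by move=> nuS; right; exists nu.
have MU : M `<=` U by move=> z [/M1U //|[nu /= nuS <-]]; case: (SP nu nuS).
have Mu0 t : 0 <= t <= T -> M (u0 t) by move=> tT; left; exact: M1u0.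
have M_n0 : M !=set0 by exists (u0 0); exact: Mu0.
have [r r0 tube] := aug_tube T0 oOm adm rf0 rf cM M_n0 MU.
have [K K0 HK] := aug_lin_le T0 adm rf0 rf.
have [c [cc c0 dc]] := aug_cost T0 adm rf0.
pose Z0 t : F := (X0 t, c t).
have cZ0 : continuous Z0 by move=> t; apply: cvg_pair_to; [exact: cX0|exact: cc].
(* The dynamics is Lipschitz only near x0; the radial retraction on a tube around
   x0 makes it globally Lipschitz without changing it inside the tube. *)
pose ret (t : R) (x : F) := X0 t + retract r (x.1 - X0 t).
have ret_near t x : `|ret t x - X0 t| <= r by rewrite /ret addrC addKr; apply: retract_norm; exact: ltW.
have ret_Om t x : 0 <= t <= T -> Om (ret t x).
  by move=> tT; have [] := tube t (ret t x) (ret t x) (u0 t) tT (Mu0 t tT) (ret_near t x) (ret_near t x).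
have ret_id t (x : F) : `|x.1 - X0 t| <= r -> ret t x = x.1.
  by move=> xr; rewrite /ret retract_id// addrC subrK.
have cret (z : R -> F) : continuous z -> continuous (fun t => ret t (z t)).
  move=> cz t; apply: cvgD; first exact: cX0.
  apply: (@cvg_comp _ _ _ (fun s => (z s).1 - X0 s) (retract r) _ (nbhs ((z t).1 - X0 t))); last exact: retract_continuous.
  apply: cvgB; last exact: cX0.
  by apply: (@cvg_comp _ _ _ z fst _ (nbhs (z t))); [exact: cz|exact: cvg_fst].
pose Phi t (x : F) z := aug_field t (ret t x) z.
pose UU : set (R -> Y) := [set u | regulated T U u /\ forall t, 0 <= t <= T -> M (u t)].
pose L := 2 * r^-1 + K.
have tT' t : 0 <= t < T -> 0 <= t <= T by case/andP => -> /ltW ->.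
have L0 : 0 < L by rewrite addr_gt0// mulr_gt0// invr_gt0.
have UU0 : UU u0 by [].
have UUc z : M z -> UU (fun=> z) by move=> Mz; split=> [|//]; apply: cst_regulated; exact: MU.
have UUs u s e z : UU u -> M z -> 0 <= s -> s <= e -> e < T -> UU (spike s e z u).
  move=> [ru uM] Mz s0 se eT; split; first by apply: spike_regulated => //; exact: MU.
  by move=> t tT; rewrite /spike; case: ifP => // _; exact: uM.
have Phi_regulated u (z : R -> F) : UU u -> continuous z -> regulated T setT (fun t => Phi t (z t) (u t)).
  move=> [ru _] cz; apply: (aug_regulated T0 rf0 rf ru (cret z cz)) => t tT; exact: ret_Om.
have Phi_reg u (z : R -> F) : UU u -> continuous z -> cadlag 0 T (fun t => Phi t (z t) (u t)).
  by move=> uu cz; apply: regulated_cadlag; exact: Phi_regulated.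
have Phi_lip u t (x z : F) : UU u -> 0 <= t < T -> `|Phi t x (u t) - Phi t z (u t)| <= L * `|x - z|.
  move=> [_ uM] tT.
  have [_] := tube t (ret t x) (ret t z) (u t) (tT' t tT) (uM t (tT' t tT)) (ret_near t x) (ret_near t z).
  move=> /le_trans; apply; apply: (@le_trans _ _ (2 * r^-1 * `|x - z|)); last first.
    by rewrite ler_wpM2r// lerDl ltW.
  rewrite [2 * _]mulrC -mulrA ler_pM2l ?invr_gt0//.
  have -> : ret t x - ret t z = retract r (x.1 - X0 t) - retract r (z.1 - X0 t) by rewrite /ret; module R.
  apply: le_trans (retract_lip _ _ r0) _; rewrite ler_pM2l//.
  rewrite (_ : _ - _ = (x - z).1); first exact: fst_norm_le.
  by rewrite /=; module R.
have dZ0 t : 0 <= t < T -> rderiv Z0 t (Phi t (Z0 t) (u0 t)).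
  move=> tT; rewrite /Phi ret_id /Z0/=; last by rewrite subrr normr0 ltW.
  have dX0 : rderiv X0 t (f t (X0 t) (u0 t)).
    have [xPC _ dx _] := adm; rewrite X0E ?tT'//.
    exact: (PC1_rderiv (w := fun s => f s (x0 s) (u0 s)) T0 xPC dx tT).
  exact: rderiv_pair dX0 (dc t tT).
have linB t (x z : F) : aug_lin t (x - z) = aug_lin t x - aug_lin t z by exact: aug_linB.
have linZ t a (x : F) : aug_lin t (a *: x) = a *: aug_lin t x by exact: aug_linZ.
have lin_le t (x : F) : 0 <= t < T -> `|aug_lin t x| <= L * `|x|.
  move=> tT; apply: le_trans (HK t x tT) _; rewrite ler_wpM2r// lerDr mulr_ge0// invr_ge0 ltW//.
have lin_reg (z : R -> F) : continuous z -> cadlag 0 T (fun t => aug_lin t (z t)).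
  exact: aug_lin_cadlag.
have Phi_diff t e : 0 <= t < T -> 0 < e -> exists2 d, 0 < d &
    forall k : F, `|k| <= d ->
    `|Phi t (Z0 t + k) (u0 t) - Phi t (Z0 t) (u0 t) - aug_lin t k| <= e * `|k|.
  move=> tT e0; have [d d0 Hd] := aug_diff adm rf0 rf tT e0.
  exists (Num.min d r); first by rewrite lt_min d0.
  move=> k; rewrite le_min => /andP[kd kr].
  rewrite /Phi !ret_id /Z0/=; first exact: Hd.
    by rewrite subrr normr0 ltW.
  by rewrite addrC addKr; apply: le_trans kr; exact: fst_norm_le.
have cF : geom_complete F by apply: geom_complete_prod; [exact: geom_complete_complete|exact: geom_complete_rV].
have S_ok nu : nu \in S -> 0 <= nu.1 < T /\ M nu.2.
  by move=> nuS; have [h _ _] := SP nu nuS; split => //; exact: SM.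
have [r1 r10 [rT [X XP]]] := needle_family Z0 cF T0 L0 UU0 UUs Phi_reg Phi_lip S_ok.
have [C1 C10 HC1] := needle_dist0 T0 L0 UU0 UUc Phi_reg Phi_lip cZ0 dZ0 S_ok XP.
have [C2 C20 HC2] := needle_lip T0 L0 UU0 UUc Phi_reg Phi_lip cZ0 dZ0 S_ok r10 XP.
have C11 : 0 < C1 + 1 by rewrite ltr_wpDl.
(* Below this amplitude the trajectories stay within [r] of [x0], where the retraction is the
   identity, so they solve the original equation. *)
pose r2 := Num.min r1 (r / (C1 + 1)).
have r20 : 0 < r2 by rewrite lt_min r10 divr_gt0.
have am12 a : amplitude S r2 a -> amplitude S r1 a.
  by move=> [a0 ar]; split => //; apply: le_trans ar _; rewrite ge_min lexx.
have Z0T : aug_end x0 u0 = Z0 T.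
  have [||_ _ <-] := @aug_trajectory Z0 u0 ru0 cZ0 c0.
  - by move=> t tT; exact: X0Om.
  - by move=> t tT; have := dZ0 t tT; rewrite /Phi ret_id // subrr normr0 ltW.
  rewrite /aug_end /Z0/= X0E//; congr (_, _); apply/rowP => i; rewrite !mxE.
  by apply: eq_Rintegral => t; rewrite inE/= in_itv/= => tT; rewrite X0E.
exists r2, C2, (fun a => X a T); split => //.
- move=> a am; have [Ua cX XO dX] := XP a (am12 a am).
  have near t : 0 <= t <= T -> `|(X a t).1 - X0 t| <= r.
    move=> tT; apply: le_trans (fst_norm_le (X a t - Z0 t)) _.
    apply: le_trans (HC1 a (am12 a am) t tT) _.
    apply: (@le_trans _ _ ((C1 + 1) * r2)).
      apply: ler_pM => //; [by apply: sumr_ge0 => nu _; case: am|by rewrite lerDl|by case: am].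
    by rewrite mulrC -ler_pdivlMr// ge_min lexx orbT.
  have XO2 : (X a 0).2 = 0 by rewrite XO.
  have [||h1 h2 h3] := aug_trajectory Ua.1 cX XO2.
  + by move=> t tT; rewrite -(ret_id t (X a t) (near t tT)); exact: ret_Om.
  + by move=> t tT; have := dX t tT; rewrite /Phi ret_id // near// tT'.
  exists (fun t => (X a t).1), (needle_ctrl u0 a S 0); split => //.
  + by apply: regulated_NPC0 => //; exact: Ua.1.
  + by rewrite XO /Z0/= X0E//; have [_ _ _ []] := adm.
- by move=> a b /am12 am /am12 bm; exact: HC2.
- move=> e e0.
  have y_init nu : nu \in S -> y nu nu.1 = impulse Phi Z0 u0 nu nu.1.
    move=> nuS; have [nuT _ ->] := SP nu nuS.
    by rewrite /impulse /Phi ret_id /Z0/= ?X0E ?tT'// subrr normr0 ltW.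
  have [r' r'0 Hr'] := needle_expansion T0 L0 UU0 UUc Phi_reg Phi_lip cZ0 dZ0 linB linZ lin_le lin_reg
    Phi_diff sS S_ok rT XP y_init cy dy e0.
  by exists r' => // a /am12 am h; rewrite Z0T; exact: Hr'.
Qed.

End NeedleVariationsOfBolza.

(** * Multipliers *)

Section HadamardUniform.
Context {R : realType} {X : normedModType R}.
Implicit Types (phi : X -> R^o) (x c h : X) (D : blin X R^o).

(** If the estimate failed, there would be directions converging to [c] that violate it; with their
    limit they form a compact set, on which Hadamard differentiability is uniform. *)
Lemma hadamard_local phi x D c e : is_hadamard phi x D -> 0 < e ->
  exists2 d, 0 < d & forall t h, 0 < t < d -> `|h - c| < d ->
  `|phi (x + t *: h) - phi x - t * D c| <= e * t.
Proof.
move=> HD e0; apply: contrapT => Hne.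
have /choice[w Hw] : forall n : nat, exists w : R * X, [/\ 0 < w.1 < n.+1%:R^-1,
    `|w.2 - c| < n.+1%:R^-1 & e * w.1 < `|phi (x + w.1 *: w.2) - phi x - w.1 * D c|].
  move=> n; apply: contrapT => Hna; apply: Hne; exists n.+1%:R^-1; first by rewrite invr_gt0.
  by move=> t h tn hn; rewrite leNgt; apply/negP => lt; apply: Hna; exists (t, h).
have wc : (fun n => (w n).2) @ \oo --> c.
  apply/cvgrPdist_lt => k k0; near=> n; rewrite distrC.
  have [_ h _] := Hw n; apply: lt_trans h _; near: n; exact: (near_infty_natSinv_lt (PosNum k0)).
have cK := compact_cvg_range wc; set K := _ `|` _ in cK.
have Kn0 : K !=set0 by exists c; left.
have e2 : 0 < e / 2 by rewrite divr_gt0.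
have : \forall t \near 0^'+, (ereal_sup [set `|t^-1 *: (phi (x + t *: h) - phi x) - D h|%:E | h in K] < (e / 2)%:E)%E.
  apply: (HD K cK Kn0 [set y | (y < (e / 2)%:E)%E]); apply: open_nbhs_nbhs; split; last by rewrite /= lte_fin.
  exact: open_ereal_lt_ereal.
move=> /near_rightP[d d0 Hd].
have k0 : 0 < e / 2 / (opnorm D + 1) by rewrite divr_gt0// ltr_wpDl// opnorm_ge0.
near \oo => n.
have [/andP[t0 tn] hn lt] := Hw n.
have td : (w n).1 < d by apply: lt_trans tn _; near: n; exact: (near_infty_natSinv_lt (PosNum d0)).
have Dh : `|D (w n).2 - D c| <= e / 2.
  rewrite -linearB; apply: le_trans (le_opnorm D _) _; apply: (@le_trans _ _ ((opnorm D + 1) * `|(w n).2 - c|)).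
    by rewrite ler_wpM2r// lerDl.
  rewrite mulrC -ler_pdivlMr ?ltr_wpDl ?opnorm_ge0//; apply/ltW.
  apply: lt_trans hn _; near: n; exact: (near_infty_natSinv_lt (PosNum k0)).
have H1 : `|(w n).1^-1 *: (phi (x + (w n).1 *: (w n).2) - phi x) - D (w n).2| <= e / 2.
  rewrite -lee_fin; apply: le_trans (ltW (Hd (w n).1 _)); last by rewrite t0 add0r.
  by apply: ereal_sup_ubound; exists (w n).2 => //; right; exists n.
move: lt; apply/negP; rewrite -leNgt.
have -> : phi (x + (w n).1 *: (w n).2) - phi x - (w n).1 * D c =
    (w n).1 * (((w n).1^-1 *: (phi (x + (w n).1 *: (w n).2) - phi x) - D (w n).2) + (D (w n).2 - D c)).
  have alg (a b u v t : R) : 0 < t -> a - b - t * u = t * ((t^-1 * (a - b) - v) + (v - u)).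
    by move=> t00; field; exact: lt0r_neq0.
  exact: alg.
rewrite normrM gtr0_norm// mulrC ler_pM2r//.
apply: le_trans (ler_normD _ _) _; rewrite [leRHS](splitr e).
exact: lerD.
Unshelve. all: by end_near. Qed.

(** The prescribed directions [c] fill a compact set, but the true displacements [h] only
    approximate them, without staying in a fixed compact set. The local estimates, which tolerate
    such an error, are made uniform by a covering argument. *)
Lemma hadamard_uniform phi x D (C : set X) e : is_hadamard phi x D -> compact C -> 0 < e ->
  exists2 d, 0 < d & forall c t h, C c -> 0 < t < d -> `|h - c| < d ->
  `|phi (x + t *: h) - phi x - t * D c| <= e * t.
Proof.
move=> HD cC e0.
have : \forall d \near (0 : R)^'+, C `<=` [set c | forall t h, 0 < t < d -> `|h - c| < d ->
    `|phi (x + t *: h) - phi x - t * D c| <= e * t].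
  move/compact_near_coveringP : cC; apply => c Cc.
  have e2 : 0 < e / 2 by rewrite divr_gt0.
  have [d0 d00 Hd0] := hadamard_local c HD e2.
  have d02 : 0 < d0 / 2 by rewrite divr_gt0.
  have nc : \forall c' \near c, `|c - c'| < d0 / 2 /\ `|D c - D c'| < e / 2.
    apply: filterI; first by move/cvgrPdist_lt : (@cvg_id _ (nbhs c)); apply.
    by have /cvgrPdist_lt := @blin_continuous _ _ _ D c; apply.
  have nd : \forall d \near (0 : R)^'+, d < d0 / 2 by exact: nbhs_right_lt.
  exists ([set c' | `|c - c'| < d0 / 2 /\ `|D c - D c'| < e / 2], [set d | d < d0 / 2]) => //.
  move=> [c' d] /= [[cc' Dcc'] dd0] t h /andP[t0 td] hc'.
  have := Hd0 t h; have -> : 0 < t < d0 by rewrite t0; move: td dd0 d00; lra.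
  have -> : `|h - c| < d0.
    rewrite -(subrK c' h) -addrA; apply: le_lt_trans (ler_normD _ _) _.
    by move: hc' cc' dd0; rewrite [`|c - _|]distrC; lra.
  move=> /(_ isT isT) H.
  rewrite (_ : _ - _ = (phi (x + t *: h) - phi x - t * D c) + t * (D c - D c')); last first.
    have alg (a b u v k : R) : a - b - k * v = a - b - k * u + k * (u - v) by ring.
    exact: alg.
  apply: le_trans (ler_normD _ _) _; rewrite (splitr e) mulrDl; apply: lerD => //.
  by rewrite normrM gtr0_norm// mulrC ler_pM2r// ltW.
move=> /near_rightP[d d0 Hd]; exists (d / 2); first by rewrite divr_gt0.
by move=> c t h Cc; apply: (Hd (d / 2)) => //; rewrite divr_gt0//=; move: d0; lra.
Qed.

End HadamardUniform.

Section ConeAlternative.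
Context {R : realType} {l m q : nat}.
Local Notation coords := ('rV[R]_l * 'rV[R]_m * 'rV[R]_q)%type.

Lemma dot_row_mx {n1 n2} (u u' : 'rV[R]_n1) (v v' : 'rV[R]_n2) :
  dot (row_mx u v) (row_mx u' v') = dot u u' + dot v v'.
Proof.
rewrite /dot big_split_ord; congr (_ + _); apply: eq_bigr => i _.
  by rewrite !row_mxEl.
by rewrite !row_mxEr.
Qed.

Lemma dot_delta {n} (u : 'rV[R]_n) i : dot u (delta_mx 0 i) = u 0 i.
Proof.
rewrite /dot (bigD1 i) //= mxE !eqxx mulr1 big1 ?addr0// => j ji.
by rewrite mxE (negbTE ji) andbF mulr0.
Qed.

Lemma dotNr {n} (u v : 'rV[R]_n) : dot u (- v) = - dot u v.
Proof. by rewrite /dot -sumrN; apply: eq_bigr => i _; rewrite mxE mulrN. Qed.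

Lemma dotZr {n} (u v : 'rV[R]_n) c : dot u (c *: v) = c * dot u v.
Proof. by rewrite /dot mulr_sumr; apply: eq_bigr => i _; rewrite mxE mulrCA. Qed.

Lemma dot0r {n} (u : 'rV[R]_n) : dot u 0 = 0.
Proof. by rewrite /dot big1// => i _; rewrite mxE mulr0. Qed.

(** The signs come from testing a nonpositive functional on the negatives of discarded gains: a
    nonnegative gain yields a nonnegative multiplier. The gain of an inactive constraint may have
    either sign, which forces its multiplier to vanish. In the other case, approximating
    [(1, ..., 1, tau)] gives the required direction. *)
Lemma cone_alternative (act : pred 'I_m) (K : set coords) :
  K 0 -> (forall k k', K k -> K k' -> K (k + k')) -> (forall c k, 0 < c -> K k -> K (c *: k)) ->
  (exists (theta : 'rV[R]_l) (lambda : 'rV[R]_m) (mu : 'rV[R]_q),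
    [/\ (theta, lambda, mu) != 0, forall i, 0 <= theta 0 i, forall a, 0 <= lambda 0 a,
        forall a, ~~ act a -> lambda 0 a = 0 &
        forall k, K k -> dot theta k.1.1 + dot lambda k.1.2 + dot mu k.2 <= 0]) \/
  (forall (tau : 'rV[R]_q) e, 0 < e -> exists k, [/\ K k, forall i, 1 - e <= k.1.1 0 i,
     forall a, act a -> 1 - e <= k.1.2 0 a & forall b, `|k.2 0 b - tau 0 b| <= e]).
Proof.
move=> K0 KD KZ.
(* Q consists of the gains that may be discarded. *)
pose Q (z : 'rV[R]_l * 'rV[R]_m) := (forall i, 0 <= z.1 0 i) /\ forall a, act a -> 0 <= z.2 0 a.
have Q0 : Q 0 by split => [i|a _]; rewrite mxE.
pose pack (k : coords) (z : 'rV[R]_l * 'rV[R]_m) := row_mx (row_mx (k.1.1 - z.1) (k.1.2 - z.2)) k.2.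
pose A := [set v | exists k z, [/\ K k, Q z & v = pack k z]].
have [[v v0 vA]|H] := pselect (exists2 v, v != 0 & forall a, A a -> dot v a <= 0); [left|right].
  exists (lsubmx (lsubmx v)), (rsubmx (lsubmx v)), (rsubmx v).
  have vE : v = row_mx (row_mx (lsubmx (lsubmx v)) (rsubmx (lsubmx v))) (rsubmx v) by rewrite !hsubmxK.
  set th := lsubmx (lsubmx v) in vE *; set la := rsubmx (lsubmx v) in vE *; set mu := rsubmx v in vE *.
  have H k z : K k -> Q z -> dot th (k.1.1 - z.1) + dot la (k.1.2 - z.2) + dot mu k.2 <= 0.
    by move=> Kk Qz; rewrite -!dot_row_mx -vE; apply: vA; exists k, z.
  have HQ z : Q z -> 0 <= dot th z.1 + dot la z.2.
    by move=> Qz; have := H 0 z K0 Qz; rewrite /= !sub0r !dotNr dot0r addr0 -opprD oppr_le0.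
  have Hla (c : R) a : (act a -> 0 <= c) -> 0 <= c * la 0 a.
    move=> ca; have := HQ (0, c *: delta_mx 0 a); rewrite /= dot0r add0r.
    rewrite dotZr dot_delta.
    apply; split => [i|b /= ab]; rewrite !mxE//=.
    by case: eqP => [ba|_]; rewrite ?mulr0// mulr1 ca// -ba.
  split.
  - apply: contra v0 => /eqP[th0 la0 mu0]; by rewrite vE th0 la0 mu0 !row_mx0.
  - move=> i; have := HQ (delta_mx 0 i, 0); rewrite /= dot_delta dot0r addr0; apply.
    by split => [j|a _]; rewrite /= !mxE//; case: eqP => //= _; rewrite ler0n.
  - by move=> a; have := Hla 1 a; rewrite mul1r; apply.
  - move=> a na; apply/eqP; rewrite eq_le.
    have h1 : act a -> 0 <= 1 :> R by [].
    have h2 : act a -> 0 <= -1 :> R by rewrite (negbTE na).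
    have := Hla _ _ h1; have := Hla _ _ h2.
    by rewrite mul1r mulN1r oppr_ge0 => -> ->.
  - by move=> k Kk; have := H k 0 Kk Q0; rewrite /= !subr0.
move=> tau e e0.
have AA : A !=set0 by exists (pack 0 0), 0, 0.
have AD a b : A a -> A b -> A (a + b).
  move=> [k [z [Kk [Qz1 Qz2] ->]]] [k' [z' [Kk' [Qz1' Qz2'] ->]]]; exists (k + k'), (z + z'); split.
  - exact: KD.
  - split => [i|b' ab]; rewrite mxE; first by rewrite addr_ge0// ?Qz1 ?Qz1'.
    by apply: addr_ge0; [exact: Qz2|exact: Qz2'].
  - by rewrite /pack/= !add_row_mx !opprD !(addrACA _ _ (- _)).
have AZ c a : 0 < c -> A a -> A (c *: a).
  move=> c0 [k [z [Kk [Qz1 Qz2] ->]]]; exists (c *: k), (c *: z); split.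
  - exact: KZ.
  - split => [i|b' ab]; rewrite mxE; first by rewrite mulr_ge0 ?Qz1 ?(ltW c0).
    by rewrite mulr_ge0 ?Qz2 ?(ltW c0).
  - by rewrite /pack/= !scale_row_mx !scalerBr.
have Av v : (forall a, A a -> dot v a <= 0) -> v = 0.
  by move=> vA; apply/eqP/negPn/negP => v0; apply: H; exists v.
have [_ [k [z [Kk [Qz1 Qz2] ->]]] kd] :=
  cone_dense AA AD AZ Av (row_mx (row_mx (const_mx 1) (const_mx 1)) tau) e0.
have crd i : `|(row_mx (row_mx (const_mx 1) (const_mx 1)) tau - pack k z) 0 i| <= e.
  by apply: le_trans kd; exact: rV_coord_le.
exists k; split => //.
- move=> i; have := crd (lshift q (lshift m i)); rewrite /pack mxE [X in _ + X]mxE !row_mxEl !mxE.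
  by rewrite ler_norml => /andP[_]; have := Qz1 i; lra.
- move=> a aa; have := crd (lshift q (rshift l a)); rewrite /pack mxE [X in _ + X]mxE !row_mxEl !row_mxEr !mxE.
  by rewrite ler_norml => /andP[_]; have := Qz2 a aa; lra.
- move=> b; have := crd (rshift (l + m) b); rewrite /pack mxE [X in _ + X]mxE !row_mxEr.
  by rewrite distrC.
Qed.

End ConeAlternative.

(** The same needle may occur several times, but the variations are indexed by a list without
    repetitions; equal needles are merged by adding their weights. *)
Lemma sum_collect {R : ringType} {W : lmodType R} {V : eqType} (S : seq V) (s : seq (V * R)) (D : V -> W) :
  uniq S -> (forall p, p \in s -> p.1 \in S) ->
  \sum_(nu <- S) (\sum_(p <- s | p.1 == nu) p.2) *: D nu = \sum_(p <- s) p.2 *: D p.1.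
Proof.
move=> uS; elim: s => [_|p s IH sS].
  by rewrite big_nil big1// => nu _; rewrite big_nil scale0r.
rewrite big_cons -IH; last by move=> p' p's; apply: sS; rewrite inE p's orbT.
have pS : p.1 \in S by apply: sS; rewrite mem_head.
rewrite !(bigD1_seq p.1 pS uS) /= addrA; congr (_ + _).
  by rewrite big_cons eqxx scalerDl.
by apply: eq_bigr => nu np; rewrite big_cons eq_sym (negbTE np).
Qed.

Lemma functionalZ {R : realType} {E : normedModType R} (D : blin E R^o) (c : R) x : D (c *: x) = c * D x.
Proof. by rewrite linearZ. Qed.

Section Improvement.
Context {R : realType} {E : normedModType R} {V : choiceType} {l m q : nat}.
Local Notation F := (E * 'rV[R]_l)%type.
Variables (S : seq (R * V)) (r C : R) (W : (R * V -> R) -> F) (eta : F) (dW : R * V -> F).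
Variables (g0 : 'I_l -> E -> R) (g : 'I_m -> E -> R) (h : 'I_q -> E -> R).
Variables (D0 : 'I_l -> blin E R^o) (Dg : 'I_m -> blin E R^o) (Dh : 'I_q -> blin E R^o).
Variables (act : pred 'I_m) (ap am : 'I_q -> R * V -> R).
Hypotheses (q0 : (0 < q)%N) (r0 : 0 < r).
Hypothesis W_lip : forall a b, amplitude S r a -> amplitude S r b ->
  `|W a - W b| <= C * \sum_(nu <- S) `|a nu - b nu|.
Hypothesis W_exp : forall e, 0 < e -> exists2 r', 0 < r' & forall a, amplitude S r a ->
  \sum_(nu <- S) a nu <= r' ->
  `|W a - eta - \sum_(nu <- S) a nu *: dW nu| <= e * \sum_(nu <- S) a nu.
Hypothesis g0D : forall i, is_hadamard (g0 i : E -> R^o) eta.1 (D0 i).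
Hypothesis gD : forall a, is_hadamard (g a : E -> R^o) eta.1 (Dg a).
Hypothesis hD : forall b, is_hadamard (h b : E -> R^o) eta.1 (Dh b).
Hypothesis hcont : forall b, exists2 N, nbhs eta.1 N & {within N, continuous (h b : E -> R^o)}.
Hypothesis g_ge0 : forall a, 0 <= g a eta.1.
Hypothesis g_inactive : forall a, ~~ act a -> 0 < g a eta.1.
Hypothesis h_eq0 : forall b, h b eta.1 = 0.
Hypotheses (ap0 : forall b nu, 0 <= ap b nu) (am0 : forall b nu, 0 <= am b nu).

Let vec (a : R * V -> R) : F := \sum_(nu <- S) a nu *: dW nu.

Hypothesis vec0 : forall b i, 1 / 2 <= D0 i (vec (ap b)).1 + (vec (ap b)).2 0 i /\
  1 / 2 <= D0 i (vec (am b)).1 + (vec (am b)).2 0 i.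
Hypothesis vecg : forall b a, act a -> 1 / 2 <= Dg a (vec (ap b)).1 /\ 1 / 2 <= Dg a (vec (am b)).1.
Hypothesis vech : forall b b', `|Dh b' (vec (ap b)).1 - (b == b')%:R| <= (2 * q%:R)^-1 /\
  `|Dh b' (vec (am b)).1 + (b == b')%:R| <= (2 * q%:R)^-1.

(* For b in the cube, the amplitudes are interpolated between ap and am, so that the
   linearised equality constraints are close to b; Brouwer's theorem then solves the
   nonlinear ones. *)
Let mix (b : 'rV[R]_q) nu := \sum_j ((1 + b 0 j) / 2 * ap j nu + (1 - b 0 j) / 2 * am j nu).

Let v (b : 'rV[R]_q) : F := \sum_j ((1 + b 0 j) / 2 *: vec (ap j) + (1 - b 0 j) / 2 *: vec (am j)).

Let vE b c : \sum_(nu <- S) (c * mix b nu) *: dW nu = c *: v b.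
Proof.
rewrite /v scaler_sumr; under eq_bigr do rewrite /mix mulr_sumr scaler_suml.
rewrite exchange_big; apply: eq_bigr => j _.
rewrite /vec !scaler_sumr -big_split scaler_sumr; apply: eq_bigr => nu _ /=.
by rewrite !scalerA -scalerDl scalerA.
Qed.

Let cubeW (b : 'rV[R]_q) j : cube b -> 0 <= (1 + b 0 j) / 2 <= 1 /\ 0 <= (1 - b 0 j) / 2 <= 1.
Proof. by move=> /(_ j); rewrite ler_norml => /andP[b1 b2]; split; apply/andP; split; lra. Qed.

Let mix_ge0 b nu : cube b -> 0 <= mix b nu.
Proof.
move=> cb; apply: sumr_ge0 => j _; have [/andP[h1 _] /andP[h2 _]] := cubeW j cb.
by rewrite addr_ge0// mulr_ge0.
Qed.

Let A := \sum_(nu <- S) \sum_j (ap j nu + am j nu).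

Let A0 : 0 <= A.
Proof. by apply: sumr_ge0 => nu _; apply: sumr_ge0 => j _; rewrite addr_ge0. Qed.

Let mix_le b : cube b -> \sum_(nu <- S) mix b nu <= A.
Proof.
move=> cb; apply: ler_sum => nu _; apply: ler_sum => j _.
have [/andP[_ h1] /andP[_ h2]] := cubeW j cb.
by apply: lerD; rewrite ler_piMl.
Qed.

Let cv : continuous v.
Proof.
move=> b; apply: (@cvg_sumr R F _ (nbhs b)) => j.
have cj : (fun x : 'rV[R]_q => x 0 j) @ nbhs b --> b 0 j by exact: coord_continuous.
apply: cvgD; apply: cvgZr_tmp; apply: (@cvgMl R).
  by apply: (@cvgD R R^o); [exact: cvg_cst|].
by apply: (@cvgB R R^o); [exact: cvg_cst|].
Qed.

Let cmix nu : continuous (mix ^~ nu : 'rV[R]_q -> R^o).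
Proof.
move=> b; apply: (@cvg_sumr R R^o _ (nbhs b)) => j.
have cj : (fun x : 'rV[R]_q => x 0 j) @ nbhs b --> b 0 j by exact: coord_continuous.
apply: cvgD; apply: (@cvgMl R); apply: (@cvgMl R).
  by apply: (@cvgD R R^o); [exact: cvg_cst|].
by apply: (@cvgB R R^o); [exact: cvg_cst|].
Qed.

(** For each index the two weights are nonnegative with sum 1, so its term is at least 1/2; as [q]
    is positive, there is at least one term. *)
Let v_lower (L : F -> R) b : (forall x y, L (x + y) = L x + L y) -> (forall c x, L (c *: x) = c * L x) ->
  (forall j, 1 / 2 <= L (vec (ap j)) /\ 1 / 2 <= L (vec (am j))) -> cube b -> 1 / 2 <= L (v b).
Proof.
move=> LD LZ Lv cb; have L0 : L 0 = 0 by have := LZ 0 0; rewrite scale0r mul0r.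
rewrite /v (big_morph L LD L0); have j0 := Ordinal q0.
have H j : 1 / 2 <= L ((1 + b 0 j) / 2 *: vec (ap j) + (1 - b 0 j) / 2 *: vec (am j)).
  rewrite LD !LZ; have [h1 h2] := Lv j; have [/andP[c1 _] /andP[c2 _]] := cubeW j cb.
  have := ler_wpM2l c1 h1; have := ler_wpM2l c2 h2; lra.
rewrite (bigD1 j0)//=; apply: le_trans (H j0) _; rewrite lerDl; apply: sumr_ge0 => j _.
by apply: le_trans (H j); rewrite divr_ge0.
Qed.

(** Each of the [q] directions contributes an error of at most [(2 * q%:R)^-1]. The total 1/2 leaves
    room for the nonlinear remainder in [brouwer_cube]. *)
Let v_h b k : cube b -> `|Dh k (v b).1 - b 0 k| <= 1 / 2.
Proof.
move=> cb.
have -> : Dh k (v b).1 - b 0 k = \sum_j ((1 + b 0 j) / 2 * (Dh k (vec (ap j)).1 - (j == k)%:R) +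
    (1 - b 0 j) / 2 * (Dh k (vec (am j)).1 + (j == k)%:R)).
  have -> : b 0 k = \sum_j b 0 j * (j == k)%:R.
    by rewrite (bigD1 k)//= eqxx mulr1 big1 ?addr0// => j /negbTE ->; rewrite mulr0.
  rewrite /v (big_morph fst (id1 := 0) (op1 := +%R))// (linear_sum (Dh k)) -sumrB.
  apply: eq_bigr => j _ /=; rewrite linearD.
  rewrite -[LHS]/(Dh k ((1 + b 0 j) / 2 *: (vec (ap j)).1) + Dh k ((1 - b 0 j) / 2 *: (vec (am j)).1)
    - b 0 j * (j == k)%:R) !functionalZ.
  have alg (B x y d : R) : (1 + B) / 2 * x + (1 - B) / 2 * y - B * d =
    (1 + B) / 2 * (x - d) + (1 - B) / 2 * (y + d) by field.
  exact: alg.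
apply: le_trans (ler_norm_sum _ _ _) _.
apply: (@le_trans _ _ (\sum_(j < q) (2 * q%:R)^-1)).
  apply: ler_sum => j _; apply: le_trans (ler_normD _ _) _.
  rewrite [X in X + _ <= _]normrM [X in _ + X <= _]normrM.
  have [c1 c2] := cubeW j cb; have [h1 h2] := vech j k.
  have [c10 c20] := (andP c1, andP c2); rewrite (ger0_norm c10.1) (ger0_norm c20.1).
  have := ler_wpM2l c10.1 h1; have := ler_wpM2l c20.1 h2; lra.
rewrite sumr_const card_ord -mulr_natr le_eqVlt; apply/orP; left; apply/eqP; field.
by rewrite pnatr_eq0 -lt0n.
Qed.

Lemma improvement : exists2 a, amplitude S r a &
  [/\ forall i, g0 i eta.1 + eta.2 0 i < g0 i (W a).1 + (W a).2 0 i,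
      forall a', 0 <= g a' (W a).1 & forall b, h b (W a).1 = 0].
Proof.
pose C1 : set E := [set (v b).1 | b in (cube : set 'rV[R]_q)].
have cC1 : compact C1.
  apply: (@continuous_compact _ _ (fun b => (v b).1)); last exact: cube_compact.
  apply: continuous_subspaceT => b.
  by apply: (@cvg_comp _ _ _ v fst _ (nbhs (v b))); [exact: cv|exact: cvg_fst].
have [M0 [_ HM0]] := compact_bounded cC1.
pose M := Num.max M0 0 + 1.
have M0' : 0 < M by rewrite ltr_wpDl// le_max lexx orbT.
have HM b : cube b -> `|(v b).1| <= M.
  move=> cb; apply: HM0; last by exists b.
  by apply: (@le_lt_trans _ _ (Num.max M0 0)); rewrite ?le_max ?lexx// ltrDl.
have e8 : 0 < 1 / 8 :> R by rewrite divr_gt0.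
pose unif phi (D : blin E R^o) d := forall c t k, C1 c -> 0 < t < d -> `|k - c| < d ->
  `|phi (eta.1 + t *: k) - phi eta.1 - t * D c| <= 1 / 8 * t.
have unif_mono phi D d d' : 0 < d' -> d' <= d -> unif phi D d -> unif phi D d'.
  move=> d'0 dd' H c t k Cc /andP[t0 td] kc; apply: H => //; first by rewrite t0 (lt_le_trans td).
  exact: lt_le_trans dd'.
have [d1 d10 H1] : exists2 d, 0 < d & forall i, unif (g0 i) (D0 i) d.
  apply: finite_common_radius => [i|i]; first exact: unif_mono.
  exact: hadamard_uniform.
have [d2 d20 H2] : exists2 d, 0 < d & forall a, unif (g a) (Dg a) d.
  apply: finite_common_radius => [i|i]; first exact: unif_mono.
  exact: hadamard_uniform.
have [d3 d30 H3] : exists2 d, 0 < d & forall b, unif (h b) (Dh b) d.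
  apply: finite_common_radius => [i|i]; first exact: unif_mono.
  exact: hadamard_uniform.
have [d4 d40 H4] : exists2 d, 0 < d & forall b, forall x, `|x - eta.1| < d -> {for x, continuous (h b : E -> R^o)}.
  apply: finite_common_radius => [b d d' d'0 dd' H x xd|b]; first by apply: H; exact: lt_le_trans dd'.
  have [N nN cN] := hcont b; have /nbhs_ballP[d /= d0 HN] := nbhs_interior nN.
  exists d => // x xd.
  have Nx : interior N x by apply: HN; rewrite -ball_normE /= distrC.
  move/subspace_continuousP : cN => /(_ x (interior_subset Nx)).
  by rewrite within_interior.
(* Below this scale the loss of an inactive constraint, at most [s * (opnorm (Dg a) * M)] plus the
   remainder [s / 8], stays below its value at the optimum. *)
have [d5 d50 H5] : exists2 d, 0 < d & forall a, ~~ act a -> forall s, 0 < s -> s <= d ->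
    s * (opnorm (Dg a) * M + 1) < g a eta.1.
  apply: finite_common_radius => [a d d' d'0 dd' H na s s0 sd|a]; first by apply: H => //; exact: le_trans dd'.
  have [aa|na] := boolP (act a); first by exists 1.
  have p0 : 0 < opnorm (Dg a) * M + 1 by rewrite ltr_wpDl// mulr_ge0 ?opnorm_ge0// ltW.
  exists (g a eta.1 / (opnorm (Dg a) * M + 1) / 2); first by rewrite !divr_gt0// g_inactive.
  move=> _ s s0 sd; rewrite -ltr_pdivlMr//; apply: le_lt_trans sd _.
  have : 0 < g a eta.1 / (opnorm (Dg a) * M + 1) by rewrite divr_gt0// g_inactive.
  lra.
pose d := Num.min d1 (Num.min d2 d3).
have dd0 : 0 < d by rewrite !lt_min d10 d20 d30.
(* The displacement will be known up to [k * s]. The bound 1/8 serves the payoff coordinates, and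
   [d / 2] keeps the rescaled displacement within [d] of [v b], as the Hadamard estimates demand. *)
pose k := Num.min (1 / 8) (d / 2).
have k0 : 0 < k by rewrite lt_min e8 divr_gt0.
have A1 : 0 < A + 1 by rewrite ltr_wpDl.
have [r' r'0 Hr'] := W_exp (divr_gt0 k0 A1).
(* In turn: the Hadamard estimates, admissibility of the amplitudes, validity of the expansion,
   continuity of the equality constraints, and positivity of the inactive constraints. *)
pose s := Num.min (d / 2) (Num.min (Num.min (r / (A + 1)) (r' / (A + 1))) (Num.min (d4 / (M + 1) / 2) d5)).
have M1 : 0 < M + 1 by rewrite addr_gt0.
have s0 : 0 < s.
  by rewrite /s !lt_min d50 !andbT (divr_gt0 dd0)// !(divr_gt0 _ A1)// divr_gt0// divr_gt0.
have [s1 s2 s3 s4 s5] : [/\ s <= d / 2, s <= r / (A + 1), s <= r' / (A + 1), s <= d4 / (M + 1) / 2 & s <= d5].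
  by split; rewrite /s !ge_min lexx ?orbT.
have sA b p : cube b -> s <= p / (A + 1) -> \sum_(nu <- S) s * mix b nu <= p.
  move=> cb; rewrite ler_pdivlMr// => /(le_trans _); apply.
  by rewrite -mulr_sumr ler_pM2l//; apply: le_trans (mix_le cb) _; rewrite lerDl.
have am' b : cube b -> amplitude S r (fun nu => s * mix b nu).
  by move=> cb; split => [nu|]; [rewrite mulr_ge0 ?mix_ge0// ltW|exact: sA].
pose w b := W (fun nu => s * mix b nu).
have wv b : cube b -> `|w b - eta - s *: v b| <= k * s.
  move=> cb; rewrite -vE; apply: le_trans (Hr' _ (am' b cb) (sA b _ cb s3)) _.
  rewrite -mulrA ler_pM2l// ler_pdivrMl// -mulr_sumr mulrC ler_pM2r//.
  by apply: le_trans (mix_le cb) _; rewrite lerDl.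
have k8 : k <= 1 / 8 by rewrite ge_min lexx.
have kd : k < d.
  by apply: (@le_lt_trans _ _ (d / 2)); [rewrite ge_min lexx orbT|move: dd0; lra].
have sd : s < d by apply: le_lt_trans s1 _; move: dd0; lra.
have wH b phi D : cube b -> unif phi D d ->
    `|phi (w b).1 - phi eta.1 - s * D (v b).1| <= 1 / 8 * s.
  move=> cb /(_ (v b).1 s (s^-1 *: ((w b).1 - eta.1))).
  rewrite scalerA divff ?gt_eqF// scale1r subrKC; apply; first by exists b.
    by rewrite s0.
  set X := s^-1 *: _ - _; have X_eq : s *: X = (w b - eta - s *: v b).1.
    by rewrite /X scalerBr scalerA divff ?gt_eqF// scale1r.
  apply: le_lt_trans kd; rewrite -(ler_pM2l s0) -{1}(gtr0_norm s0) -normrZ X_eq mulrC.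
  exact: le_trans (fst_norm_le _) (wv b cb).
have {}H1 i : unif (g0 i) (D0 i) d by apply: unif_mono (H1 i); rewrite // ge_min lexx.
have {}H2 i : unif (g i) (Dg i) d by apply: unif_mono (H2 i); rewrite // !ge_min lexx ?orbT.
have {}H3 i : unif (h i) (Dh i) d by apply: unif_mono (H3 i); rewrite // !ge_min lexx ?orbT.
have w_near b : cube b -> `|(w b).1 - eta.1| < d4.
  move=> cb; have h1 : `|(w b).1 - eta.1 - s *: (v b).1| <= k * s.
    by apply: le_trans (wv b cb); exact: (fst_norm_le (w b - eta - s *: v b)).
  rewrite -[_ - _](subrK (s *: (v b).1)); apply: le_lt_trans (ler_normD _ _) _.
  rewrite normrZ gtr0_norm//; apply: (@le_lt_trans _ _ (s * (M + 1))).
    rewrite addrC mulrDr mulr1; apply: lerD; first by rewrite ler_pM2l// HM.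
    by apply: le_trans h1 _; rewrite ler_piMl ?(ltW s0)//; move: k8; lra.
  rewrite -(ltr_pdivlMr _ _ M1); apply: le_lt_trans s4 _.
  have : 0 < d4 / (M + 1) by rewrite divr_gt0// addr_gt0.
  lra.
have cw b : cube b -> w @ within cube (nbhs b) --> w b.
  move=> cb; pose psi x := C * \sum_(nu <- S) `|s * mix b nu - s * mix x nu|.
  have cpsi : psi @ nbhs b --> (0 : R).
    have -> : (0 : R) = C * \sum_(nu <- S) `|s * mix b nu - s * mix b nu|.
      by rewrite big1 ?mulr0// => nu _; rewrite subrr normr0.
    apply: (@cvgMr R); apply: (@cvg_sumr R R^o) => nu.
    by apply: cvg_norm; apply: (@cvgB R R^o); [exact: cvg_cst|apply: (@cvgMr R); exact: cmix].
  apply/cvgrPdist_lt => e e0; move/cvgrPdist_lt : cpsi => /(_ e e0) H.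
  rewrite near_withinE; apply: filterS H => x; rewrite sub0r normrN => /ltr_normlW H cx.
  exact: le_lt_trans (W_lip (am' b cb) (am' x cx)) H.
(* Divided by [s], the equality constraints differ from their linearisation by at most 1/8, and this
   differs from the identity by at most 1/2, so the total stays below 1. *)
have [b cb hb] : exists2 b : 'rV[R]_q, cube b & forall i, h i (w b).1 / s = 0.
  apply: (@brouwer_cube R q (fun i b => h i (w b).1 / s)) => [i b cb|i b cb].
    apply: (@cvgMl R); apply: (@cvg_comp _ _ _ (fun b => (w b).1) (h i) _ (nbhs (w b).1)).
      by apply: (@cvg_comp _ _ _ w fst _ (nbhs (w b))); [exact: cw|exact: cvg_fst].
    exact: H4 (w_near b cb).
  have := wH b _ _ cb (H3 i); rewrite h_eq0 subr0 => hw.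
  have hw' : `|h i (w b).1 / s - Dh i (v b).1| <= 1 / 8.
    have alg (a c : R) : (a / s - c) * s = a - s * c by field; rewrite gt_eqF.
    move: hw; rewrite -alg normrM (gtr0_norm s0) ler_pM2r//.
  have := v_h i cb.
  have := ler_normD (h i (w b).1 / s - Dh i (v b).1) (Dh i (v b).1 - b 0 i).
  have -> : h i (w b).1 / s - Dh i (v b).1 + (Dh i (v b).1 - b 0 i) = h i (w b).1 / s - b 0 i :> R.
    have alg (a c e : R) : a - c + (c - e) = a - e by ring.
    exact: alg.
  by move: hw'; lra.
exists (fun nu => s * mix b nu); [exact: am'|split].
- move=> i; rewrite -/(w b).
  have := wH b _ _ cb (H1 i).
  have h2 : `|(w b).2 0 i - eta.2 0 i - s * (v b).2 0 i| <= 1 / 8 * s.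
    apply: le_trans (ler_wpM2r (ltW s0) k8); apply: le_trans (wv b cb).
    apply: le_trans (snd_norm_le _).
    by have := rV_coord_le (w b - eta - s *: v b).2 i; rewrite !mxE.
  have LD (x y : F) : D0 i (x + y).1 + (x + y).2 0 i = (D0 i x.1 + x.2 0 i) + (D0 i y.1 + y.2 0 i).
    by rewrite /= linearD mxE addrACA.
  have LZ c (x : F) : D0 i (c *: x).1 + (c *: x).2 0 i = c * (D0 i x.1 + x.2 0 i).
    by rewrite /= functionalZ mxE mulrDr.
  (* The first-order gain is at least [s / 2]; the terminal payoff and the integral payoff each lose
     at most [s / 8] of it. *)
  have := v_lower (L := fun x : F => D0 i x.1 + x.2 0 i) LD LZ (vec0 ^~ i) cb.
  move=> lo; rewrite ler_norml => /andP[h1 _]; move: h2; rewrite ler_norml => /andP[h2 _].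
  have := ler_pM2l s0 (1 / 2) (D0 i (v b).1 + (v b).2 0 i); rewrite lo mulrDr => /esym.
  move: h1 h2 s0; set X := D0 i _; lra.
- move=> a; rewrite -/(w b); have := wH b _ _ cb (H2 a).
  rewrite ler_norml => /andP[h1 _].
  have [aa|na] := boolP (act a).
    have LD (x y : F) : Dg a (x + y).1 = Dg a x.1 + Dg a y.1 by rewrite linearD.
    have LZ c (x : F) : Dg a (c *: x).1 = c * Dg a x.1 by rewrite /= functionalZ.
    have lo := v_lower (L := fun x : F => Dg a x.1) LD LZ (fun j => vecg j aa) cb.
    have := ler_pM2l s0 (1 / 2) (Dg a (v b).1); rewrite lo => /esym.
    by have := g_ge0 a; move: h1 s0; set X := Dg a _; lra.
  have := H5 a na s s0 s5.
  have : - (opnorm (Dg a) * M) <= Dg a (v b).1.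
    have : `|Dg a (v b).1| <= opnorm (Dg a) * M.
      by apply: le_trans (le_opnorm _ _) _; rewrite ler_wpM2l ?opnorm_ge0 ?HM.
    by rewrite ler_norml => /andP[].
  rewrite -(ler_pM2l s0) mulrN mulrDr mulr1.
  by move: h1 s0; set X := Dg a _; lra.
- by move=> i; rewrite -/(w b); have /eqP := hb i; rewrite mulf_eq0 invr_eq0 (gt_eqF s0) orbF => /eqP.
Qed.

End Improvement.

Section Multipliers.
Context {R : realType} {E : completeNormedModType R} {Y : normedModType R}.
Context {l m q : nat} (P : bolza E Y l m q) (x0 : R -> E) (u0 : R -> Y).
Local Notation T := (horizon P).
Local Notation U := (control_set P).
Local Notation Om := (state_domain P).
Local Notation f := (dynamics P).
Local Notation f0 := (running_payoff P).
Local Notation g0 := (terminal_payoff P).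
Local Notation g := (ineq_constraint P).
Local Notation h := (eq_constraint P).
Hypotheses (l0 : (0 < l)%N) (q0 : (0 < q)%N).
Hypotheses (T0 : 0 < T) (oOm : open Om) (opt : pareto_optimal P x0 u0).
Hypotheses (rf0 : forall i, regular_along P x0 (f0 i)) (rf : regular_along P x0 f).
Hypothesis g0D : forall i, hadamard_differentiable (g0 i) (x0 T).
Hypothesis gD : forall a, hadamard_differentiable (g a) (x0 T).
Hypothesis hD : forall b, (exists2 N, nbhs (x0 T) N & {within N, continuous (h b)}) /\
  hadamard_differentiable (h b) (x0 T).

Local Notation F := (E * 'rV[R]_l)%type.
Local Notation aug_field := (aug_field P).
Local Notation aug_lin := (aug_lin P x0 u0).
Local Notation aug_end := (aug_end P).

Let adm : admissible P x0 u0 := opt.1.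

(** The time is strictly before [T], so that a short slot fits before the horizon; time [T] itself
    is reached later by a limit from the left. *)
Definition needle (nu : R * Y) := 0 <= nu.1 < T /\ U nu.2.

Definition needle_impulse (nu : R * Y) : F :=
  aug_field nu.1 (x0 nu.1) nu.2 - aug_field nu.1 (x0 nu.1) (u0 nu.1).

Lemma linearized_flow c v : 0 <= c <= T -> exists y : R -> F, [/\ continuous y, y c = v &
  forall t, 0 <= t < T -> rderiv y t (aug_lin t (y t))].
Proof.
move=> cT; have [K K0 HK] := aug_lin_le T0 adm rf0 rf.
have cF : geom_complete F by apply: geom_complete_prod; [exact: geom_complete_complete|exact: geom_complete_rV].
apply: (@cauchy_problem _ _ aug_lin 0 T c K) => //.
  by move=> y cy; exact: aug_lin_cadlag.
by move=> t x z tT; rewrite -aug_linB; exact: HK.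
Qed.

(** The directional derivative at the end point of all objectives and constraints, as functions of
    the augmented state. *)
Definition terminal_dir (e : F) : 'rV[R]_l * 'rV[R]_m * 'rV[R]_q :=
  (\row_i (dH (g0 i) (x0 T) e.1 + e.2 0 i), \row_a dH (g a) (x0 T) e.1, \row_b dH (h b) (x0 T) e.1).

Lemma terminal_dirD e e' : terminal_dir (e + e') = terminal_dir e + terminal_dir e'.
Proof.
by congr (_, _, _); apply/rowP => i; rewrite !mxE linearD // addrACA.
Qed.

Lemma terminal_dirZ c e : terminal_dir (c *: e) = c *: terminal_dir e.
Proof.
by congr (_, _, _); apply/rowP => i; rewrite !mxE functionalZ // mulrDr.
Qed.

Theorem multipliers (y : R * Y -> R -> F) :
  (forall nu, continuous (y nu)) ->
  (forall nu t, 0 <= t < T -> rderiv (y nu) t (aug_lin t (y nu t))) ->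
  (forall nu, needle nu -> y nu nu.1 = needle_impulse nu) ->
  exists (theta : 'rV[R]_l) (lambda : 'rV[R]_m) (mu : 'rV[R]_q),
    [/\ (theta, lambda, mu) != 0, forall i, 0 <= theta 0 i, forall a, 0 <= lambda 0 a,
        forall a, lambda 0 a * g a (x0 T) = 0 &
        forall nu, needle nu -> dot theta (terminal_dir (y nu T)).1.1 +
          dot lambda (terminal_dir (y nu T)).1.2 + dot mu (terminal_dir (y nu T)).2 <= 0].
Proof.
move=> cy dy y_init.
pose act a := g a (x0 T) == 0.
have [_ _ _ [_ g_ge0 h_eq0]] := adm.
pose D nu := terminal_dir (y nu T).
pose K := [set k | exists2 s : seq (R * Y * R), (forall p, p \in s -> needle p.1 /\ 0 <= p.2) &
  k = \sum_(p <- s) p.2 *: D p.1].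
have K0 : K 0 by exists [::]; rewrite ?big_nil.
have KD k k' : K k -> K k' -> K (k + k').
  move=> [s sP ->] [s' sP' ->]; exists (s ++ s'); last by rewrite big_cat.
  by move=> p; rewrite mem_cat => /orP[/sP|/sP'].
have KZ c k : 0 < c -> K k -> K (c *: k).
  move=> c0 [s sP ->]; exists [seq (p.1, c * p.2) | p <- s].
    by move=> _ /mapP[p /sP[h1 h2] ->]; split => //=; rewrite mulr_ge0// ltW.
  by rewrite big_map scaler_sumr; apply: eq_bigr => p _; rewrite scalerA.
have [[theta [lambda [mu [nz th0 la0 laI le0]]]]|dense] := cone_alternative act K0 KD KZ.
  exists theta, lambda, mu; split => //.
    by move=> a; have [/eqP ->|/laI ->] := boolP (act a); rewrite ?mulr0 ?mul0r.
  move=> nu nuP; apply: (le0 (D nu)); exists [:: (nu, 1)].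
    by move=> p; rewrite inE => /eqP ->; split => //=.
  by rewrite big_seq1 scale1r.
exfalso; apply: opt.2.
(* With this tolerance the gains are at least 1/2, and the errors in the [q] equality constraints
   add up to at most 1/2. *)
have e0 : 0 < (2 * q%:R)^-1 :> R by rewrite invr_gt0 mulr_gt0// ltr0n.
have e2 : (2 * q%:R)^-1 <= 1 / 2 :> R.
  by rewrite div1r lef_pV2 ?posrE ?mulr_gt0 ?ltr0n// ler_peMr// ler1n.
have pick (tau : 'rV[R]_q) : exists s : seq (R * Y * R), (forall p, p \in s -> needle p.1 /\ 0 <= p.2) /\
    let k := \sum_(p <- s) p.2 *: D p.1 in
    [/\ forall i, 1 / 2 <= k.1.1 0 i, forall a, act a -> 1 / 2 <= k.1.2 0 a &
        forall b, `|k.2 0 b - tau 0 b| <= (2 * q%:R)^-1].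
  have [k [[s sP ->] h1 h2 h3]] := dense tau _ e0; exists s; split => //.
  by split => // [i|a aa]; [have := h1 i|have := h2 a aa]; move: e2; lra.
have /choice[sp Hp] := fun b => pick (delta_mx 0 b).
have /choice[sm Hm] := fun b => pick (- delta_mx 0 b).
pose le_time (k nu : R * Y) := k.1 <= nu.1.
(* All needles used for the [2 * q] target directions, without repetitions and in the order of time
   that makes their slots disjoint. *)
pose S := sort le_time (undup (flatten [seq map fst (sp b) ++ map fst (sm b) | b <- enum 'I_q])).
have S_sorted : sorted le_time S by apply: sort_sorted => k nu; exact: le_total.
have S_uniq : uniq S by rewrite sort_uniq undup_uniq.
have memS nu : (nu \in S) = (nu \in flatten [seq map fst (sp b) ++ map fst (sm b) | b <- enum 'I_q]).
  by rewrite mem_sort mem_undup.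
have Sp b p : p \in sp b -> p.1 \in S.
  move=> ps; rewrite memS; apply/flatten_mapP; exists b; first by rewrite mem_enum.
  by rewrite mem_cat map_f.
have Sm b p : p \in sm b -> p.1 \in S.
  move=> ps; rewrite memS; apply/flatten_mapP; exists b; first by rewrite mem_enum.
  by rewrite mem_cat (map_f _ ps) orbT.
have S_needle nu : nu \in S -> needle nu.
  rewrite memS => /flatten_mapP[b _]; rewrite mem_cat => /orP[/mapP[p ps ->]|/mapP[p ps ->]].
    by have [/(_ p ps)[]] := Hp b.
  by have [/(_ p ps)[]] := Hm b.
have S_ok nu : nu \in S -> [/\ 0 <= nu.1 < T, U nu.2 &
    y nu nu.1 = aug_field nu.1 (x0 nu.1) nu.2 - aug_field nu.1 (x0 nu.1) (u0 nu.1)].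
  by move=> /S_needle nuP; split; [case: nuP|case: nuP|exact: y_init].
have [r [C [W [r0 C0 Wx Wlip Wexp]]]] := needle_variation T0 oOm adm rf0 rf S_sorted S_ok cy dy.
pose weight (s : seq (R * Y * R)) nu := \sum_(p <- s | p.1 == nu) p.2.
have weightE s : (forall p, p \in s -> p.1 \in S) ->
    terminal_dir (\sum_(nu <- S) weight s nu *: y nu T) = \sum_(p <- s) p.2 *: D p.1.
  move=> sS; have dir0 : terminal_dir 0 = 0 by have := terminal_dirZ 0 0; rewrite !scale0r.
  rewrite /weight sum_collect// (big_morph terminal_dir terminal_dirD dir0).
  by apply: eq_bigr => p _; rewrite terminal_dirZ.
have weight_ge0 s : (forall p, p \in s -> needle p.1 /\ 0 <= p.2) -> forall nu, 0 <= weight s nu.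
  by move=> sP nu; rewrite /weight big_seq_cond sumr_ge0// => p /andP[/sP[]].
have [] := @improvement R E Y l m q S r C W (aug_end x0 u0) (fun nu => y nu T) g0 g h
  (fun i => dH (g0 i) (x0 T)) (fun a => dH (g a) (x0 T)) (fun b => dH (h b) (x0 T)) act
  (fun b => weight (sp b)) (fun b => weight (sm b)) q0 r0 Wlip Wexp => //.
- by move=> i; exact: dH_hadamard.
- by move=> i; exact: dH_hadamard.
- by move=> b; apply: dH_hadamard; case: (hD b).
- by move=> b; case: (hD b).
- by move=> a na; rewrite lt_def na g_ge0.
- by move=> b; apply: weight_ge0; case: (Hp b).
- by move=> b; apply: weight_ge0; case: (Hm b).
- move=> b i; have [_ [h1 _ _]] := Hp b; have [_ [h2 _ _]] := Hm b.
  have := h1 i; have := h2 i.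
  rewrite -!weightE; [|exact: Sp|exact: Sm].
  by rewrite !mxE => le1 le2; split.
- move=> b a aa; have [_ [_ h1 _]] := Hp b; have [_ [_ h2 _]] := Hm b.
  have := h1 a aa; have := h2 a aa.
  rewrite -!weightE; [|exact: Sp|exact: Sm].
  by rewrite !mxE => le1 le2; split.
- move=> b b'; have [_ [_ _ h1]] := Hp b; have [_ [_ _ h2]] := Hm b.
  have := h1 b'; have := h2 b'.
  rewrite -!weightE; [|exact: Sp|exact: Sm].
  by rewrite !mxE opprK /= eq_sym => le1 le2; split.
move=> a am [J_lt g_ok h_ok].
have [x [u [xPC uN dx xO xW]]] := Wx a am.
have xT : x T = (W a).1 by rewrite -xW.
have obj i : objective P i x u = g0 i (W a).1 + (W a).2 0 i by rewrite -xW !mxE.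
have obj0 i : objective P i x0 u0 = g0 i (aug_end x0 u0).1 + (aug_end x0 u0).2 0 i by rewrite !mxE.
exists x, u; split.
- by split => //; split => // [a'|b]; rewrite xT.
- by move=> i; rewrite obj obj0 ltW.
- by exists (Ordinal l0); rewrite obj obj0.
Qed.

End Multipliers.

(** * Adjoint state and maximum principle *)

Lemma blin_compBl {R : realType} {X Y Z : normedModType R} (g g' : blin Y Z) (f : blin X Y) :
  blin_comp (g - g') f = blin_comp g f - blin_comp g' f.
Proof. exact: val_inj. Qed.

Lemma blin_compBr {R : realType} {X Y Z : normedModType R} (g : blin Y Z) (f f' : blin X Y) :
  blin_comp g (f - f') = blin_comp g f - blin_comp g f'.
Proof. by apply/val_inj/funext => x /=; exact: (linearB g). Qed.

Lemma opnorm_comp {R : realType} {X Y Z : normedModType R} (g : blin Y Z) (f : blin X Y) :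
  `|blin_comp g f| <= `|g| * `|f|.
Proof.
apply: opnorm_le => x x1; apply: le_trans (le_opnorm g _) _.
apply: ler_wpM2l; first exact: opnorm_ge0.
by apply: le_trans (le_opnorm f x) _; rewrite ler_piMr// opnorm_ge0.
Qed.

Lemma cvg_blin_comp {R : realType} {X Y Z : normedModType R} {I : Type} (G : set_system I)
  {FG : Filter G} (g : I -> blin Y Z) (f : I -> blin X Y) g' f' :
  g @ G --> g' -> f @ G --> f' -> (fun i => blin_comp (g i) (f i)) @ G --> blin_comp g' f'.
Proof.
move=> gg ff; apply/cvgrPdist_le => e e0.
have : (fun i => `|g' - g i| * `|f i| + `|g'| * `|f' - f i|) @ G --> `|g' - g'| * `|f'| + `|g'| * `|f' - f'|.
  apply: cvgD; apply: cvgM; try exact: cvg_cst; apply: cvg_norm => //.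
    by apply: cvgB => //; exact: cvg_cst.
  by apply: cvgB => //; exact: cvg_cst.
rewrite !subrr !normr0 mul0r mulr0 addr0 => /cvgrPdist_le /(_ e e0); apply: filterS => i.
rewrite sub0r normrN ger0_norm ?addr_ge0 ?mulr_ge0//; apply: le_trans.
rewrite -(subrK (blin_comp g' (f i)) (blin_comp g' f')) -addrA -blin_compBr -blin_compBl.
apply: le_trans (ler_normD _ _) _; rewrite addrC; apply: lerD; exact: opnorm_comp.
Qed.

Lemma blin_sumE {R : realType} {X Y : normedModType R} {I : Type} (r : seq I) (f : I -> blin X Y) x :
  (\sum_(i <- r) f i) x = \sum_(i <- r) f i x.
Proof. exact: (big_morph (fun D : blin X Y => D x)). Qed.

Lemma is_diff_sum {R : realType} {X : normedModType R} {I : Type} (r : seq I) (f : I -> X -> R^o)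
  (df : I -> X -> R^o) x : (forall i, is_diff x (f i) (df i)) ->
  is_diff x (fun y => \sum_(i <- r) f i y) (fun y => \sum_(i <- r) df i y).
Proof.
move=> fd; elim: r => [|i r IH].
  by under eq_fun do rewrite big_nil; under [X in is_diff _ _ X]eq_fun do rewrite big_nil; exact: is_diff_cst.
under eq_fun do rewrite big_cons; under [X in is_diff _ _ X]eq_fun do rewrite big_cons.
exact: is_diffD.
Qed.

Section Adjoint.
Context {R : realType} {E : completeNormedModType R} {Y : normedModType R}.
Context {l m q : nat} (P : bolza E Y l m q) (x0 : R -> E) (u0 : R -> Y).
Local Notation T := (horizon P).
Local Notation U := (control_set P).
Local Notation Om := (state_domain P).
Local Notation f := (dynamics P).
Local Notation f0 := (running_payoff P).
Hypotheses (T0 : 0 < T) (oOm : open Om) (adm : admissible P x0 u0).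
Hypotheses (rf0 : forall i, regular_along P x0 (f0 i)) (rf : regular_along P x0 f).
Variable theta : 'rV[R]_l.

Local Notation F := (E * 'rV[R]_l)%type.
Local Notation aug_lin := (aug_lin P x0 u0).
Local Notation H := (hamiltonian P).

(** The right-hand side of the adjoint equation, written out so that its affine dependence on [p]
    and its limits in time are visible before it is identified with a differential of the
    Hamiltonian. *)
Definition adjoint_field (t : R) (p : blin E R) (z : Y) : blin E R :=
  - (\sum_i theta 0 i *: dF (fun x => f0 i t x z) (x0 t) + blin_comp p (dF (fun x => f t x z) (x0 t))).

Lemma adjoint_fieldE t p z : 0 <= t <= T -> U z ->
  adjoint_field t p z = - dF (fun xi => H t xi z p theta) (x0 t).
Proof.
move=> tT Uz; rewrite /adjoint_field; congr (- _); apply/esym/dF_eq.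
have df (G : normedModType R) (phi : R -> E -> Y -> G) : regular_along P x0 phi ->
    is_diff (x0 t) (fun x => phi t x z) (dF (fun x => phi t x z) (x0 t)).
  by move=> [_ _ h _ _]; apply: dF_is_diff; apply: h => //; rewrite in_itv.
have dfi := fun i => df _ _ (rf0 i).
have dff := df _ _ rf.
have dp x : is_diff x p p.
  by apply: DiffDef; [apply: linear_differentiable; exact: blin_continuous|apply: diff_lin; exact: blin_continuous].
have d1 := is_diff_sum (index_enum 'I_l) (fun i => is_diffZ (theta 0 i) (dfi i)).
have d2 := @is_diff_comp _ _ _ _ _ _ _ _ _ dff (dp _).
have [h1 h2] := is_diffD d1 d2; apply: DiffDef.
  by apply: h1.
rewrite h2; apply/funext => e; congr (_ + _).
exact/esym/blin_sumE.
Qed.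

Lemma adjoint_regulated p : continuous p ->
  regulated T setT (fun t => adjoint_field t (p t) (u0 t)).
Proof.
move=> cp; have ru0 := aug_u0 adm; have [uU _ _ _ _] := ru0.
apply: (regulated_comp (psi := fun t z => adjoint_field t (p t) z) T0 ru0) => t z G FG tT Uz Gt uz Gs.
apply: cvgN; apply: cvgD.
  apply: cvg_sumr => i; apply: cvgZl_tmp; exact: (regular_dF_lim (rf0 i)).
apply: cvg_blin_comp; last exact: (regular_dF_lim rf).
by apply: cvg_comp Gt _; exact: cp.
Qed.

Lemma adjoint_exists pT : exists p : R -> blin E R, [/\ continuous p, p T = pT &
  forall t, 0 <= t < T -> rderiv p t (adjoint_field t (p t) (u0 t))].
Proof.
have ru0 := aug_u0 adm.
have [K K0 HK] := cadlag_bounded (ltW T0) (regulated_cadlag (regular_dF_regulated T0 rf ru0)).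
apply: (@cauchy_problem _ _ (fun t p => adjoint_field t p (u0 t)) 0 T T (K + 1)).
- apply: geom_complete_blin; exact: (@geom_complete_complete R R^o).
- by rewrite lexx ltW.
- by rewrite ltr_wpDl.
- by move=> y cy; apply: regulated_cadlag; exact: adjoint_regulated.
move=> t p p' /andP[t0 tT].
have tT' : 0 <= t <= T by rewrite t0 ltW.
have -> : adjoint_field t p (u0 t) - adjoint_field t p' (u0 t) =
    - blin_comp (p - p') (dF (fun x => f t x (u0 t)) (x0 t)).
  by rewrite blin_compBl /adjoint_field; module R.
rewrite normrN; apply: le_trans (opnorm_comp _ _) _; rewrite mulrC ler_wpM2r//.
by apply: le_trans (HK t tT') _; rewrite lerDl.
Qed.

Variable p : R -> blin E R.
Hypotheses (cp : continuous p) (dp : forall t, 0 <= t < T -> rderiv p t (adjoint_field t (p t) (u0 t))).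

Lemma adjoint_PC1 : PC1 T setT p.
Proof. exact: (rderiv_PC1 T0 cp (adjoint_regulated cp) dp). Qed.

Lemma adjoint_equation t : 0 <= t <= T ->
  ext_derive T p t = - dF (fun xi => H t xi (u0 t) (p t) theta) (x0 t).
Proof.
move=> tT; have [uU _ _ _ _] := aug_u0 adm.
rewrite -adjoint_fieldE//; last exact: uU.
exact: (rderiv_ext_derive (G := setT) T0 cp (adjoint_regulated cp) dp).
Qed.

Lemma adjoint_duality (y : R -> F) s : 0 <= s < T -> continuous y ->
  (forall t, 0 <= t < T -> rderiv y t (aug_lin t (y t))) ->
  p s (y s).1 + dot theta (y s).2 = p T (y T).1 + dot theta (y T).2.
Proof.
move=> /andP[s0 sT] cy dy.
pose phi t : R^o := p t (y t).1 + dot theta (y t).2.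
have cphi : continuous phi.
  move=> t; apply: cvgD.
    apply: cvg_blin_eval; first exact: cp.
    by apply: (@cvg_comp _ _ _ y fst _ (nbhs (y t))); [exact: cy|exact: cvg_fst].
  apply: (@cvg_sumr R R^o) => i; apply: (@cvgMr R).
  apply: (@cvg_comp _ _ _ (fun t => (y t).2) (fun v : 'rV[R]_l => v 0 i) _ (nbhs (y t).2)).
    by apply: (@cvg_comp _ _ _ y snd _ (nbhs (y t))); [exact: cy|exact: cvg_snd].
  exact: coord_continuous.
suff : `|phi T - phi s| <= 0 * (T - s).
  by rewrite mul0r normr_le0 subr_eq0 => /eqP /esym.
apply: rderiv_lip (ltW sT) cphi _ => t /andP[st tT].
have t0T : 0 <= t < T by rewrite (le_trans s0 st).
exists 0; last by rewrite normr0.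
have d1 : rderiv (fun t => p t (y t).1 : R^o) t
    (adjoint_field t (p t) (u0 t) (y t).1 + p t (aug_lin t (y t)).1).
  apply: (@rderiv_bilin _ (blin E R) E R^o (fun p x => p x) 1 p (fun t => (y t).1)) => //.
  - by move=> p' x x'; rewrite linearB.
  - by move=> c p' x; rewrite linearZ.
  - by move=> p' x; rewrite mul1r; exact: le_opnorm.
  - exact: dp.
  - exact: (rderiv_fst (dy t t0T)).
have d2 : rderiv (fun t => dot theta (y t).2 : R^o) t (dot theta (aug_lin t (y t)).2).
  apply: (@rderiv_sum _ R^o) => i; apply: (@rderivZ _ R^o).
  exact: (rderiv_coord i (rderiv_snd (dy t t0T))).
have := rderivD d1 d2.
suff -> : adjoint_field t (p t) (u0 t) (y t).1 + p t (aug_lin t (y t)).1 + dot theta (aug_lin t (y t)).2 = 0 by [].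
rewrite -[adjoint_field _ _ _ _]/(- ((\sum_i theta 0 i *: dF (fun x => f0 i t x (u0 t)) (x0 t)) (y t).1
   + p t (dF (fun x => f t x (u0 t)) (x0 t) (y t).1))).
rewrite blin_sumE /dot /aug_lin/=; under [in X in _ + X]eq_bigr do rewrite mxE.
by rewrite opprD subrK addNr.
Qed.

Lemma hamiltonian_lim u t z (G : set_system R) : Filter G ->
  (forall t, 0 <= t <= T -> U (u t)) -> 0 <= t <= T -> U z -> G --> t -> u @ G --> z ->
  (\forall s \near G, 0 <= s <= T) ->
  (fun s => H s (x0 s) (u s) (p s) theta) @ G --> H t (x0 t) z (p t) theta.
Proof.
move=> FG uU tT Uz Gt uz Gs.
have cX0 := aug_cX0 T0 adm.
have X0Om s : 0 <= s <= T -> Om ((x0 \o clamp 0 T) s) by exact: (aug_X0Om adm).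
have -> : x0 t = (x0 \o clamp 0 T) t by rewrite /= clampE.
suff H1 : (fun s => H s ((x0 \o clamp 0 T) s) (u s) (p s) theta) @ G -->
    H t ((x0 \o clamp 0 T) t) z (p t) theta.
  apply: cvg_trans H1; apply: near_eq_cvg; apply: filterS Gs => s sT.
  by rewrite /= clampE.
apply: cvgD.
  apply: (@cvg_sumr R R^o) => i; apply: (@cvgMr R); exact: (regular_lim (rf0 i)).
apply: cvg_blin_eval; last exact: (regular_lim rf).
by apply: cvg_comp Gt _; exact: cp.
Qed.

End Adjoint.

Section MaximumPrinciple.
Context {R : realType} {E : completeNormedModType R} {Y : normedModType R}.
Context {l m q : nat} (P : bolza E Y l m q) (x0 : R -> E) (u0 : R -> Y).
Local Notation T := (horizon P).
Local Notation U := (control_set P).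
Local Notation Om := (state_domain P).
Local Notation f := (dynamics P).
Local Notation f0 := (running_payoff P).
Hypotheses (T0 : 0 < T) (oOm : open Om) (adm : admissible P x0 u0).
Hypotheses (rf0 : forall i, regular_along P x0 (f0 i)) (rf : regular_along P x0 f).
Variables (theta : 'rV[R]_l) (p : R -> blin E R).
Hypothesis cp : continuous p.
Local Notation H := (hamiltonian P).

Hypothesis mp : forall t z, 0 <= t < T -> U z ->
  H t (x0 t) z (p t) theta <= H t (x0 t) (u0 t) (p t) theta.

Let near_left t : 0 < t <= T -> \forall s \near t^'-, 0 <= s < T /\ 0 <= s <= T.
Proof.
move=> /andP[t0 tT]; near=> s.
have s0 : 0 < s by near: s; exact: nbhs_left_gt.
have st : s < t by near: s; exact: nbhs_left_lt.
by rewrite (ltW s0) (lt_le_trans st tT) ltW// (lt_le_trans st tT).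
Unshelve. all: by end_near. Qed.

(** At [T] both sides are limits from the left of the inequality at earlier times, because the
    control at [T] equals its left limit. *)
Lemma maximum_principle t z : 0 <= t <= T -> U z ->
  H t (x0 t) z (p t) theta <= H t (x0 t) (u0 t) (p t) theta.
Proof.
move=> /andP[t0]; rewrite le_eqVlt => /predU1P[->|tT Uz]; last by apply: mp; rewrite ?t0.
move=> Uz; have [uU _ _ uT _] := aug_u0 adm.
have TT : 0 <= T <= T by rewrite lexx ltW.
have T1 : 0 < T <= T by rewrite lexx T0.
have nT := near_left T1; have leT : T^'- --> T by move=> A /near_to_left.
have nT' : \forall s \near T^'-, 0 <= s <= T by apply: filterS nT => s [].
apply: (@ler_cvg_to _ T^'- _ R (fun s => H s (x0 s) z (p s) theta) (fun s => H s (x0 s) (u0 s) (p s) theta)).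
- exact: (hamiltonian_lim T0 adm rf0 rf cp (u := fun=> z) _ (fun _ _ => Uz) TT Uz leT (cvg_cst _) nT').
- exact: (hamiltonian_lim T0 adm rf0 rf cp _ uU TT (uU _ TT) leT uT nT').
- by apply: filterS nT => s [sT _]; exact: mp.
Qed.

(** Only jumps of the control are at issue. If [z] is its left limit at [t], the maximum condition
    at [t] bounds the Hamiltonian at [z] by the one at [u0 t]; the maximum condition at earlier
    times, tested with the constant value [u0 t], gives the converse in the limit. *)
Lemma hamiltonian_continuous :
  {within `[0, T], continuous (fun t => H t (x0 t) (u0 t) (p t) theta)}.
Proof.
have [uU ur ul _ _] := aug_u0 adm.
pose k t : R^o := H t (x0 t) (u0 t) (p t) theta.
have right t : 0 <= t < T -> k @ t^'+ --> k t.
  move=> tT; have tT' : 0 <= t <= T by case/andP: tT => -> /ltW ->.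
  have nt : \forall s \near t^'+, 0 <= s <= T.
    have [t0 t1] := andP tT; near=> s.
    have st : t < s by near: s; exact: nbhs_right_gt.
    rewrite (le_trans t0 (ltW st)) ltW//; near: s; exact: nbhs_right_lt.
  exact: (hamiltonian_lim T0 adm rf0 rf cp _ uU tT' (uU _ tT') (@near_to_right _ t) (ur t tT) nt).
have left t : 0 < t <= T -> k @ t^'- --> k t.
  move=> tT; have tT' : 0 <= t <= T by case/andP: tT => /ltW -> ->.
  have nt : \forall s \near t^'-, 0 <= s <= T by apply: filterS (near_left tT) => s [].
  have [z Uz uz] := ul t tT.
  have kz : k @ t^'- --> (H t (x0 t) z (p t) theta : R^o).
    exact: (hamiltonian_lim T0 adm rf0 rf cp _ uU tT' Uz (@near_to_left _ t) uz nt).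
  suff -> : k t = H t (x0 t) z (p t) theta by [].
  apply/eqP; rewrite eq_le (maximum_principle tT' Uz) andbT.
  apply: (@ler_cvg_to _ t^'- _ R (fun s => H s (x0 s) (u0 t) (p s) theta) k) => //.
  - exact: (hamiltonian_lim T0 adm rf0 rf cp (u := fun=> u0 t) _ (fun _ _ => uU _ tT') tT' (uU _ tT') (@near_to_left _ t) (cvg_cst _) nt).
  - by apply: filterS (near_left tT) => s [sT _]; apply: mp => //; exact: uU.
apply/subspace_continuousP => t /=; rewrite in_itv/= => tT.
apply/cvgrPdist_lt => e e0; have [t0 t1] := andP tT.
have [d1 d10 H1] : exists2 d, 0 < d & forall s, t < s < t + d -> s <= T -> `|k t - k s| < e.
  move: t1; rewrite le_eqVlt => /predU1P[tT1|t1].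
    by exists 1 => // s /andP[ts _]; rewrite leNgt -tT1 ts.
  have /cvgrPdist_lt /(_ e e0) /near_rightP[d d0 Hd] := right t (introT andP (conj t0 t1)).
  by exists d => // s /Hd.
have [d2 d20 H2] : exists2 d, 0 < d & forall s, t - d < s < t -> 0 <= s -> `|k t - k s| < e.
  move: t0; rewrite le_eqVlt => /predU1P[tT1|t0].
    by exists 1 => // s /andP[_ ts]; rewrite leNgt tT1 ts.
  have /cvgrPdist_lt /(_ e e0) /near_leftP[d d0 Hd] := left t (introT andP (conj t0 t1)).
  by exists d => // s /Hd.
rewrite near_withinE; exists (Num.min d1 d2); first by rewrite /= lt_min d10.
move=> s; rewrite /= lt_min => /andP[s1 s2]; rewrite in_itv/= => /andP[s0 sT].
have [st|st|<-] := ltgtP s t; last by rewrite subrr normr0.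
- apply: H2 => //; rewrite st andbT; move: s2; rewrite ger0_norm ?subr_ge0 ?ltW//; lra.
- apply: H1 => //; rewrite st; move: s1; rewrite ltr0_norm ?subr_lt0//; lra.
Unshelve. all: by end_near. Qed.

End MaximumPrinciple.

(** * Nonvanishing of the payoff multipliers *)

Section Nontriviality.
Context {R : realType} {E : completeNormedModType R} {Y : normedModType R}.
Context {l m q : nat} (P : bolza E Y l m q) (x0 : R -> E) (u0 : R -> Y).
Local Notation T := (horizon P).
Local Notation U := (control_set P).

(* With theta = 0 the maximum condition at time T makes u0 T a local maximum of
   p T o f(T, x0 T, _), so p T vanishes on the range of the control differential. *)
Lemma theta_neq0 theta (lambda : 'rV[R]_m) (mu : 'rV[R]_q) p :
  0 < T -> nbhs (u0 T) U -> gateaux_differentiable (dynamics P T (x0 T)) (u0 T) ->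
  lin_indep (fun k : 'I_m + 'I_q =>
    let dfu := dG (dynamics P T (x0 T)) (u0 T) in
    match k with
    | inl a => blin_comp (dH (ineq_constraint P a) (x0 T)) dfu
    | inr b => blin_comp (dH (eq_constraint P b) (x0 T)) dfu
    end) ->
  pontryagin P x0 u0 theta lambda mu p -> theta != 0.
Proof.
move=> T0 nU fG indep [NN _ _ TC _ MP _]; apply/eqP => th0.
have TT : T \in `[0, T] by rewrite in_itv/= lexx ltW.
set dfu := dG _ _ in indep.
have dfuP : is_gateaux (dynamics P T (x0 T)) (u0 T) dfu := dG_gateaux fG.
have ham z : hamiltonian P T (x0 T) z (p T) theta = p T (dynamics P T (x0 T) z).
  by rewrite /hamiltonian th0 big1 ?add0r// => i _; rewrite mxE mul0r.
have le0 h : p T (dfu h) <= 0.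
  have lim : (fun t => p T (t^-1 *: (dynamics P T (x0 T) (u0 T + t *: h) - dynamics P T (x0 T) (u0 T))))
      @ (0 : R)^'+ --> p T (dfu h).
    apply: cvg_comp; first exact: dfuP h.
    exact: (@blin_continuous _ _ _ (p T)).
  apply: (cvgr_to_le lim).
  have cu : (fun t : R => u0 T + t *: h) @ (0 : R)^'+ --> u0 T.
    have : (fun t : R => u0 T + t *: h) @ nbhs (0 : R) --> u0 T + 0 *: h.
      by apply: cvgD; [exact: cvg_cst|apply: cvgZr_tmp; exact: cvg_id].
    by rewrite scale0r addr0 => c A /c /near_to_right.
  have nUt : \forall t \near (0 : R)^'+, U (u0 T + t *: h) := cu _ nU.
  near=> t; have Ut : U (u0 T + t *: h) by near: t.
  have t0 : 0 < t by near: t; exact: nbhs_right_gt.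
  have := MP T TT _ Ut; rewrite !ham => le.
  rewrite functionalZ; apply: mulr_ge0_le0; first by rewrite invr_ge0 ltW.
  by rewrite (linearB (p T)) subr_le0.
have eq0 h : p T (dfu h) = 0.
  apply/eqP; rewrite eq_le le0/=; have := le0 (- h).
  by rewrite linearN linearN oppr_le0.
pose c (k : 'I_m + 'I_q) := match k with inl a => lambda 0 a | inr b => mu 0 b end.
have c0 : forall k, c k = 0.
  apply: indep; rewrite big_sumType /=; apply/val_inj/funext => h /=.
  have := eq0 h; rewrite -TC big1 ?add0r; last by move=> i _; rewrite th0 mxE scale0r.
  move=> e0; apply: etrans e0.
  rewrite -[RHS]/((\sum_a lambda 0 a *: dH (ineq_constraint P a) (x0 T)) (dfu h) +
    (\sum_b mu 0 b *: dH (eq_constraint P b) (x0 T)) (dfu h)) !blin_sumE.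
  rewrite -[LHS]/((\sum_a lambda 0 a *: blin_comp (dH (ineq_constraint P a) (x0 T)) dfu) h +
    (\sum_b mu 0 b *: blin_comp (dH (eq_constraint P b) (x0 T)) dfu) h) !blin_sumE.
  by congr (_ + _).
have la0 : lambda = 0 by apply/rowP => a; rewrite mxE; exact: (c0 (inl a)).
have mu0 : mu = 0 by apply/rowP => b; rewrite mxE; exact: (c0 (inr b)).
by move: NN; rewrite th0 la0 mu0 eqxx.
Unshelve. all: by end_near. Qed.

End Nontriviality.

Unset Implicit Arguments.

Theorem corollary4p12 (R : realType) (E : completeNormedModType R)
    (Y : normedModType R) (l m q : nat) (P : bolza E Y l m q)
    (x0 : R -> E) (u0 : R -> Y) :
  let T := horizon P in
  (0 < l)%N -> (0 < m)%N -> (0 < q)%N ->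
  0 < T -> open (state_domain P) -> state_domain P (initial_state P) ->
  pareto_optimal P x0 u0 ->
  (forall i, regular_along P x0 (running_payoff P i)) ->
  regular_along P x0 (dynamics P) ->
  (forall i, hadamard_differentiable (terminal_payoff P i) (x0 T)) ->
  (forall a, hadamard_differentiable (ineq_constraint P a) (x0 T)) ->
  (forall b,
    (exists2 N, nbhs (x0 T) N & {within N, continuous (eq_constraint P b)}) /\
    hadamard_differentiable (eq_constraint P b) (x0 T)) ->
  nbhs (u0 T) (control_set P) ->
  gateaux_differentiable (dynamics P T (x0 T)) (u0 T) ->
  lin_indep (fun k : 'I_m + 'I_q =>
    let dfu := dG (dynamics P T (x0 T)) (u0 T) in
    match k with
    | inl a => blin_comp (dH (ineq_constraint P a) (x0 T)) dfu
    | inr b => blin_comp (dH (eq_constraint P b) (x0 T)) dfu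
    end) ->
  (exists (theta : 'rV[R]_l) (lambda : 'rV[R]_m) (mu : 'rV[R]_q)
     (p : R -> blin E R),
     PC1 T setT p /\ pontryagin P x0 u0 theta lambda mu p) /\
  (forall (theta : 'rV[R]_l) (lambda : 'rV[R]_m) (mu : 'rV[R]_q)
     (p : R -> blin E R),
     PC1 T setT p -> pontryagin P x0 u0 theta lambda mu p -> theta != 0).
Proof.
move=> T l0 m0 q0 T0 oOm xi0 opt rf0 rf g0D gD hD nU fG indep.
split; last by move=> theta lambda mu p _; exact: theta_neq0.
have adm : admissible P x0 u0 := opt.1.
have TT : 0 <= T <= T by rewrite lexx ltW.
(* Pairs that are not needles also receive a solution, since continuity and the linearised equation
   are required for every index. *)
have /choice[y Hy] : forall nu : R * Y, exists y : R -> E * 'rV[R]_l, [/\ continuous y,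
    forall t, 0 <= t < T -> rderiv y t (aug_lin P x0 u0 t (y t)) &
    needle P nu -> y nu.1 = needle_impulse P x0 u0 nu].
  move=> nu; have [[/andP[s0 sT] Uz]|nP] := pselect (needle P nu).
    have sTT : 0 <= nu.1 <= T by rewrite s0 ltW.
    have [y [cy ys dy]] := linearized_flow T0 opt rf0 rf (needle_impulse P x0 u0 nu) sTT.
    by exists y.
  by have [y [cy _ dy]] := linearized_flow T0 opt rf0 rf 0 TT; exists y.
have [theta [lambda [mu [nz th0 la0 slack le0]]]] := multipliers l0 q0 T0 oOm opt rf0 rf g0D gD hD
  (fun nu => let: And3 h _ _ := Hy nu in h) (fun nu => let: And3 _ h _ := Hy nu in h)
  (fun nu => let: And3 _ _ h := Hy nu in h).
pose pT : blin E R := \sum_i theta 0 i *: dH (terminal_payoff P i) (x0 T) +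
  \sum_a lambda 0 a *: dH (ineq_constraint P a) (x0 T) +
  \sum_b mu 0 b *: dH (eq_constraint P b) (x0 T).
have pTE (e : E * 'rV[R]_l) : dot theta (terminal_dir P x0 e).1.1 + dot lambda (terminal_dir P x0 e).1.2 +
    dot mu (terminal_dir P x0 e).2 = pT e.1 + dot theta e.2.
  rewrite -[pT e.1]/((\sum_i theta 0 i *: dH (terminal_payoff P i) (x0 T)) e.1 +
    (\sum_a lambda 0 a *: dH (ineq_constraint P a) (x0 T)) e.1 +
    (\sum_b mu 0 b *: dH (eq_constraint P b) (x0 T)) e.1) !blin_sumE.
  have -> : dot theta (terminal_dir P x0 e).1.1 =
      \sum_i theta 0 i * dH (terminal_payoff P i) (x0 T) e.1 + dot theta e.2.
    by rewrite /dot -big_split; apply: eq_bigr => i _; rewrite !mxE mulrDr.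
  have -> : dot lambda (terminal_dir P x0 e).1.2 = \sum_a lambda 0 a * dH (ineq_constraint P a) (x0 T) e.1.
    by apply: eq_bigr => a _; rewrite !mxE.
  have -> : dot mu (terminal_dir P x0 e).2 = \sum_b mu 0 b * dH (eq_constraint P b) (x0 T) e.1.
    by apply: eq_bigr => b _; rewrite !mxE.
  by rewrite (addrAC _ (dot theta e.2)) (addrAC _ (dot theta e.2)).
have [p [cp pTT dp]] := adjoint_exists T0 adm rf0 rf theta pT.
have mp t z : 0 <= t < T -> control_set P z ->
    hamiltonian P t (x0 t) z (p t) theta <= hamiltonian P t (x0 t) (u0 t) (p t) theta.
  move=> tT Uz; have nuP : needle P (t, z) by split.
  have [cy dy /(_ nuP) ys] := Hy (t, z).
  (* Duality carries the inequality from the horizon back to time [t], where [y] is the jump of the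
     augmented field and the pairing is the increment of the Hamiltonian. *)
  have := le0 (t, z) nuP; rewrite pTE -pTT.
  rewrite -(adjoint_duality cp dp tT cy dy) ys; suff -> : p t (needle_impulse P x0 u0 (t, z)).1 +
      dot theta (needle_impulse P x0 u0 (t, z)).2 =
      hamiltonian P t (x0 t) z (p t) theta - hamiltonian P t (x0 t) (u0 t) (p t) theta by rewrite subr_le0.
  rewrite /hamiltonian /needle_impulse /aug_field /= linearB /dot.
  have -> : \sum_i theta 0 i * (\row_i running_payoff P i t (x0 t) z -
      \row_i running_payoff P i t (x0 t) (u0 t)) 0 i =
      \sum_i theta 0 i * running_payoff P i t (x0 t) z - \sum_i theta 0 i * running_payoff P i t (x0 t) (u0 t).
    by rewrite -sumrB; apply: eq_bigr => i _; rewrite !mxE mulrBr.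
  ring.
exists theta, lambda, mu, p; split; first exact: adjoint_PC1 dp.
split => //.
- by move=> t; rewrite in_itv/= => tT; exact: adjoint_equation dp _ tT.
- by move=> t; rewrite in_itv/= => tT z; exact: maximum_principle.
- exact: hamiltonian_continuous.
Qed.
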